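(* The functions $g_1,g_2,g_3$ are algebraically independent over $\mathbb C$, and $M$ is freely generated by $g_1,g_2,g_3$ as a $\mathbb C$-algebra. Moreover, for $m\in\mathbb N$ and $n\in\mathbb N_0$, $M^n_m$ is the set of functions $P(g_1,g_2,g_3)$ where $P\in\mathbb C[X_1,X_2,X_3]$ is homogeneous of degree $m$ for the grading $\deg X_i=2i$ ($i=1,2,3$) and has weighted degree at most $2n$ in $X_1$ (i.e. $X_1$ occurs with exponent at most $n$).
   Context: Let $\mathbb H=\{z\in\mathbb C:\operatorname{Im} z>0\}$. For a real $2\times2$ matrix $A=\begin{pmatrix}a_A&b_A\\ c_A&d_A\end{pmatrix}$ with $\det A>0$ put $j(A,z)=c_Az+d_A$, $Az=\frac{a_Az+b_A}{c_Az+d_A}$ and, for $m\in\mathbb Z$, $(f|_mA)(z)=(\det A)^{m-1}j(A,z)^{-m}f(Az)$. For $m\in\mathbb Z$ and $n\in\mathbb N_0$, a holomorphic function $f:\mathbb H\to\mathbb C$ is called an $M^n_m$-function if there exist holomorphic functions $f_0,\dots,f_n$ on $\mathbb H$ such that $f|_mA=\sum_{i=0}^n\binom ni c_A^i\,j(A,z)^{-i}f_i$ for all $A\in SL(2,\mathbb Z)$, and each $f_i(z)$ has a finite limit in $\mathbb C$ as $\operatorname{Im} z\to+\infty$. $M^n_m$ denotes the set of $M^n_m$-functions (so $M^0_m$ is the space of classical modular forms of weight $m$ for $SL(2,\mathbb Z)$), and $M=\sum_{m\in\mathbb Z,\,n\in\mathbb N_0}M^n_m$ (a $\mathbb C$-algebra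 of functions on $\mathbb H$). Let $q=e^{2\pi iz}$, $\sigma_r(n)=\sum_{d\mid n}d^r$, and define the Eisenstein series $g_1=a_1\big(1-24\sum_{n\ge1}\sigma_1(n)q^n\big)$, $g_2=a_2\big(1+240\sum_{n\ge1}\sigma_3(n)q^n\big)$, $g_3=a_3\big(1-504\sum_{n\ge1}\sigma_5(n)q^n\big)$, where $a_1=\frac{2\pi i}{12}$, $a_2=12\left(\frac{2\pi i}{12}\right)^2$, $a_3=8\left(\frac{2\pi i}{12}\right)^3$. One has $g_1\in M^1_2$, $g_2\in M^0_4$, $g_3\in M^0_6$. *)

(* Defs.v *)
From HB Require Import structures.
From mathcomp Require Import all_boot all_order all_algebra.
From mathcomp Require Import all_classical all_reals all_analysis.
From mathcomp Require Import complex.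
(* The notations of mpoly clash with those of MathComp-Analysis. *)
From mathcomp Require Import -(notations) mpoly.

Set Implicit Arguments.
Unset Strict Implicit.
Unset Printing Implicit Defensive.

Import Order.TTheory GRing.Theory Num.Theory.
Import numFieldNormedType.Exports.

Local Open Scope classical_set_scope.
Local Open Scope ring_scope.
Local Open Scope complex_scope.

(* Functions on the upper half-plane are represented by total functions on
   R[i]; only their values on [upper] matter, and they are identified when
   they agree on [upper].  R[i]^o is R[i] with its topology as a normed space
   over itself, so [derivable _ z 1] is complex differentiability at z. *)

Definition upper (R : realType) : set R[i] := [set z | 0 < complex.Im z].

Definition eq_upper (R : realType) (f g : R[i] -> R[i]) : Prop :=
  forall z, @upper R z -> f z = g z.

Definition holomorphic (R : realType) (f : R[i] -> R[i]) : Prop :=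
  forall z, @upper R z -> derivable (f : R[i]^o -> R[i]^o) (z : R[i]^o) 1.

(* The filter "Im z -> +oo", uniformly in Re z. *)
Definition Im_pinfty (R : realType) : set_system R[i] :=
  [set P | exists Y : R, forall z : R[i], Y < complex.Im z -> P z].

#[global] Instance Im_pinfty_filter (R : realType) : ProperFilter (@Im_pinfty R).
Proof.
apply: Build_ProperFilter.
- case=> Y /(_ (0 +i* (Y + 1))); apply => /=.
  by rewrite ltrDl ltr01.
- split=> [|P Q [Y PY] [Z QZ]|P Q PQ [Y PY]]; first by exists 0.
  + exists (Num.max Y Z) => z; rewrite gt_max => /andP[Yz Zz].
    by split; [exact: PY | exact: QZ].
  + by exists Y => z /PY /PQ.
Qed.

Definition finite_limit_at_cusp (R : realType) (f : R[i] -> R[i]) : Prop :=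
  exists l : R[i], (f : R[i] -> R[i]^o) @ @Im_pinfty R --> (l : R[i]^o).

Definition autfactor (R : realType) (A : 'M[R]_2) (z : R[i]) : R[i] :=
  (A 1 0)%:C * z + (A 1 1)%:C.

Definition moebius (R : realType) (A : 'M[R]_2) (z : R[i]) : R[i] :=
  ((A 0 0)%:C * z + (A 0 1)%:C) / autfactor A z.

Definition slash (R : realType) (m : int) (A : 'M[R]_2) (f : R[i] -> R[i])
    (z : R[i]) : R[i] :=
  (\det A)%:C ^ (m - 1) * autfactor A z ^ (- m) * f (moebius A z).

(* f \in M^n_m *)
Definition Mnm (R : realType) (n : nat) (m : int) (f : R[i] -> R[i]) : Prop :=
  holomorphic f /\
  exists F : 'I_n.+1 -> R[i] -> R[i],
    [/\ forall i, holomorphic (F i),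
        forall A0 : 'M[int]_2, \det A0 = 1 ->
          let A : 'M[R]_2 := map_mx intr A0 in
          eq_upper (slash m A f)
            (fun z => \sum_(i < n.+1) 'C(n, i)%:R * (A 1 0)%:C ^+ i
                                      * autfactor A z ^- i * F i z)
      & forall i, finite_limit_at_cusp (F i)].

(* f \in M, the sum of the spaces M^n_m over all m : int and n : nat *)
Definition Msum (R : realType) (f : R[i] -> R[i]) : Prop :=
  exists (k : nat) (n : 'I_k -> nat) (m : 'I_k -> int)
         (h : 'I_k -> R[i] -> R[i]),
    (forall i, Mnm (n i) (m i) (h i)) /\
    eq_upper f (fun z => \sum_(i < k) h i z).

Definition cexp (R : realType) (z : R[i]) : R[i] :=
  (expR (complex.Re z))%:C * (cos (complex.Im z) +i* sin (complex.Im z)).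

Definition two_pi_i (R : realType) : R[i] := 2 * (@pi R)%:C * (0 +i* 1).

Definition qpar (R : realType) (z : R[i]) : R[i] := cexp (two_pi_i R * z).

Definition sigma (r n : nat) : nat := (\sum_(d <- divisors n) d ^ r)%N.

(* \sum_(n >= 1) sigma r n * q ^ n, where q = e ^ (2 pi i z) *)
Definition sigma_series (R : realType) (r : nat) (z : R[i]) : R[i] :=
  limn (series (fun k => (sigma r k.+1)%:R * qpar z ^+ k.+1)
        : nat -> R[i]^o).

Definition g1 (R : realType) (z : R[i]) : R[i] :=
  (two_pi_i R / 12) * (1 - 24 * sigma_series 1 z).

Definition g2 (R : realType) (z : R[i]) : R[i] :=
  (12 * (two_pi_i R / 12) ^+ 2) * (1 + 240 * sigma_series 3 z).

Definition g3 (R : realType) (z : R[i]) : R[i] :=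
  (8 * (two_pi_i R / 12) ^+ 3) * (1 - 504 * sigma_series 5 z).

Definition gs (R : realType) : 'I_3 -> R[i] -> R[i] :=
  tnth [tuple @g1 R; @g2 R; @g3 R].

(* The function P(g_0, ..., g_(k-1)) *)
Definition peval (R : realType) (k : nat) (g : 'I_k -> R[i] -> R[i])
    (P : mpoly.mpoly k R[i]) (z : R[i]) : R[i] :=
  mpoly.meval (fun i => g i z) P.

Definition algebraically_independent (R : realType) (k : nat)
    (g : 'I_k -> R[i] -> R[i]) : Prop :=
  forall P : mpoly.mpoly k R[i], eq_upper (peval g P) (fun=> 0) -> P = 0.

(* P |-> P(g) is a bijection from R[i][X_0, ..., X_(k-1)] onto M, modulo
   [eq_upper]. *)
Definition freely_generated (R : realType) (k : nat)
    (M : (R[i] -> R[i]) -> Prop) (g : 'I_k -> R[i] -> R[i]) : Prop :=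
  (forall P : mpoly.mpoly k R[i], M (peval g P)) /\
  (forall f, M f -> exists! P : mpoly.mpoly k R[i], eq_upper f (peval g P)).

(* The grading deg X_i = 2 i of the 1-indexed variables X_1, ..., X_k. *)
Definition wdeg (k : nat) (a : mpoly.multinom k) : nat :=
  (\sum_(i < k) 2 * i.+1 * a i)%N.

Lemma wdeg0 (k : nat) : @wdeg k mpoly.mnm0 = 0%N.
Proof. by rewrite /wdeg big1 // => i _; rewrite mpoly.mnm0E muln0. Qed.

Lemma wdegD (k : nat) :
  {morph @wdeg k : a b / mpoly.mnm_add a b >-> (a + b)%N}.
Proof.
move=> a b; rewrite /wdeg -big_split /=; apply: eq_bigr => i _.
by rewrite mpoly.mnmDE mulnDr.
Qed.

HB.instance Definition _ (k : nat) :=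
  mpoly.isMeasure.Build k (@wdeg k) (@wdeg0 k) (@wdegD k).

(* Main.v *)
(* The laws of the Eisenstein series under [z -> -1/z] come from lattice sums: the
   Lipschitz formulas, obtained by iterating the duplication identity of
   [sum_k (z + k)^-r], identify the [q]-series with double sums over the lattice,
   and in weight 2 a telescoping correction makes the double sum absolutely
   convergent and produces the anomaly [g1 | A = g1 + c / j].  A Cauchy formula for
   periodic functions (Goursat on rectangles) shows that a form vanishing at the
   cusp is divisible by [q], hence by the discriminant [Delta], and that a cusp
   form of weight 0 is zero.  Subtracting monomials in [g2], [g3] and dividing by
   [Delta] then expresses every modular form as a polynomial in [g2], [g3].  For
   [f] in [M^n_m] the top coefficient [f_n] is modular of weight [m - 2 n] and
   [f - f_n g1^n] lies in [M^(n-1)_m], which gives the description of [M^n_m] by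
   induction on [n].  A relation [P(g1, g2, g3) = 0] transforms under [SL(2, Z)]
   into [P(j^2 g1 + c j, j^4 g2, j^6 g3) = 0] for infinitely many [j] and [c];
   since [g2^3 / g3^2] takes infinitely many values, [P = 0]. *)
Require Import Defs.
From mathcomp Require Import all_boot all_order all_algebra.
From mathcomp Require Import all_classical all_reals all_analysis.
From mathcomp Require Import complex.
From mathcomp Require Import -(notations) mpoly.
From mathcomp Require Import ring lra zify.

Set Implicit Arguments.
Unset Strict Implicit.
Unset Printing Implicit Defensive.

Import Order.TTheory GRing.Theory Num.Theory.
Import numFieldNormedType.Exports.

Local Open Scope classical_set_scope.
Local Open Scope ring_scope.
Local Open Scope complex_scope.

(** Neither the valence formula nor a fundamental domain is used. Their role is played by [Delta]:
    being an exponential times [q] it never vanishes, and dividing by it lowers the weight by 12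
    until the form must be zero. That a cusp form of weight 0 is zero needs no maximum principle
    either, since a bound on one horizontal line reproduces itself with a factor 1/2. The lattice
    sums start from the functions p(q) / (1 - q)^w with Eulerian numerators p. They satisfy the same
    duplication relation as sum_k (z + k)^-w, so the value at z is a rescaled sum over the points (z
    + j) / 2^n, where in the limit only the pole at 0 counts; this replaces the partial fractions of
    the cotangent. The same argument at z = 0 gives the zeta values, hence the constant terms of the
    Eisenstein series. Since the inverse of 0 is 0, lattice and zeta sums can run over all integers,
    the origin contributing nothing. *)

Notation nc := (@Normc.normc _).

(** * Limits and derivatives of complex functions *)

Section ComplexNorm.
Context {R : realType}.
Implicit Types (z w : R[i]) (x y e : R).

(** The norm of [R[i]] takes its values in [R[i]]; [nc] is the same modulus as a real number, so
    that estimates are within reach of [lra] and [nra]. *)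
Lemma norm_nc z : `|z| = (nc z)%:C.
Proof. by []. Qed.

Lemma nc_ge0 z : 0 <= nc z.
Proof. by case: z => a b; exact: sqrtr_ge0. Qed.

Lemma nc0 : nc (0 : R[i]) = 0.
Proof. exact: Normc.normc0. Qed.

Lemma nc1 : nc (1 : R[i]) = 1.
Proof. exact: Normc.normc1. Qed.

Lemma ncM z w : nc (z * w) = nc z * nc w.
Proof. exact: Normc.normcM. Qed.

Lemma ncV z : nc z^-1 = (nc z)^-1.
Proof. exact: Normc.normcV. Qed.

Lemma ncX z n : nc (z ^+ n) = nc z ^+ n.
Proof. by elim: n => [|n IH]; rewrite ?expr0 ?nc1 // !exprS ncM IH. Qed.

Lemma ncN z : nc (- z) = nc z.
Proof. by case: z => a b /=; rewrite !sqrrN. Qed.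

Lemma ncD z w : nc (z + w) <= nc z + nc w.
Proof. by have := ler_normD z w; rewrite !norm_nc -rmorphD lecR. Qed.

Lemma ncB z w : nc (z - w) <= nc z + nc w.
Proof. by rewrite -(ncN w) ncD. Qed.

Lemma nc_distC z w : nc (z - w) = nc (w - z).
Proof. by rewrite -ncN opprB. Qed.

Lemma nc_eq0 z : (nc z == 0) = (z == 0).
Proof.
by apply/eqP/eqP => [/Normc.eq0_normc //|->]; exact: nc0.
Qed.

Lemma nc_gt0 z : (0 < nc z) = (z != 0).
Proof. by rewrite lt_def nc_ge0 andbT nc_eq0. Qed.

Lemma nc_real x : nc x%:C = `|x|.
Proof. by rewrite /= expr0n /= addr0 sqrtr_sqr. Qed.

Lemma nc_nat n : nc (n%:R : R[i]) = n%:R.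
Proof. by rewrite -(rmorph_nat (real_complex R)) nc_real ger0_norm. Qed.

Lemma ler_ncB z w : nc z - nc w <= nc (z - w).
Proof. by rewrite lerBlDr -{1}(subrK w z) ncD. Qed.

Lemma Re_le_nc z : `|complex.Re z| <= nc z.
Proof.
case: z => a b /=; rewrite -sqrtr_sqr ler_wsqrtr // lerDl sqr_ge0 //.
Qed.

Lemma Im_le_nc z : `|complex.Im z| <= nc z.
Proof.
case: z => a b /=; rewrite -sqrtr_sqr ler_wsqrtr // lerDr sqr_ge0 //.
Qed.

Lemma nc_le_ReIm z : nc z <= `|complex.Re z| + `|complex.Im z|.
Proof.
case: z => a b.
have E : a +i* b = a%:C + b%:C * 'i by rewrite /real_complex_def; simpc.
rewrite {1}E; apply: le_trans (ncD _ _) _; rewrite ncM !nc_real.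
by rewrite [nc 'i]/= expr0n /= add0r expr1n sqrtr1 mulr1.
Qed.

Lemma nc_sum (I : Type) (r : seq I) (P : pred I) (F : I -> R[i]) :
  nc (\sum_(i <- r | P i) F i) <= \sum_(i <- r | P i) nc (F i).
Proof.
elim/big_rec2: _ => [|i y1 y2 _ h]; first by rewrite nc0.
by apply: le_trans (ncD _ _) _; rewrite lerD2l.
Qed.

End ComplexNorm.

Section ComplexTopology.
Context {R : realType}.
Local Notation C := R[i].

(* Sealing the convergence statements in an inductive type keeps unification
   from unfolding the topologies of R[i] and R[i]^o. *)
Variant ccvg (T : Type) (F : set_system T) (f : T -> C) (l : C) : Prop :=
  CCvg of (f : T -> C^o) @ F --> (l : C^o).

Lemma cvgCP (T : Type) (F : set_system T) {FF : Filter F} (f : T -> C) (l : C) :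
  ccvg F f l <->
  forall e : R, 0 < e -> \forall t \near F, nc (f t - l) < e.
Proof.
split=> [[/cvgrPdist_lt h] e e0|h].
  have : 0 < e%:C :> C by rewrite ltcR.
  by move=> /h; apply: filterS => t; rewrite norm_nc nc_distC ltcR.
split; apply/cvgrPdist_lt => e e0.
have er : e = (complex.Re e)%:C by rewrite RRe_real // realE (ltW e0).
have e0' : 0 < complex.Re e by move: e0; rewrite {1}er ltcR.
move: (h _ e0'); apply: filterS => t.
by rewrite norm_nc nc_distC er ltcR.
Qed.

Section CcvgTheory.
Context {T : Type} {F : set_system T} {FF : Filter F}.
Implicit Types (f g : T -> C).

Lemma ccvg_cst (a : C) : ccvg F (fun=> a) a.
Proof. by split; exact: (@cvg_cst C^o). Qed.

Lemma ccvgD f g a b : ccvg F f a -> ccvg F g b -> ccvg F (fun t => f t + g t) (a + b).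
Proof. by move=> [hf] [hg]; split; exact: (@cvgD C C^o T F FF f g a b hf hg). Qed.

Lemma ccvgN f a : ccvg F f a -> ccvg F (fun t => - f t) (- a).
Proof. by move=> [hf]; split; exact: (@cvgN C C^o T F FF f a hf). Qed.

Lemma ccvgB f g a b : ccvg F f a -> ccvg F g b -> ccvg F (fun t => f t - g t) (a - b).
Proof. by move=> hf hg; apply: ccvgD => //; exact: ccvgN. Qed.

Lemma ccvgM f g a b : ccvg F f a -> ccvg F g b -> ccvg F (fun t => f t * g t) (a * b).
Proof. by move=> [hf] [hg]; split; exact: (@cvgM C T F FF f g a b hf hg). Qed.

Lemma ccvgV f a : a != 0 -> ccvg F f a -> ccvg F (fun t => (f t)^-1) a^-1.
Proof. by move=> a0 [hf]; split; exact: (@cvgV C T F FF f a a0 hf). Qed.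

Lemma ccvgX f a n : ccvg F f a -> ccvg F (fun t => f t ^+ n) (a ^+ n).
Proof.
move=> h; elim: n => [|n IH]; first exact: ccvg_cst.
rewrite exprS (_ : (fun t => _) = (fun t => f t * f t ^+ n)); first exact: ccvgM.
by apply/funext => t; rewrite exprS.
Qed.

Lemma ccvg_sum (n : nat) (f : nat -> T -> C) (a : nat -> C) :
  (forall k, ccvg F (f k) (a k)) ->
  ccvg F (fun t => \sum_(0 <= k < n) f k t) (\sum_(0 <= k < n) a k).
Proof.
move=> h; elim: n => [|n IH].
  rewrite big_geq // (_ : (fun t => _) = (fun=> 0)); first exact: ccvg_cst.
  by apply/funext => t; rewrite big_geq.
rewrite big_nat_recr //=.
rewrite (_ : (fun t => _) = (fun t => \sum_(0 <= k < n) f k t + f n t)).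
  exact: ccvgD.
by apply/funext => t; rewrite big_nat_recr.
Qed.

Lemma near_ccvg f g a : (\forall t \near F, f t = g t) -> ccvg F f a -> ccvg F g a.
Proof.
move=> h /cvgCP H; apply/cvgCP => e /H; apply: filterS2 h => t; by move=> ->.
Qed.

End CcvgTheory.


Lemma ccvg_unique (T : Type) (F : set_system T) {FF : ProperFilter F}
  (f : T -> C) (a b : C) : ccvg F f a -> ccvg F f b -> a = b.
Proof. by move=> [ha] [hb]; exact: (@cvg_unique C^o (@norm_hausdorff C C^o) (f @ F) _ a b ha hb). Qed.

Lemma nbhsCP (z : C) (P : set C) :
  (\forall x \near (z : C^o), P x) <->
  exists2 e : R, 0 < e & forall x, nc (x - z) < e -> P x.
Proof.
split=> [/nbhs_ballP[e /= e0 h]|[e e0 h]].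
  have er : e = (complex.Re e)%:C by rewrite RRe_real // realE (ltW e0).
  exists (complex.Re e); first by move: e0; rewrite {1}er ltcR.
  by move=> x hx; apply: h; rewrite /ball/= norm_nc er nc_distC ltcR.
apply/nbhs_ballP; exists e%:C => /=; first by rewrite ltcR.
by move=> x; rewrite /ball/= norm_nc ltcR nc_distC => /h.
Qed.

Lemma cvg_nbhsCP (f : C -> C) (z l : C) :
  ccvg (nbhs (z : C^o)) f l <->
  forall e : R, 0 < e -> exists2 d : R, 0 < d &
    forall x, nc (x - z) < d -> nc (f x - l) < e.
Proof.
split=> [/cvgCP h e /h/nbhsCP[d d0 hd]|h]; first by exists d.
apply: (proj2 (@cvgCP _ (nbhs (z : C^o)) _ _ _)) => e /h[d d0 hd].
by apply/nbhsCP; exists d.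
Qed.

Lemma cvg_seqCP (u : nat -> C) (l : C) :
  ccvg \oo u l <->
  forall e : R, 0 < e -> exists N, forall n, (N <= n)%N -> nc (u n - l) < e.
Proof.
split=> [/cvgCP h e /h[N _ hN]|h]; first by exists N => n /hN.
by apply/cvgCP => e /h[N hN]; exists N.
Qed.

Lemma cvg_cuspP (f : C -> C) (l : C) :
  ccvg (@Im_pinfty R) f l <->
  forall e : R, 0 < e -> exists Y : R, forall z : C, Y < complex.Im z ->
    nc (f z - l) < e.
Proof.
split=> [/cvgCP h e /h[Y hY]|h]; first by exists Y.
by apply/cvgCP => e /h[Y hY]; exists Y.
Qed.

Variant cderiv (f : C -> C) (z d : C) : Prop :=
  CDeriv of is_derive (z : C^o) 1 (f : C^o -> C^o) d.

(** The bound is a product and covers [h = 0], so that no later estimate has to divide by [h]. *)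
Lemma cderivP (f : C -> C) (z d : C) :
  cderiv f z d <->
  forall e : R, 0 < e -> exists2 r : R, 0 < r &
    forall h, nc h < r -> nc (f (z + h) - f z - d * h) <= e * nc h.
Proof.
have key : (fun h : C^o => h^-1 *: ((f : C^o -> C^o) (h *: 1 + z) - f z)) @ 0^'
     --> (d : C^o) <->
  forall e : R, 0 < e -> exists2 r : R, 0 < r &
    forall h, nc h < r -> nc (f (z + h) - f z - d * h) <= e * nc h.
  split=> [H' e e0|H].
    have /cvgCP H := CCvg H'.
    have /nbhsCP [r r0 hr] := H _ e0; exists r => // h hr'.
    have [->|h0] := eqVneq h 0.
      by rewrite addr0 mulr0 subrr subr0 nc0 mulr0.
    have := hr h; rewrite subr0 => /(_ hr' h0) /ltW.
    have -> : h^-1 *: (f (h *: 1 + z) - f z) - d = h^-1 * (f (z + h) - f z - d * h).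
      rewrite -[h *: 1]/(h * 1) mulr1 (addrC h) -[_ *: _]/(_ * _).
      by rewrite [in RHS]mulrBr (mulrC d) mulKf.
    by rewrite ncM ncV mulrC ler_pdivrMr // nc_gt0.
  suff [] : ccvg ((0 : C^o)^')
      (fun h => h^-1 *: ((f : C^o -> C^o) (h *: 1 + z) - f z)) d by [].
  apply: (proj2 (@cvgCP _ ((0 : C^o)^') _ _ _)) => e e0.
  have e2 : 0 < e / 2 by lra.
  have [r r0 hr] := H _ e2; apply/nbhsCP; exists r => // h.
  rewrite subr0 => hr' h0; have {hr} := hr _ hr'.
  rewrite -ler_pdivrMr ?nc_gt0 // => hh.
  have -> : h^-1 *: (f (h *: 1 + z) - f z) - d = h^-1 * (f (z + h) - f z - d * h).
    rewrite -[h *: 1]/(h * 1) mulr1 (addrC h) -[_ *: _]/(_ * _).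
    by rewrite [in RHS]mulrBr (mulrC d) mulKf.
  rewrite ncM ncV mulrC; lra.
split=> [[[df dE]]|/key H]; first by apply/key; rewrite -dE; exact: df.
have cv : derivable (f : C^o -> C^o) (z : C^o) 1 by apply/cvg_ex; exists d.
by split; split=> //; exact: (cvg_lim _ H).
Qed.

Lemma holomorphicP (f : C -> C) :
  holomorphic f <-> forall z, @upper R z -> exists d, cderiv f z d.
Proof.
split=> H z /H => [/derivableP h|[d [[h _]]] //].
by eexists; split; exact: h.
Qed.

Lemma finite_limitP (f : C -> C) :
  finite_limit_at_cusp f <-> exists l, ccvg (@Im_pinfty R) f l.
Proof. by split=> -[l]; [exists l|case; exists l]. Qed.

Lemma cderiv_cvg (f : C -> C) z d : cderiv f z d -> ccvg (nbhs (z : C^o)) f (f z).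
Proof.
by case=> -[/derivable1_diffP/differentiable_continuous h _]; split; exact: h.
Qed.

Lemma cderiv_cst (a z : C) : cderiv (fun=> a) z 0.
Proof. by split; exact: (@is_derive_cst C C^o C^o a z 1). Qed.

Lemma cderiv_id (z : C) : cderiv (fun x => x) z 1.
Proof. by split; exact: (@is_derive_id C C^o z 1). Qed.

Lemma cderivD f g z a b : cderiv f z a -> cderiv g z b ->
  cderiv (fun x => f x + g x) z (a + b).
Proof. by move=> [hf] [hg]; split; exact: (@is_deriveD C C^o C^o f g z 1 a b hf hg). Qed.

Lemma cderivN f z a : cderiv f z a -> cderiv (fun x => - f x) z (- a).
Proof. by move=> [hf]; split; exact: (@is_deriveN C C^o C^o f z 1 a hf). Qed.

Lemma cderivM f g z a b : cderiv f z a -> cderiv g z b ->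
  cderiv (fun x => f x * g x) z (f z * b + g z * a).
Proof. by move=> [hf] [hg]; split; exact: (@is_deriveM C C^o f g z 1 a b hf hg). Qed.

Lemma cderivZ c f z a : cderiv f z a -> cderiv (fun x => c * f x) z (c * a).
Proof. by move=> [hf]; split; exact: (@is_deriveZ C C^o C^o f c z 1 a hf). Qed.

Lemma cderivV f z a : f z != 0 -> cderiv f z a ->
  cderiv (fun x => (f x)^-1) z (- (f z) ^- 2 * a).
Proof.
move=> h1 [[h2 <-]]; split; split; first exact: (@derivableV C C^o f z 1 h1 h2).
exact: (@deriveV C C^o f z 1 h1 h2).
Qed.

Lemma cderivX f z a n : cderiv f z a ->
  cderiv (fun x => f x ^+ n) z (n%:R * f z ^+ n.-1 * a).
Proof.
move=> h; have [->|] := eqVneq n 0%N.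
  by rewrite !mul0r; exact: cderiv_cst.
elim: n => // n IH _; have [->|n0] := eqVneq n 0%N.
  by rewrite expr0 !mul1r.
have := cderivM h (IH n0); rewrite /=.
have -> : f z * (n%:R * f z ^+ n.-1 * a) + f z ^+ n * a = n.+1%:R * f z ^+ n * a.
  by case: n {IH} n0 => // n _ /=; rewrite exprS -[in RHS]natr1; ring.
by congr cderiv; apply/funext => x; rewrite exprS.
Qed.

(** With k the increment of [f], the error is the remainder of [g] at k plus [b] times the remainder
    of [f], and each gets e/2. The minimum with 1 ensures |k| <= (1 + |a|) |h|; adding 1 to the
    moduli allows [a] or [b] to vanish. *)
Lemma cderiv_comp f g z a b : cderiv f z a -> cderiv g (f z) b ->
  cderiv (fun x => g (f x)) z (b * a).
Proof.
move=> hf hg; apply/cderivP => e e0.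
have [|d1 d1p hd1] := (proj1 (cderivP _ _ _) hg) (e / (2 * (1 + nc a))).
  by apply: divr_gt0 => //; have := nc_ge0 a; lra.
have e2p : 0 < Num.min 1 (e / (2 * (1 + nc b))).
  rewrite lt_min ltr01 /=; apply: divr_gt0 => //; have := nc_ge0 b; lra.
have [r r0 hr] := (proj1 (cderivP _ _ _) hf) _ e2p.
exists (Num.min r (d1 / (2 + nc a))).
  rewrite lt_min r0 /=; apply: divr_gt0 => //; have := nc_ge0 a; lra.
move=> h; rewrite lt_min => /andP[/hr h1 h2].
set k := f (z + h) - f z.
have a0 := nc_ge0 a; have b0 := nc_ge0 b; have hh := nc_ge0 h.
have hm1 : Num.min 1 (e / (2 * (1 + nc b))) <= 1 by rewrite ge_min lexx.
have hm2 : Num.min 1 (e / (2 * (1 + nc b))) <= e / (2 * (1 + nc b)).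
  by rewrite ge_min lexx orbT.
set m := Num.min _ _ in h1 hm1 hm2 e2p.
have hk : nc k <= (1 + nc a) * nc h.
  have -> : k = (k - a * h) + a * h by rewrite subrK.
  apply: le_trans (ncD _ _) _; rewrite ncM; nra.
have : nc k < d1.
  apply: le_lt_trans hk _.
  have : nc h * (2 + nc a) < d1 by rewrite -ltr_pdivlMr //; lra.
  nra.
move=> /hd1; rewrite {1}/k [f z + _]addrC subrK => h3.
have -> : g (f (z + h)) - g (f z) - b * a * h =
   (g (f (z + h)) - g (f z) - b * k) + b * (k - a * h) by ring.
apply: le_trans (ncD _ _) _; rewrite ncM.
have h4 : e / (2 * (1 + nc a)) * nc k <= e / 2 * nc h.
  apply: (@le_trans _ _ (e / (2 * (1 + nc a)) * ((1 + nc a) * nc h))).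
    by apply: ler_wpM2l => //; apply: divr_ge0; lra.
  rewrite le_eqVlt; apply/orP; left; apply/eqP; field.
  by apply/eqP; lra.
have h5 : nc b * nc (k - a * h) <= e / 2 * nc h.
  apply: (@le_trans _ _ (nc b * (m * nc h))); first exact: ler_wpM2l.
  apply: (@le_trans _ _ (nc b * (e / (2 * (1 + nc b)) * nc h))).
    by apply: ler_wpM2l => //; apply: ler_wpM2r.
  have -> : nc b * (e / (2 * (1 + nc b)) * nc h) = (nc b / (1 + nc b)) * (e / 2 * nc h).
    by field; apply/eqP; lra.
  rewrite -[leRHS]mul1r; apply: ler_wpM2r; first by nra.
  by rewrite ler_pdivrMr; lra.
move: h3; rewrite -/k; lra.
Qed.

Lemma near_cderiv f g z a (r : R) : 0 < r ->
  (forall x, nc (x - z) < r -> f x = g x) -> cderiv f z a -> cderiv g z a.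
Proof.
move=> r0 fg /cderivP h; apply/cderivP => e /h[d d0 hd].
exists (Num.min r d); first by rewrite lt_min r0.
move=> k; rewrite lt_min => /andP[kr kd].
by rewrite -!fg ?subrr ?nc0 //; [exact: hd|rewrite addrC addKr].
Qed.

End ComplexTopology.

(** * Complex series *)

Section ComplexSeries.
Context {R : realType}.
Local Notation C := R[i].
Implicit Types (a : nat -> C) (b : nat -> R).

Definition bounded_series b := exists B : R, forall N, \sum_(0 <= k < N) b k <= B.

Definition csum a : C := limn (series a : nat -> C^o).

Definition csummable a := bounded_series (fun k => nc (a k)).

Lemma bounded_series_le b b' : (forall k, b k <= b' k) ->
  bounded_series b' -> bounded_series b.
Proof.
move=> h [B hB]; exists B => N; apply: le_trans (hB N).
by apply: ler_sum => k _.
Qed.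

Lemma bounded_seriesD b b' : bounded_series b -> bounded_series b' ->
  bounded_series (fun k => b k + b' k).
Proof.
move=> [B hB] [B' hB']; exists (B + B') => N.
by rewrite big_split /= lerD.
Qed.

Lemma bounded_seriesZ (r : R) b : 0 <= r -> bounded_series b ->
  bounded_series (fun k => r * b k).
Proof.
move=> r0 [B hB]; exists (r * B) => N.
by rewrite -mulr_sumr ler_wpM2l.
Qed.

Lemma csummable_le a b : (forall k, nc (a k) <= b k) -> bounded_series b ->
  csummable a.
Proof. exact: bounded_series_le. Qed.

Lemma real_series_cvg (u : nat -> R) b : (forall k, `|u k| <= b k) ->
  bounded_series b -> cvgn (series u).
Proof.
move=> h [B hB]; apply: normed_cvg.
apply: nondecreasing_is_cvgn.
  apply/nondecreasing_seqP => n; rewrite -subr_ge0.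
  by rewrite [X in X - _]big_nat_recr //= addrAC subrr add0r normr_ge0.
exists B => _ [n _ <-]; apply: le_trans (hB n).
by rewrite /series /=; apply: ler_sum => k _; exact: h.
Qed.

Lemma ReD (z w : C) : complex.Re (z + w) = complex.Re z + complex.Re w.
Proof. by case: z w => [? ?] [? ?]. Qed.

Lemma ImD (z w : C) : complex.Im (z + w) = complex.Im z + complex.Im w.
Proof. by case: z w => [? ?] [? ?]. Qed.

Lemma ReN (z : C) : complex.Re (- z) = - complex.Re z.
Proof. by case: z. Qed.

Lemma ImN (z : C) : complex.Im (- z) = - complex.Im z.
Proof. by case: z. Qed.

Lemma Re_series a n : complex.Re (series a n) = series (fun k => complex.Re (a k)) n.
Proof.
rewrite /series /=; elim/big_rec2: _ => [//|i x y _ <-]; exact: ReD.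
Qed.

Lemma Im_series a n : complex.Im (series a n) = series (fun k => complex.Im (a k)) n.
Proof.
rewrite /series /=; elim/big_rec2: _ => [//|i x y _ <-]; exact: ImD.
Qed.

Lemma csum_unique a l : ccvg \oo (series a) l -> csum a = l.
Proof. by case=> h; exact: (cvg_lim _ h). Qed.

Lemma csum_cvg a : csummable a ->
  ccvg \oo (series a) (csum a).
Proof.
move=> ha.
have /cvg_ex[x hx] := real_series_cvg (fun k => Re_le_nc (a k)) ha.
have /cvg_ex[y hy] := real_series_cvg (fun k => Im_le_nc (a k)) ha.
suff H : ccvg \oo (series a) (x +i* y).
  by rewrite (csum_unique H).
apply/cvgCP => e e0; have e2 : 0 < e / 2 by lra.
move/cvgrPdist_lt: hx => /(_ _ e2) hx; move/cvgrPdist_lt: hy => /(_ _ e2) hy.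
near=> n; apply: le_lt_trans (nc_le_ReIm _) _.
rewrite ReD ImD ReN ImN Re_series Im_series /= (distrC _ x) (distrC _ y).
have h1 : `|x - series (fun k => complex.Re (a k)) n| < e / 2 by near: n.
have h2 : `|y - series (fun k => complex.Im (a k)) n| < e / 2 by near: n.
lra.
Unshelve. all: by end_near.
Qed.

Lemma eq_csum a a' : a =1 a' -> csum a = csum a'.
Proof. by move=> /funext ->. Qed.

Lemma csum0 : csum (fun=> 0) = 0.
Proof.
apply: csum_unique; rewrite (_ : series _ = cst 0); first exact: ccvg_cst.
by apply/funext => n; rewrite /series /= big1.
Qed.

Lemma csumD a a' : csummable a -> csummable a' ->
  csum (fun k => a k + a' k) = csum a + csum a'.
Proof.
move=> /csum_cvg h /csum_cvg h'; apply: csum_unique.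
rewrite (_ : series _ = (fun n => series a n + series a' n)).
  exact: (ccvgD h h').
by apply/funext => n; rewrite /series /= big_split.
Qed.

Lemma csumZ (z : C) a : csummable a -> csum (fun k => z * a k) = z * csum a.
Proof.
move=> /csum_cvg h; apply: csum_unique.
rewrite (_ : series _ = (fun n => z * series a n)).
  by apply: ccvgM => //; exact: ccvg_cst.
by apply/funext => n; rewrite /series /= -mulr_sumr.
Qed.

Lemma csummableD a a' : csummable a -> csummable a' ->
  csummable (fun k => a k + a' k).
Proof.
move=> h h'; apply: (csummable_le (b := fun k => nc (a k) + nc (a' k))).
  by move=> k; exact: ncD.
exact: bounded_seriesD.
Qed.

Lemma csummableZ z a : csummable a -> csummable (fun k => z * a k).
Proof.
move=> h; apply: (csummable_le (b := fun k => nc z * nc (a k))).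
  by move=> k; rewrite ncM.
by apply: bounded_seriesZ => //; exact: nc_ge0.
Qed.

Lemma csummable_sum n (a : nat -> nat -> C) :
  (forall i, csummable (a i)) -> csummable (fun k => \sum_(0 <= i < n) a i k).
Proof.
move=> h; elim: n => [|n IH].
  exists 0 => N; rewrite big1 // => k _; rewrite big_geq // nc0 //.
under eq_fun do rewrite big_nat_recr //=.
exact: csummableD.
Qed.

Lemma csum_sum n (a : nat -> nat -> C) : (forall i, csummable (a i)) ->
  csum (fun k => \sum_(0 <= i < n) a i k) = \sum_(0 <= i < n) csum (a i).
Proof.
move=> h; elim: n => [|n IH].
  rewrite big_geq // -[RHS]csum0; apply: eq_csum => k; rewrite big_geq //.
rewrite big_nat_recr //= -IH -csumD //; last exact: csummable_sum.
by apply: eq_csum => k; rewrite big_nat_recr.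
Qed.

Lemma bounded_series_shift b : (forall k, 0 <= b k) -> bounded_series b ->
  bounded_series (fun k => b k.+1).
Proof.
move=> b0 [B hB]; exists B => N; apply: le_trans (hB N.+1).
by rewrite big_nat_recl // lerDr.
Qed.

Lemma csummable_shift a : csummable a -> csummable (fun k => a k.+1).
Proof. by apply: bounded_series_shift => k; exact: nc_ge0. Qed.

Lemma csum_shift a : csummable a -> csum a = a 0%N + csum (fun k => a k.+1).
Proof.
move=> h; apply: csum_unique.
have /cvg_seqCP h1 : ccvg \oo (fun n => a 0%N + series (fun k => a k.+1) n)
    (a 0%N + csum (fun k => a k.+1)).
  by apply: ccvgD; [exact: ccvg_cst|exact: csum_cvg (csummable_shift h)].
apply/cvg_seqCP => e /h1[N hN]; exists N.+1 => -[//|n] /hN.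
by rewrite /series /= big_nat_recl.
Qed.

Lemma csum_split N a : csummable a ->
  csum a = \sum_(0 <= k < N) a k + csum (fun k => a (N + k)%N).
Proof.
elim: N a => [|N IH] a ha; first by rewrite big_geq // add0r.
rewrite csum_shift // IH; last exact: csummable_shift.
by rewrite big_nat_recl // addrA.
Qed.

Lemma nc_csum_le a B : csummable a -> (forall N, \sum_(0 <= k < N) nc (a k) <= B) ->
  nc (csum a) <= B.
Proof.
move=> ha hB; apply/ler_addgt0Pr => e e0.
have /cvgCP/(_ _ e0)[N _ /(_ N (leqnn N))] := csum_cvg ha.
move=> h; have : nc (csum a) <= nc (csum a - series a N) + nc (series a N).
  by rewrite -{1}(subrK (series a N) (csum a)) ncD.
have : nc (series a N) <= B.
  by apply: le_trans (hB N); rewrite /series /=; exact: nc_sum.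
move: h; rewrite nc_distC => h h1 h2.
by apply: le_trans h2 _; rewrite addrC lerD // ltW.
Qed.

(** Once a partial sum is within [e] of the supremum, every later block is at most [e]. *)
Lemma tail_small b (e : R) : (forall k, 0 <= b k) -> bounded_series b -> 0 < e ->
  exists N, forall M, \sum_(0 <= k < M) b (N + k)%N <= e.
Proof.
move=> b0 [B hB] e0.
pose S := [set \sum_(0 <= k < N) b k | N in [set: nat]].
have supS : has_sup S.
  split; first by exists (\sum_(0 <= k < 0) b k); exists 0%N.
  by exists B => _ [N _ <-].
have [_ [N _ <-] hN] := sup_adherent e0 supS; exists N => M.
have : \sum_(0 <= k < N + M) b k <= sup S.
  by apply: sup_upper_bound => //; exists (N + M)%N.
have -> : \sum_(0 <= k < N + M) b k = \sum_(0 <= k < N) b k + \sum_(0 <= k < M) b (N + k)%N.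
  rewrite (@big_cat_nat _ _ _ N) ?leq_addr //=; congr (_ + _).
  by rewrite -{1}(add0n N) big_addn addKn; apply: eq_bigr => i _; rewrite addnC.
lra.
Qed.

Lemma cvg_nc_le (u : nat -> C) (l : C) (B : R) n0 :
  ccvg \oo u l ->
  (forall n, (n0 <= n)%N -> nc (u n) <= B) -> nc l <= B.
Proof.
move=> /cvg_seqCP h hB; apply/ler_addgt0Pr => e /h[N hN].
have := hN (maxn N n0) (leq_maxl _ _); have := hB _ (leq_maxr N n0).
set v := u _ => h1 h2; have : nc l <= nc (l - v) + nc v.
  by rewrite -{1}(subrK v l) ncD.
rewrite nc_distC; lra.
Qed.

(** Dominated convergence: the head is a finite sum that converges termwise, and each of the two
    tails is at most e/8. Domination is asked only from rank [n0] on, because the dyadic estimates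
    hold only for large [n]. *)
Lemma tannery (u : nat -> nat -> C) a b n0 : bounded_series b ->
  (forall n k, (n0 <= n)%N -> nc (u n k) <= b k) ->
  (forall k, ccvg \oo (u^~ k) (a k)) ->
  ccvg \oo (fun n => csum (u n)) (csum a).
Proof.
move=> sb hb hu.
have hab k : nc (a k) <= b k.
  by apply: (cvg_nc_le (n0 := n0) (hu k)) => n hn; exact: hb.
have b0 k : 0 <= b k by apply: le_trans (hab k); exact: nc_ge0.
apply/cvg_seqCP => e e0; have e8 : 0 < e / 8 by lra.
have [N hN] := tail_small b0 sb e8.
have /cvg_seqCP/(_ _ e8)[M hM] :
    ccvg \oo (fun n => \sum_(0 <= k < N) (u n k - a k)) (\sum_(0 <= k < N) (a k - a k)).
  apply: ccvg_sum => k.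
  by apply: ccvgB; [exact: hu|exact: ccvg_cst].
exists (maxn M n0) => n; rewrite geq_max => /andP[/hM h1 hn].
have su : csummable (u n) by apply: csummable_le sb => k; exact: hb.
have sa : csummable a by apply: csummable_le sb.
rewrite (csum_split N su) (csum_split N sa).
have t1 (v : nat -> C) : (forall k, nc (v k) <= b k) ->
    nc (csum (fun k => v (N + k)%N)) <= e / 8.
  move=> hv; have hs M' : \sum_(0 <= k < M') nc (v (N + k)%N) <= e / 8.
    by apply: le_trans (hN M'); apply: ler_sum => k _.
  by apply: nc_csum_le => //; exists (e / 8).
have h2 := t1 (u n) (fun k => hb n k hn); have h3 := t1 a hab.
have E0 : \sum_(0 <= k < N) (a k - a k) = 0 by rewrite big1 // => k _; rewrite subrr.
move: h1; rewrite E0 subr0 sumrB => h1.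
set A := \sum_(0 <= k < N) u n k in h1 *; set A' := \sum_(0 <= k < N) a k in h1 *.
set T := csum _ in h2 *; set T' := csum _ in h3 *.
have -> : A + T - (A' + T') = (A - A') + (T - T') by ring.
have := ncD (A - A') (T - T'); have := ncB T T'; lra.
Qed.

(** The partial sums over j of the rows are dominated by a multiple of [b1], so [tannery] passes to
    the limit under the outer sum. *)
Lemma csum_exchange (a : nat -> nat -> C) b1 b2 :
  bounded_series b1 -> bounded_series b2 -> (forall k, 0 <= b1 k) ->
  (forall k, 0 <= b2 k) ->
  (forall i j, nc (a i j) <= b1 i * b2 j) ->
  csum (fun i => csum (fun j => a i j)) = csum (fun j => csum (fun i => a i j)).
Proof.
move=> s1 s2 p1 p2 h.
have r1 i : csummable (a i).
  by apply: (csummable_le (b := fun j => b1 i * b2 j)) => //; exact: bounded_seriesZ.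
have r2 j : csummable (a^~ j).
  apply: (csummable_le (b := fun i => b2 j * b1 i)) => [k|]; first by rewrite mulrC.
  exact: bounded_seriesZ.
symmetry; apply: csum_unique; have [B2 hB2] := s2.
have := @tannery (fun n i => \sum_(0 <= j < n) a i j) (fun i => csum (a i))
  (fun i => B2 * b1 i) 0.
have -> : (fun n => csum (fun i => \sum_(0 <= j < n) a i j)) =
   series (fun j => csum (fun i => a i j)).
  apply/funext => n; rewrite /series /=.
  exact: (@csum_sum n (fun j i => a i j)).
apply.
- apply: bounded_seriesZ => //; apply: le_trans (hB2 0%N); by rewrite big_geq.
- move=> n i _; apply: le_trans (nc_sum _ _ _) _.
  apply: (@le_trans _ _ (\sum_(0 <= j < n) b1 i * b2 j)).
    by apply: ler_sum => j _.
  by rewrite -mulr_sumr mulrC ler_wpM2r.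
- by move=> i; exact: csum_cvg.
Qed.

End ComplexSeries.

(** * The complex exponential *)

Section ComplexExponential.
Context {R : realType}.
Local Notation C := R[i].
Local Notation Re := complex.Re.
Local Notation Im := complex.Im.
Implicit Types (z w : C).

Lemma rderivP (f : R -> R) (z d : R) :
  is_derive z 1 f d <->
  forall e : R, 0 < e -> exists2 r : R, 0 < r &
    forall h, `|h| < r -> `|f (z + h) - f z - d * h| <= e * `|h|.
Proof.
have key : (fun h : R => h^-1 *: (f (h *: 1 + z) - f z)) @ 0^' --> d <->
  forall e : R, 0 < e -> exists2 r : R, 0 < r &
    forall h, `|h| < r -> `|f (z + h) - f z - d * h| <= e * `|h|.
  have E h : h != 0 ->
      d - h^-1 *: (f (h *: 1 + z) - f z) = - (h^-1 * (f (z + h) - f z - d * h)).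
    move=> h0; rewrite -[h *: 1]/(h * 1) mulr1 (addrC h) -[_ *: _]/(_ * _).
    by rewrite [in RHS]mulrBr (mulrC d) mulKf // opprB.
  split=> [/cvgrPdist_lt H e e0|H].
    have /nbhs_ballP [r r0 hr] := H _ e0; exists r => // h hr'.
    have [->|h0] := eqVneq h 0.
      by rewrite addr0 mulr0 subrr subr0 normr0 mulr0.
    have := hr h; rewrite /ball /= sub0r normrN => /(_ hr' h0) /ltW.
    by rewrite E // normrN normrM normfV mulrC ler_pdivrMr // normr_gt0.
  apply/cvgrPdist_lt => e e0.
  have e2 : 0 < e / 2 by lra.
  have [r r0 hr] := H _ e2; apply/nbhs_ballP; exists r => // h.
  rewrite /ball /= sub0r normrN => hr' h0; have {hr} := hr _ hr'.
  rewrite -ler_pdivrMr ?normr_gt0 // => hh.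
  by rewrite E // normrN normrM normfV mulrC; lra.
split=> [[df dE]|/key H]; first by apply/key; rewrite -dE; exact: df.
have cv : derivable f z 1 by apply/cvg_ex; exists d.
by split=> //; exact: (cvg_lim _ H).
Qed.

Lemma nc_sqr z : nc z ^+ 2 = Re z ^+ 2 + Im z ^+ 2.
Proof. by case: z => a b /=; rewrite sqr_sqrtr // addr_ge0 // sqr_ge0. Qed.

Lemma ReM z w : Re (z * w) = Re z * Re w - Im z * Im w.
Proof. by case: z w => [? ?] [? ?]. Qed.

Lemma ImM z w : Im (z * w) = Re z * Im w + Im z * Re w.
Proof. by case: z w => [? ?] [? ?]. Qed.

Lemma complex_eq z w : Re z = Re w -> Im z = Im w -> z = w.
Proof. by case: z w => [? ?] [? ?] /= -> ->. Qed.

Lemma cexpD z w : cexp (z + w) = cexp z * cexp w.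
Proof.
rewrite /cexp ReD ImD expRD cosD sinD.
by apply: complex_eq; rewrite !(ReM, ImM) /=; ring.
Qed.

Lemma cexp0 : cexp (0 : C) = 1.
Proof. by rewrite /cexp /= expR0 cos0 sin0 mul1r. Qed.

Lemma nc_cexp z : nc (cexp z) = expR (Re z).
Proof.
rewrite /cexp ncM nc_real ger0_norm ?expR_ge0 //=.
by rewrite cos2Dsin2 sqrtr1 mulr1.
Qed.

Lemma cexp_neq0 z : cexp z != 0.
Proof. by rewrite -nc_gt0 nc_cexp expR_gt0. Qed.

Lemma cexpN z : cexp (- z) = (cexp z)^-1.
Proof.
by apply: (mulfI (cexp_neq0 z)); rewrite -cexpD subrr cexp0 divff // cexp_neq0.
Qed.

Lemma cexp_natM n z : cexp (n%:R * z) = cexp z ^+ n.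
Proof.
elim: n => [|n IH]; first by rewrite mul0r cexp0.
by rewrite -natr1 mulrDl mul1r cexpD IH exprSr.
Qed.

(** By the addition formula the derivative at 0 gives all the others. *)
Lemma cderiv_cexp0 : cderiv (@cexp R) 0 1.
Proof.
apply/cderivP => e e0.
have M1 : 1 <= expR 1 :> R by rewrite -[X in X <= _]expR0 ler_expR.
have ep : 0 < e / 8 / expR 1 by rewrite !divr_gt0 // expR_gt0.
have e8 : 0 < e / 8 by lra.
have [r1 r10 h1] := (proj1 (rderivP expR 0 (expR 0)) (is_derive_expR _)) _ e8.
have [r2 r20 h2] := (proj1 (rderivP expR 0 (expR 0)) (is_derive_expR _)) 1 ltr01.
have [r3 r30 h3] := (proj1 (rderivP cos 0 (- sin 0)) (is_derive_cos _)) _ ep.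
have [r4 r40 h4] := (proj1 (rderivP sin 0 (cos 0)) (is_derive_sin _)) _ ep.
exists (Num.min (Num.min r1 r2) (Num.min (Num.min r3 r4) (Num.min 1 (e / 8)))).
  by rewrite !lt_min r10 r20 r30 r40 ltr01 e8.
move=> h; rewrite !lt_min => /andP[/andP[k1 k2] /andP[/andP[k3 k4] /andP[k5 k6]]].
have hx := Re_le_nc h; have hy := Im_le_nc h; have h0 := nc_ge0 h.
rewrite add0r cexp0 mul1r; apply: le_trans (nc_le_ReIm _) _.
have {}h1 := h1 _ (le_lt_trans hx k1); have {}h2 := h2 _ (le_lt_trans hx k2).
have {}h3 := h3 _ (le_lt_trans hy k3); have {}h4 := h4 _ (le_lt_trans hy k4).
move: h1 h2 h3 h4; rewrite !add0r expR0 cos0 sin0 oppr0 mul0r !mul1r ?subr0 ?oppr0 ?addr0.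
set x := Re h in hx *; set y := Im h in hy * => h1 h2 h3 h4.
(* Both parts are arranged so that each summand is the first-order remainder of a real function, or
   a product of two small factors. *)
have -> : Re (cexp h - 1 - h) = expR x * (cos y - 1) + (expR x - 1 - x).
  by rewrite !ReD !ReN /cexp ReM /= -/x -/y; ring.
have -> : Im (cexp h - 1 - h) = expR x * (sin y - y) + (expR x - 1) * y.
  by rewrite !ImD !ImN /cexp ImM /= -/x -/y; ring.
have hE : expR x <= expR 1.
  by rewrite ler_expR; apply: le_trans (ler_norm _) _; apply: le_trans hx (ltW k5).
have hE0 := expR_ge0 x.
have b1 (u : R) : `|u| <= e / 8 / expR 1 * `|y| -> `|expR x * u| <= e / 8 * nc h.
  move=> hu; rewrite normrM ger0_norm //.
  apply: (@le_trans _ _ (expR 1 * (e / 8 / expR 1 * `|y|))).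
    exact: ler_pM.
  rewrite mulrA (mulrC (expR 1)) mulfVK ?gt_eqF ?expR_gt0 //.
  by apply: ler_wpM2l => //; exact: ltW.
have b2 : `|(expR x - 1) * y| <= e / 4 * nc h.
  rewrite normrM; have : `|expR x - 1| <= 2 * `|x|.
    have -> : expR x - 1 = (expR x - 1 - x) + x by rewrite subrK.
    apply: le_trans (ler_normD _ _) _; lra.
  move=> hh; apply: (@le_trans _ _ (2 * nc h * nc h)); last by nra.
  by apply: ler_pM => //; lra.
apply: (@le_trans _ _ ((e / 8 * nc h + e / 8 * nc h) + (e / 8 * nc h + e / 4 * nc h))).
  apply: lerD; apply: le_trans (ler_normD _ _) _; apply: lerD => //.
  - exact: b1.
  - by apply: le_trans h1 _; apply: ler_wpM2l => //; exact: ltW.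
  - exact: b1.
nra.
Qed.

Lemma cderiv_cexp z : cderiv (@cexp R) z (cexp z).
Proof.
have := cderivZ (cexp z) cderiv_cexp0; rewrite mulr1 => /cderivP h.
apply/cderivP => e /h[r r0 hr]; exists r => // k /hr.
by rewrite add0r cexp0 mulr1 cexpD.
Qed.

Local Notation tpi := (two_pi_i R).

Lemma two_pi_iE : tpi = 0 +i* (2 * pi).
Proof.
rewrite /two_pi_i -[2 : C](rmorph_nat (real_complex R)).
by apply: complex_eq; rewrite !(ReM, ImM) /=; ring.
Qed.

Lemma two_pi_i_neq0 : tpi != 0.
Proof. by rewrite two_pi_iE eq_complex /= negb_and mulf_neq0 ?orbT // gt_eqF ?pi_gt0. Qed.

Lemma qparE z : qpar z =
  (expR (- (2 * pi * Im z)))%:C * (cos (2 * pi * Re z) +i* sin (2 * pi * Re z)).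
Proof.
by rewrite /qpar /cexp two_pi_iE ReM ImM /= !mul0r sub0r add0r.
Qed.

Lemma qparD z w : qpar (z + w) = qpar z * qpar w.
Proof. by rewrite /qpar mulrDr cexpD. Qed.

Lemma qpar0 : qpar (0 : C) = 1.
Proof. by rewrite /qpar mulr0 cexp0. Qed.

Lemma qparN z : qpar (- z) = (qpar z)^-1.
Proof. by rewrite /qpar mulrN cexpN. Qed.

Lemma qpar_neq0 z : qpar z != 0.
Proof. exact: cexp_neq0. Qed.

Lemma qpar1 : qpar (1 : C) = 1.
Proof.
by rewrite qparE /= mulr0 oppr0 expR0 mul1r mulr1 mulr_natl cos2pi sin2pi.
Qed.

Lemma qparD1 z : qpar (z + 1) = qpar z.
Proof. by rewrite qparD qpar1 mulr1. Qed.

Lemma qpar_natM n z : qpar (n%:R * z) = qpar z ^+ n.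
Proof. by rewrite /qpar mulrCA cexp_natM. Qed.

Lemma qparD_int z (n : int) : qpar (z + n%:~R) = qpar z.
Proof.
rewrite qparD; suff -> : qpar (n%:~R : C) = 1 by rewrite mulr1.
case: n => n; first by rewrite -[_%:~R](mulr1 n%:R) qpar_natM qpar1 expr1n.
by rewrite NegzE mulrNz qparN -[_%:~R](mulr1 n.+1%:R) qpar_natM qpar1 expr1n invr1.
Qed.

Lemma qpar_half : qpar (2^-1 : C) = -1.
Proof.
have -> : (2^-1 : C) = (2^-1)%:C by rewrite fmorphV /= rmorph_nat.
rewrite qparE /= mulr0 oppr0 expR0 mul1r.
have -> : 2 * pi * 2^-1 = pi :> R by field.
by rewrite cospi sinpi; apply: complex_eq => /=; rewrite ?oppr0.
Qed.

Lemma nc_qpar z : nc (qpar z) = expR (- (2 * pi * Im z)).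
Proof. by rewrite /qpar nc_cexp two_pi_iE ReM /= mul0r sub0r. Qed.

Lemma nc_qpar_lt1 z : @upper R z -> nc (qpar z) < 1.
Proof.
move=> h; have {}h : 0 < Im z := h; rewrite nc_qpar -expR0 ltr_expR oppr_lt0.
by rewrite !mulr_gt0 // pi_gt0.
Qed.

Lemma cderiv_qpar z : cderiv (@qpar R) z (tpi * qpar z).
Proof.
rewrite mulrC; apply: (@cderiv_comp _ (fun x => tpi * x) (@cexp R)).
  by have := cderivZ tpi (cderiv_id z); rewrite mulr1.
exact: cderiv_cexp.
Qed.

Lemma sin_ge_mulcos (s : R) : 0 <= s <= pi / 2 -> s * cos s <= sin s.
Proof.
move=> /andP[s0 s1]; move: s0; rewrite le_eqVlt => /orP[/eqP <-|s0].
  by rewrite mul0r sin0.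
have [c /andP[] + +] : exists2 c, c \in `]0, s[%R & sin s - sin 0 = cos c * (s - 0).
  apply: (@MVT R sin cos) => //.
  by apply: continuous_subspaceT => x; exact: continuous_sin.
rewrite !bnd_simp => c0 cs; rewrite sin0 !subr0 => ->.
rewrite mulrC ler_pM2r //; have := pi_gt0 R => p0.
by rewrite ltW // ltr_cos ?in_itv /= //; apply/andP; split; lra.
Qed.

Lemma cos_3pi4_gt : -1 < cos (3 / 4 * pi : R).
Proof.
have p0 := pi_gt0 R; rewrite -cospi ltr_cos ?in_itv /=; lra.
Qed.

(** Equal to cos(3 pi / 8)^2, the least value of cos(t / 2)^2 for |t| <= 3 pi / 4. *)
Definition sin_const : R := (1 + cos (3 / 4 * pi)) / 2.

Lemma sin_const_gt0 : 0 < sin_const.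
Proof. rewrite /sin_const; have := cos_3pi4_gt; lra. Qed.

Lemma sin_const_le1 : sin_const <= 1.
Proof. rewrite /sin_const; have := cos_le1 (3 / 4 * pi : R); lra. Qed.

(** For t >= 0, sin t = 2 sin(t/2) cos(t/2) is at least t cos(t/2)^2, by [sin_ge_mulcos] at t/2. *)
Lemma norm_sin_ge (t : R) : `|t| <= 3 / 4 * pi -> sin_const * `|t| <= `|sin t|.
Proof.
wlog t0 : t / 0 <= t.
  move=> H; case: (leP 0 t) => t0; first exact: H.
  by have := H (- t); rewrite sinN !normrN; apply; lra.
rewrite ger0_norm // => ht; have p0 := pi_gt0 R.
apply: le_trans (ler_norm _).
have hs : 0 <= t / 2 <= pi / 2 by apply/andP; split; lra.
have h1 := sin_ge_mulcos hs.
have h2 : 0 <= cos (t / 2) by apply: cos_ge0_pihalf; apply/andP; split; lra.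
have e : t = (t / 2) *+ 2 by rewrite -mulr_natr; field.
have h3 : sin_const <= cos (t / 2) ^+ 2.
  have : cos t = cos (t / 2) ^+ 2 *+ 2 - 1 by rewrite {1}e cos_mulr2n.
  have : cos (3 / 4 * pi) <= cos t.
    have [->//|ne] := eqVneq t (3 / 4 * pi).
    by rewrite ltW // ltr_cos ?in_itv /= ?lt_neqAle ?ne //; apply/andP; split; lra.
  rewrite /sin_const -mulr_natr => ? ?; lra.
rewrite {2}e sin_mulr2n -mulr_natr.
have h4 : cos (t / 2) * (t / 2 * cos (t / 2)) <= cos (t / 2) * sin (t / 2).
  exact: ler_wpM2l.
have h5 : sin_const * t <= cos (t / 2) ^+ 2 * t by exact: ler_wpM2r.
by move: h4 h5; rewrite expr2; lra.
Qed.

Lemma ler_norm_sqr (a b : R) : `|a| <= `|b| -> a ^+ 2 <= b ^+ 2.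
Proof.
move=> h; rewrite -(real_normK (num_real a)) -(real_normK (num_real b)).
by rewrite ler_pXn2r ?nnegrE.
Qed.

(** The zero of 1 - q at 0 is simple, and the range 3/4 for the real part stays away from the next
    zeros at 1 and -1. This bound dominates all the dyadic sums below. *)
Lemma nc_1Bqpar_ge (Y : R) : 0 <= Y -> exists2 c : R, 0 < c &
  forall w, `|Re w| <= 3 / 4 -> `|Im w| <= Y -> c * nc w <= nc (1 - qpar w).
Proof.
move=> Y0; have p0 := pi_gt0 R; have p2 := pi_ge2 R.
set r0 := expR (- (2 * pi * Y)); have r00 : 0 < r0 := expR_gt0 _.
have r01 : r0 <= 1 by rewrite -expR0 ler_expR oppr_le0 !mulr_ge0 // ltW.
have g0 := sin_const_gt0; have g1 := sin_const_le1.
exists (2 * r0 * sin_const); first by apply: mulr_gt0 => //; apply: mulr_gt0.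
move=> w hx hy; set x := Re w in hx; set y := Im w in hy.
set r := expR (- (2 * pi * y)).
have rge : r0 <= r.
  rewrite ler_expR lerN2 ler_pM2l ?mulr_gt0 //.
  by apply: le_trans (ler_norm _) hy.
(* The first square controls the imaginary part of [w], the second term its real part. *)
have E : nc (1 - qpar w) ^+ 2 = (1 - r) ^+ 2 + 4 * r * sin (pi * x) ^+ 2.
  rewrite nc_sqr qparE ReD ImD ReN ImN ReM ImM /= -/x -/y -/r.
  have -> : 2 * pi * x = (pi * x) *+ 2 by rewrite -mulr_natr; ring.
  rewrite cos_mulr2n sin_mulr2n.
  have := cos2Dsin2 (pi * x); set c := cos _; set s := sin _ => cs.
  apply/eqP; rewrite -subr_eq0; apply/eqP.
  transitivity ((c ^+ 2 + s ^+ 2 - 1) * (4 * r ^+ 2 * c ^+ 2 - 4 * r)); first by ring.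
  by rewrite cs subrr mul0r.
have h1 : (2 * r0 * sin_const * y) ^+ 2 <= (1 - r) ^+ 2.
  apply: ler_norm_sqr; rewrite normrM.
  rewrite (ger0_norm (_ : 0 <= 2 * r0 * sin_const)); last first.
    by rewrite !mulr_ge0 // ltW.
  have h0 : r0 * (2 * pi * `|y|) <= `|1 - r|.
    case: (leP 0 y) => y0.
      rewrite (ger0_norm y0); apply: le_trans (ler_norm _).
      have h := expR_ge1Dx (2 * pi * y).
      have rr : r * expR (2 * pi * y) = 1 by rewrite /r -expRD addNr expR0.
      have : r * (1 + 2 * pi * y) <= 1.
        by rewrite -[leRHS]rr; apply: ler_wpM2l h; exact: expR_ge0.
      have : r0 * (2 * pi * y) <= r * (2 * pi * y).
        by apply: ler_wpM2r => //; rewrite !mulr_ge0 // ltW.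
      lra.
    rewrite (ltr0_norm y0) distrC; apply: le_trans (ler_norm _).
    have := expR_ge1Dx (- (2 * pi * y)); rewrite -/r.
    have q0 : 0 <= 2 * pi * - y by rewrite !mulr_ge0 //; lra.
    have : r0 * (2 * pi * - y) <= 1 * (2 * pi * - y) by apply: ler_wpM2r.
    lra.
  apply: le_trans h0; have y0 := normr_ge0 y.
  have : r0 * (sin_const * `|y|) <= r0 * (pi * `|y|).
    apply: ler_wpM2l; first exact: ltW.
    by apply: ler_wpM2r => //; lra.
  lra.
have h2 : (2 * r0 * sin_const * x) ^+ 2 <= 4 * r * sin (pi * x) ^+ 2.
  have hs : (sin_const * (pi * x)) ^+ 2 <= sin (pi * x) ^+ 2.
    apply: ler_norm_sqr; rewrite (normrM sin_const) (ger0_norm (ltW g0)); apply: norm_sin_ge.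
    rewrite normrM (ger0_norm (ltW p0)) mulrC ler_pM2r //.
  have : r0 * (sin_const * (pi * x)) ^+ 2 <= r * sin (pi * x) ^+ 2.
    by apply: ler_pM => //; [exact: ltW|exact: sqr_ge0].
  have : (r0 * sin_const * x) ^+ 2 <= r0 * (sin_const * (pi * x)) ^+ 2.
    have -> : (r0 * sin_const * x) ^+ 2 = r0 * (r0 * (sin_const ^+ 2 * x ^+ 2)) by ring.
    have -> : r0 * (sin_const * (pi * x)) ^+ 2 = r0 * (pi ^+ 2 * (sin_const ^+ 2 * x ^+ 2)) by ring.
    apply: ler_wpM2l; first exact: ltW.
    have sx : 0 <= sin_const ^+ 2 * x ^+ 2 by rewrite mulr_ge0 // sqr_ge0.
    have pp : 1 <= pi ^+ 2 :> R by rewrite expr2; nra.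
    have : r0 * (sin_const ^+ 2 * x ^+ 2) <= 1 * (sin_const ^+ 2 * x ^+ 2).
      exact: ler_wpM2r.
    have : 1 * (sin_const ^+ 2 * x ^+ 2) <= pi ^+ 2 * (sin_const ^+ 2 * x ^+ 2).
      exact: ler_wpM2r.
    lra.
  have -> : (2 * r0 * sin_const * x) ^+ 2 = 4 * (r0 * sin_const * x) ^+ 2 by ring.
  lra.
rewrite -(@ler_pXn2r _ 2) ?nnegrE ?mulr_ge0 ?nc_ge0 // ?(ltW r00) ?(ltW g0) //.
rewrite E exprMn nc_sqr -/x -/y mulrDr -!exprMn addrC; exact: lerD.
Qed.

Lemma pow2_cvgy (e : R) : 0 < e -> exists N, forall n, (N <= n)%N -> (2 ^+ n)^-1 < e.
Proof.
move=> e0; have [N hN] : exists N : nat, e^-1 < N%:R.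
  exists (Num.bound e^-1); apply: archi_boundP; rewrite invr_ge0; exact: ltW.
exists N => n hn; rewrite invf_plt ?posrE ?exprn_gt0 //.
apply: lt_le_trans hN _; rewrite -natrX ler_nat.
by apply: leq_trans hn _; apply: ltnW; exact: ltn_expl.
Qed.

Lemma cderiv_seq (f : C -> C) z d v : cderiv f z d ->
  ccvg \oo (fun n => 2 ^+ n * (f (z + v / 2 ^+ n) - f z)) (d * v).
Proof.
move=> /cderivP h; apply/cvg_seqCP => e e0.
have v0 := nc_ge0 v; have v1 : 0 < 1 + nc v by lra.
have [|r r0 hr] := h (e / (1 + nc v) / 2); first by rewrite !divr_gt0.
have [|N hN] := @pow2_cvgy (r / (1 + nc v)); first exact: divr_gt0.
exists N => n /hN hn.
have p0 : 0 < (2 ^+ n : R) by rewrite exprn_gt0.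
have pE : nc (2 ^+ n : C) = 2 ^+ n by rewrite ncX nc_nat.
have pn : (2 ^+ n : C) != 0 by rewrite -nc_gt0 pE.
have hk : nc (v / 2 ^+ n) = nc v / 2 ^+ n by rewrite ncM ncV pE.
have hlt : nc (v / 2 ^+ n) < r.
  rewrite hk; move: hn; rewrite ltr_pdivlMr // mulrC => hn.
  apply: le_lt_trans hn; rewrite ler_pM2r ?invr_gt0 //; lra.
have := hr _ hlt; rewrite hk => hh.
have -> : 2 ^+ n * (f (z + v / 2 ^+ n) - f z) - d * v =
  2 ^+ n * (f (z + v / 2 ^+ n) - f z - d * (v / 2 ^+ n)) by field.
rewrite ncM pE; apply: (@le_lt_trans _ _ (e / (1 + nc v) / 2 * nc v)).
  by rewrite mulrC -ler_pdivlMr //; move: hh; rewrite !mulrA.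
have -> : e / (1 + nc v) / 2 * nc v = (nc v / (1 + nc v)) * (e / 2).
  by field; rewrite gt_eqF.
have : nc v / (1 + nc v) <= 1 by rewrite ler_pdivrMr //; lra.
nra.
Qed.

End ComplexExponential.

(** * Lipschitz formulas *)

Section IntegerSums.
Context {R : realType}.
Local Notation C := R[i].
Implicit Types (f : int -> C).

Definition zb (k : int) : R := (1 + `|k%:~R|) ^- 2.

(** The partial sums run over -n <= k < n, which is the shape of the dyadic ranges and, after
    translation, a full set of residues. *)
Definition sumZ f : C := csum (fun k : nat => f k%:Z + f (- k.+1%:Z)).

Definition zdec f (B : R) := forall k, nc (f k) <= B * zb k.

Lemma zb_gt0 k : 0 < zb k.
Proof. by rewrite invr_gt0 exprn_gt0 // ltr_wpDr. Qed.

Lemma zb_nat (k : nat) : zb k%:Z = k.+1%:R ^- 2.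
Proof. by rewrite /zb ger0_norm ?ler0n // addrC natr1. Qed.

Lemma zbN k : zb (- k) = zb k.
Proof. by rewrite /zb mulrNz normrN. Qed.

Lemma sum_invsq_le N : \sum_(0 <= k < N) (k.+1%:R ^- 2 : R) <= 2.
Proof.
(* A sharper bound that the induction can carry, from x^-2 <= 2 (1/x - 1/(x + 1)) for x >= 1. *)
suff : \sum_(0 <= k < N) (k.+1%:R ^- 2 : R) <= 2 * (1 - N.+1%:R^-1).
  move=> h; apply: le_trans h _; have : (0 : R) <= N.+1%:R^-1 by rewrite invr_ge0.
  by move: (N.+1%:R^-1) => t t0; lra.
elim: N => [|N IH]; first by rewrite big_geq // invr1 subrr mulr0.
rewrite big_nat_recr //=; apply: le_trans (lerD IH (lexx _)) _.
have h1 : (0 : R) < N.+1%:R by rewrite ltr0n.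
have -> : N.+2%:R = N.+1%:R + 1 :> R by rewrite natr1.
set x : R := N.+1%:R in h1 *.
have : x ^- 2 <= 2 * (x^-1 - (x + 1)^-1).
  have -> : x^-1 - (x + 1)^-1 = (x * (x + 1))^-1 by field; apply/andP; split; apply/eqP; lra.
  rewrite ler_pdivlMr; last by nra.
  rewrite mulrC ler_pdivrMr ?exprn_gt0 // expr2.
  have : 1 <= x by rewrite ler1n.
  nra.
by move: (x ^- 2) (x^-1) ((x + 1)^-1) => ? ? ? ?; lra.
Qed.

Lemma bounded_invsq : bounded_series (fun k : nat => k.+1%:R ^- 2 : R).
Proof. by exists 2; exact: sum_invsq_le. Qed.

Lemma zdec_ge0 f B : zdec f B -> 0 <= B.
Proof.
move=> /(_ 0); rewrite /zb normr0 addr0 expr1n invr1 mulr1.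
by apply: le_trans; exact: nc_ge0.
Qed.

Lemma zdec_pos f B : zdec f B -> forall k : nat, nc (f k%:Z) <= B * k.+1%:R ^- 2.
Proof. by move=> h k; rewrite -zb_nat. Qed.

Lemma zdec_neg f B : zdec f B -> forall k : nat, nc (f (- k.+1%:Z)) <= B * k.+1%:R ^- 2.
Proof.
move=> h k; have B0 := zdec_ge0 h; apply: le_trans (h _) _; apply: ler_wpM2l => //.
by rewrite zbN zb_nat lef_pV2 ?posrE ?exprn_gt0 // ler_pXn2r ?nnegrE // ler_nat.
Qed.

Lemma bounded_Binvsq (B : R) : 0 <= B -> bounded_series (fun k : nat => B * k.+1%:R ^- 2).
Proof. by move=> B0; apply: bounded_seriesZ => //; exact: bounded_invsq. Qed.

Lemma csummable_pos f B : zdec f B -> csummable (fun k : nat => f k%:Z).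
Proof.
move=> h; apply: csummable_le (zdec_pos h) _; apply: bounded_Binvsq; exact: zdec_ge0 h.
Qed.

Lemma csummable_neg f B : zdec f B -> csummable (fun k : nat => f (- k.+1%:Z)).
Proof.
move=> h; apply: csummable_le (zdec_neg h) _; apply: bounded_Binvsq; exact: zdec_ge0 h.
Qed.

Lemma sumZE f B : zdec f B ->
  sumZ f = csum (fun k : nat => f k%:Z) + csum (fun k : nat => f (- k.+1%:Z)).
Proof. by move=> h; rewrite /sumZ csumD //; [exact: csummable_pos h|exact: csummable_neg h]. Qed.

Lemma csummableZ2 f B : zdec f B -> csummable (fun k : nat => f k%:Z + f (- k.+1%:Z)).
Proof. by move=> h; apply: csummableD; [exact: csummable_pos h|exact: csummable_neg h]. Qed.

Lemma eq_sumZ f f' : f =1 f' -> sumZ f = sumZ f'.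
Proof. by move=> /funext ->. Qed.

Lemma zdecD f f' B B' : zdec f B -> zdec f' B' -> zdec (fun k => f k + f' k) (B + B').
Proof.
by move=> h h' k; apply: le_trans (ncD _ _) _; rewrite mulrDl lerD.
Qed.

Lemma zdecZ z f B : zdec f B -> zdec (fun k => z * f k) (nc z * B).
Proof.
by move=> h k; rewrite ncM -mulrA ler_wpM2l // nc_ge0.
Qed.

Lemma sumZD f f' B B' : zdec f B -> zdec f' B' ->
  sumZ (fun k => f k + f' k) = sumZ f + sumZ f'.
Proof.
move=> h h'; rewrite -csumD; [|exact: csummableZ2 h|exact: csummableZ2 h'].
by apply: eq_csum => k; ring.
Qed.

Lemma sumZ_mull z f B : zdec f B -> sumZ (fun k => z * f k) = z * sumZ f.
Proof.
move=> h; rewrite -csumZ; last exact: csummableZ2 h.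
by apply: eq_csum => k; rewrite mulrDr.
Qed.

(** The range -n <= k < n is not symmetric, so the two one-sided sums are compared after detaching
    the term at 0. *)
Lemma sumZN f B : zdec f B -> sumZ (fun k => f (- k)) = sumZ f.
Proof.
move=> h; have h' : zdec (fun k => f (- k)) B by move=> k; rewrite -(zbN k).
rewrite (sumZE h) (sumZE h') (csum_shift (csummable_pos h)).
rewrite (csum_shift (csummable_pos h')) oppr0 addrAC; congr (_ + _ + _).
Qed.

Lemma sumZ_tannery (u : nat -> int -> C) (a : int -> C) B n0 :
  (forall n, (n0 <= n)%N -> zdec (u n) B) ->
  (forall k, ccvg \oo (u^~ k) (a k)) ->
  ccvg \oo (fun n => sumZ (u n)) (sumZ a).
Proof.
move=> h hu; have B0 := zdec_ge0 (h _ (leqnn n0)).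
apply: (@tannery _ _ _ (fun k : nat => B * k.+1%:R ^- 2 + B * k.+1%:R ^- 2) n0).
- by apply: bounded_seriesD; exact: bounded_Binvsq.
- move=> n k hn; apply: le_trans (ncD _ _) _.
  by apply: lerD; [exact: zdec_pos (h _ hn) _|exact: zdec_neg (h _ hn) _].
- by move=> k; apply: ccvgD; exact: hu.
Qed.

Lemma csum_fin N (a : nat -> C) : (forall k, (N <= k)%N -> a k = 0) ->
  csum a = \sum_(0 <= k < N) a k.
Proof.
move=> h; apply: csum_unique; apply/cvg_seqCP => e e0; exists N => n hn.
rewrite /series /= (@big_cat_nat _ _ _ N) //=.
have -> : \sum_(N <= k < n) a k = 0.
  by rewrite big_nat big1 // => k /andP[hk _]; exact: h.
by rewrite addr0 subrr nc0.
Qed.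

(* The unpaired terms outside the symmetric range are set to 0 before applying
   dominated convergence. *)
Lemma dyadic_limit (G : nat -> int -> C) (a : int -> C) B n0 :
  0 <= B ->
  (forall n (k : int), (n0 <= n)%N -> - (2 ^ n)%:Z <= k < (2 ^ n)%:Z ->
     nc (G n k) <= B * zb k) ->
  (forall k, ccvg \oo (G^~ k) (a k)) ->
  ccvg \oo (fun n => \sum_(0 <= k < 2 ^ n) (G n k%:Z + G n (- k.+1%:Z))) (sumZ a).
Proof.
move=> B0 hG hl.
pose u n (k : int) := if - (2 ^ n)%:Z <= k < (2 ^ n)%:Z then G n k else 0.
have -> : (fun n => \sum_(0 <= k < 2 ^ n) (G n k%:Z + G n (- k.+1%:Z))) =
    (fun n => sumZ (u n)).
  apply/funext => n; rewrite /sumZ (@csum_fin (2 ^ n)).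
    rewrite !big_nat; apply: eq_bigr => k /= hk; rewrite /u.
    have -> : - (2 ^ n)%:Z <= k%:Z < (2 ^ n)%:Z by apply/andP; split; lia.
    have -> // : - (2 ^ n)%:Z <= - k.+1%:Z < (2 ^ n)%:Z by apply/andP; split; lia.
  move=> k hk; rewrite /u; case: ifPn => [/andP[_]|_]; first lia.
  by case: ifPn => [/andP[]|_]; [lia|rewrite addr0].
apply: (@sumZ_tannery u a B n0).
  move=> n hn k; rewrite /u; case: ifPn => hk; first exact: hG.
  by rewrite nc0 mulr_ge0 // ltW // zb_gt0.
move=> k; apply: near_ccvg (hl k); exists `|k|.+1%N => // n /= hn.
have n2 : (n < 2 ^ n)%N by rewrite ltn_expl.
have hk : - (2 ^ n)%:Z <= k < (2 ^ n)%:Z by apply/andP; split; lia.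
by rewrite /u hk.
Qed.

(** The four sign quadrants are folded into one summand indexed by natural numbers, whence the
    constant 4 in the dominating product. *)
Lemma sumZ_exchange (a : int -> int -> C) B :
  (forall c d, nc (a c d) <= B * zb c * zb d) ->
  sumZ (fun c => sumZ (fun d => a c d)) = sumZ (fun d => sumZ (fun c => a c d)).
Proof.
move=> h; have hr c : zdec (a c) (B * zb c) by [].
have hc d : zdec (a^~ d) (B * zb d) by move=> c; rewrite mulrAC.
have B0 : 0 <= B.
  have := zdec_ge0 (hr 0); by rewrite /zb normr0 addr0 expr1n invr1 mulr1.
have := @csum_exchange _ (fun i j : nat => a i%:Z j%:Z + a (- i.+1%:Z) j%:Z
     + (a i%:Z (- j.+1%:Z) + a (- i.+1%:Z) (- j.+1%:Z)))
   (fun k : nat => 4 * B * k.+1%:R ^- 2) (fun k : nat => k.+1%:R ^- 2).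
have -> : (fun i : nat => csum (fun j : nat => a i%:Z j%:Z + a (- i.+1%:Z) j%:Z
     + (a i%:Z (- j.+1%:Z) + a (- i.+1%:Z) (- j.+1%:Z)))) =
   fun i : nat => sumZ (a i%:Z) + sumZ (a (- i.+1%:Z)).
  apply/funext => i; rewrite -csumD; [|exact: csummableZ2 (hr _)|exact: csummableZ2 (hr _)].
  by apply: eq_csum => j; ring.
move=> H; rewrite -[LHS]/(csum (fun i : nat => sumZ (a i%:Z) + sumZ (a (- i.+1%:Z)))) H.
- rewrite -[RHS]/(csum (fun j : nat => sumZ (a^~ j%:Z) + sumZ (a^~ (- j.+1%:Z)))).
  apply: eq_csum => j; rewrite csumD //; first exact: csummableZ2 (hc _).
  exact: csummableZ2 (hc _).
- by apply: bounded_Binvsq; rewrite mulr_ge0.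
- exact: bounded_invsq.
- by move=> k; rewrite !mulr_ge0 // invr_ge0 exprn_ge0.
- by move=> k; rewrite invr_ge0 exprn_ge0.
move=> i j.
have z1 : zb (- i.+1%:Z) <= zb i%:Z.
  by rewrite zbN !zb_nat lef_pV2 ?posrE ?exprn_gt0 // ler_pXn2r ?nnegrE // ler_nat.
have z2 : zb (- j.+1%:Z) <= zb j%:Z.
  by rewrite zbN !zb_nat lef_pV2 ?posrE ?exprn_gt0 // ler_pXn2r ?nnegrE // ler_nat.
have p1 := ltW (zb_gt0 (- i.+1%:Z)); have p2 := ltW (zb_gt0 (- j.+1%:Z)).
have p3 := ltW (zb_gt0 i%:Z); have p4 := ltW (zb_gt0 j%:Z).
rewrite -!zb_nat.
have H2 c d : zb c <= zb i -> zb d <= zb j -> nc (a c d) <= B * (zb i * zb j).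
  move=> hc' hd'; apply: le_trans (h _ _) _; rewrite -mulrA; apply: ler_wpM2l => //.
  by apply: ler_pM => //; exact: ltW (zb_gt0 _).
apply: le_trans (ncD _ _) _; apply: le_trans (lerD (ncD _ _) (ncD _ _)) _.
have := H2 i%:Z j%:Z (lexx _) (lexx _); have := H2 _ j%:Z z1 (lexx _).
have := H2 i%:Z _ (lexx _) z2; have := H2 _ _ z1 z2; lra.
Qed.

End IntegerSums.

(** * Limits of rescaled dyadic sums *)

Section Lipschitz.
Context {R : realType}.
Local Notation C := R[i].
Local Notation Re := complex.Re.
Local Notation Im := complex.Im.
Local Notation tpi := (two_pi_i R).

(** Integers [z] are allowed, the inverse of 0 being 0; so the limit theorem for upper half-plane
    points also serves at [z = 0], where it gives zeta values. *)
Definition shift_bounded (z : C) (K : R) :=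
  0 <= K /\ forall k : int, (nc (z + k%:~R))^-1 <= K / (1 + `|k%:~R|).

Lemma Re_int (k : int) : Re (k%:~R : C) = k%:~R.
Proof. by rewrite -(rmorph_int (real_complex R)). Qed.

Lemma Im_int (k : int) : Im (k%:~R : C) = 0.
Proof. by rewrite -(rmorph_int (real_complex R)). Qed.

Lemma nc_int (k : int) : nc (k%:~R : C) = `|k%:~R|.
Proof. by rewrite -(rmorph_int (real_complex R)) nc_real. Qed.

Lemma shift_boundedP (z : C) : Im z != 0 -> exists K, shift_bounded z K.
Proof.
move=> y0; set x := Re z; have ny : 0 < `|Im z| by rewrite normr_gt0.
exists ((1 + `|x| + `|Im z|) / `|Im z|); split.
  by rewrite divr_ge0 // !addr_ge0.
move=> k; have K0 : 0 < 1 + `|k%:~R| :> R by rewrite ltr_wpDr.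
have h1 : `|Im z| <= nc (z + k%:~R).
  by apply: le_trans (Im_le_nc _); rewrite ImD Im_int addr0.
have h2 : `|k%:~R| <= `|x| + nc (z + k%:~R).
  have h := Re_le_nc (z + k%:~R); rewrite ReD Re_int in h.
  have -> : k%:~R = - x + (x + k%:~R) :> R by rewrite addKr.
  by apply: le_trans (ler_normD _ _) _; rewrite normrN lerD2l.
rewrite ler_pdivlMr // mulrC ler_pdivrMr ?(lt_le_trans ny) //.
rewrite mulrAC ler_pdivlMr //; have := normr_ge0 x; nra.
Qed.

Lemma norm_int_ge1 (k : int) : k != 0 -> 1 <= `|k%:~R| :> R.
Proof. by move=> k0; rewrite -intr_norm -[1](mulr1z 1) ler_int; lia. Qed.

Lemma shift_bounded0 : shift_bounded 0 2.
Proof.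
split=> // k; rewrite add0r nc_int.
have [->|k0] := eqVneq k 0; first by rewrite normr0 invr0 addr0 divr_ge0.
have h := norm_int_ge1 k0.
rewrite ler_pdivlMr; last lra.
rewrite mulrC ler_pdivrMr; lra.
Qed.

Lemma shift_bounded_zdec z K w : (2 <= w)%N -> shift_bounded z K ->
  zdec (fun k => (z + k%:~R) ^- w) (K ^+ w).
Proof.
move=> w2 [K0 h] k; rewrite ncV ncX -exprVn.
apply: le_trans (_ : (K / (1 + `|k%:~R|)) ^+ w <= _).
  by rewrite ler_pXn2r ?nnegrE ?invr_ge0 ?nc_ge0 ?divr_ge0 // ?addr_ge0 // -?ltn0E; case: w w2.
rewrite expr_div_n ler_wpM2l ?exprn_ge0 // /zb.
have h1 : 1 <= 1 + `|k%:~R| :> R by rewrite lerDl.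
by rewrite lef_pV2 ?posrE ?exprn_gt0 ?(lt_le_trans ltr01) // ler_weXn2l.
Qed.

Lemma ccvg_shiftS (u : nat -> C) l : ccvg \oo u l -> ccvg \oo (fun n => u n.+1) l.
Proof.
move=> /cvg_seqCP h; apply/cvg_seqCP => e /h[N hN]; exists N => n hn.
by apply: hN; exact: leqW.
Qed.

Lemma ccvg_horner (T : Type) (F : set_system T) {FF : Filter F} (u : T -> C) a
  (p : {poly C}) : ccvg F u a -> ccvg F (fun t => p.[u t]) p.[a].
Proof.
move=> h; rewrite horner_coef -(big_mkord xpredT (fun i => p`_i * a ^+ i)).
rewrite (_ : (fun t => _) = (fun t => \sum_(0 <= i < size p) p`_i * u t ^+ i)).
  apply: (@ccvg_sum _ _ _ _ _ (fun i t => p`_i * u t ^+ i)) => i.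
  by apply: ccvgM; [exact: ccvg_cst|exact: ccvgX].
by apply/funext => t; rewrite horner_coef big_mkord.
Qed.

Lemma nc_horner_le (p : {poly C}) (x : C) (M : R) : nc x <= M ->
  nc p.[x] <= \sum_(i < size p) nc p`_i * M ^+ i.
Proof.
move=> h; rewrite horner_coef; apply: le_trans (nc_sum _ _ _) _.
apply: ler_sum => i _; rewrite ncM ncX ler_wpM2l ?nc_ge0 //.
have [->|i0] := eqVneq (i : nat) 0%N; first by [].
by rewrite ler_pXn2r ?nnegrE ?nc_ge0 ?(le_trans _ h) ?nc_ge0 // lt0n.
Qed.

Lemma qpar_scale_cvg (v : C) : ccvg \oo (fun n => 2 ^+ n * (1 - qpar (v / 2 ^+ n))) (- tpi * v).
Proof.
rewrite mulNr (_ : (fun n => _) =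
  (fun n => - (2 ^+ n * (qpar (0 + v / 2 ^+ n) - qpar 0)))).
  by apply: ccvgN; have := cderiv_seq v (cderiv_qpar (0 : C)); rewrite qpar0 mulr1.
by apply/funext => n; rewrite qpar0 add0r; ring.
Qed.

Lemma qpar_div_cvg (v : C) : ccvg \oo (fun n => qpar (v / 2 ^+ n)) 1.
Proof.
have /cderiv_cvg/cvg_nbhsCP h := cderiv_qpar (0 : C).
apply/cvg_seqCP => e /h[d d0 hd].
have v0 := nc_ge0 v; have v1 : 0 < 1 + nc v by lra.
have [|N hN] := @pow2_cvgy R (d / (1 + nc v)); first exact: divr_gt0.
exists N => n /hN hn; have := hd (v / 2 ^+ n); rewrite qpar0 subr0; apply.
rewrite ncM ncV ncX nc_nat mulrC.
move: hn; rewrite ltr_pdivlMr // => hn; apply: le_lt_trans hn.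
by rewrite ler_wpM2l ?invr_ge0 ?exprn_ge0 //; lra.
Qed.

(** For the Eulerian numerators below and Im z > 0 this is the sum of d^(w-1) q^d. *)
Definition qfrac (p : {poly C}) w (z : C) := p.[qpar z] * (1 - qpar z) ^- w.

(** In this range |k| / 2^(n+1) <= 1/2, and the contribution of Re z becomes negligible for large n;
    this is the domain of [nc_1Bqpar_ge]. *)
Lemma dyadic_range_bound (z : C) : exists n0, forall n (k : int), (n0 <= n)%N ->
  - (2 ^ n)%:Z <= k < (2 ^ n)%:Z ->
  `|Re ((z + k%:~R) / 2 ^+ n.+1)| <= 3 / 4 /\ `|Im ((z + k%:~R) / 2 ^+ n.+1)| <= `|Im z|.
Proof.
have x1 : 0 < 1 + `|Re z| by rewrite ltr_wpDr.
have [|n0 hn0] := @pow2_cvgy R ((1 + `|Re z|)^-1 / 4).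
  by rewrite divr_gt0 // invr_gt0.
exists n0 => n k /hn0 hn /andP[k1 k2].
have E : ((2 ^+ n.+1)^-1 : C) = ((2 ^+ n.+1)^-1)%:C.
  by rewrite fmorphV /= rmorphXn /= rmorph_nat.
have p0 : 0 < 2 ^+ n :> R by rewrite exprn_gt0.
have p1 : 1 <= 2 ^+ n :> R by rewrite exprn_ege1 // ler1n.
rewrite E ReM ImM !ReD !ImD Re_int Im_int /= !mulr0 subr0 add0r addr0 exprS.
rewrite !normrM (ger0_norm (_ : 0 <= (2 * 2 ^+ n)^-1)); last first.
  by rewrite invr_ge0 mulr_ge0 // ltW.
have hk : `|k%:~R| <= 2 ^+ n :> R.
  rewrite -natrX -[X in _ <= X]/((2 ^ n)%:Z%:~R) -intr_norm ler_int; lia.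
split; last first.
  rewrite -[leRHS]mulr1; apply: ler_wpM2l => //.
  by rewrite invf_le1; lra.
rewrite ler_pdivrMr; last lra.
apply: le_trans (ler_normD _ _) _.
have : `|Re z| <= 2 ^+ n / 4.
  move: hn; rewrite mulrC ltr_pdivlMr // mulrC ltr_pdivrMr // => hn; lra.
lra.
Qed.

(** As 1 - q(v/N) is asymptotic to -tpi v/N, each rescaled term tends to p(1) (-tpi v)^-w with v = z
    + k; the linear lower bound for 1 - q makes the convergence dominated. *)
Lemma qfrac_limit (p : {poly C}) w z K : (2 <= w)%N -> shift_bounded z K ->
  ccvg \oo (fun n => \sum_(0 <= k < 2 ^ n)
     ((2 ^+ n.+1) ^- w * qfrac p w ((z + k%:R) / 2 ^+ n.+1) +
      (2 ^+ n.+1) ^- w * qfrac p w ((z - k.+1%:R) / 2 ^+ n.+1)))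
   (p.[1] * (- tpi) ^- w * sumZ (fun k => (z + k%:~R) ^- w)).
Proof.
move=> w2 zK; have zd := shift_bounded_zdec w2 zK.
rewrite -(sumZ_mull _ zd).
have [n0 hn0] := dyadic_range_bound z.
have [c c0 hc] := nc_1Bqpar_ge (normr_ge0 (Im z)).
set M := expR (2 * pi * `|Im z|).
set Mp := \sum_(i < size p) nc p`_i * M ^+ i.
have M0 : 0 <= M by exact: expR_ge0.
have Mp0 : 0 <= Mp by apply: sumr_ge0 => i _; rewrite mulr_ge0 ?nc_ge0 ?exprn_ge0.
have := @dyadic_limit R (fun n k => (2 ^+ n.+1) ^- w * qfrac p w ((z + k%:~R) / 2 ^+ n.+1))
  (fun k => p.[1] * (- tpi) ^- w * (z + k%:~R) ^- w) (Mp * c ^- w * K ^+ w) n0.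
have -> : (fun n => \sum_(0 <= k < 2 ^ n)
      ((2 ^+ n.+1) ^- w * qfrac p w ((z + k%:R) / 2 ^+ n.+1) +
       (2 ^+ n.+1) ^- w * qfrac p w ((z - k.+1%:R) / 2 ^+ n.+1))) =
   (fun n => \sum_(0 <= k < 2 ^ n)
    ((2 ^+ n.+1) ^- w * qfrac p w ((z + k%:Z%:~R) / 2 ^+ n.+1) +
       (2 ^+ n.+1) ^- w * qfrac p w ((z + (- k.+1%:Z)%:~R) / 2 ^+ n.+1))).
  by apply/funext => n; apply: eq_bigr => k _; rewrite mulrNz.
apply.
- by rewrite !mulr_ge0 // ?invr_ge0 ?exprn_ge0 // ?(ltW c0) //; case: zK.
- move=> n k hn hk; have [h1 h2] := hn0 n k hn hk.
  set v := (z + k%:~R) / 2 ^+ n.+1 in h1 h2 *.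
  have p0 : 0 < 2 ^+ n.+1 :> R by rewrite exprn_gt0.
  have pE : nc (2 ^+ n.+1 : C) = 2 ^+ n.+1 by rewrite ncX nc_nat.
  have vE : nc v = nc (z + k%:~R) / 2 ^+ n.+1 by rewrite ncM ncV pE.
  have hq : nc (qpar v) <= M.
    rewrite nc_qpar ler_expR -mulrN ler_wpM2l ?mulr_ge0 ?pi_ge0 //.
    by apply: le_trans (ler_norm _) _; rewrite normrN.
  have hi : (nc (1 - qpar v))^-1 <= c^-1 * (nc v)^-1.
    have [v0|v0] := eqVneq v 0.
      by rewrite v0 qpar0 subrr nc0 invr0 mulr0.
    rewrite -invfM lef_pV2 ?posrE ?mulr_gt0 ?nc_gt0 ?hc //.
    by rewrite -nc_gt0; apply: lt_le_trans (hc _ h1 h2); rewrite mulr_gt0 ?nc_gt0.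
  have z1 := zd k; rewrite ncV ncX in z1.
  rewrite /qfrac !ncM !ncV !ncX nc_nat -!exprVn.
  apply: le_trans (_ : ((2 ^+ n.+1)^-1) ^+ w * (Mp * (c^-1 * (nc v)^-1) ^+ w) <= _).
    rewrite -exprVn; apply: ler_wpM2l; first by rewrite !exprn_ge0 ?invr_ge0.
    apply: ler_pM; rewrite ?exprn_ge0 ?invr_ge0 ?nc_ge0 //; first exact: nc_horner_le.
    by rewrite ler_pXn2r ?nnegrE ?mulr_ge0 ?invr_ge0 ?nc_ge0 ?(ltW c0) //; case: (w) w2.
  have -> : ((2 ^+ n.+1)^-1) ^+ w * (Mp * (c^-1 * (nc v)^-1) ^+ w) =
     Mp * c^-1 ^+ w * ((nc (z + k%:~R))^-1) ^+ w.
    rewrite vE invfM invrK !exprMn.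
    have e1 : (2 ^+ n.+1)^-1 ^+ w * (2 ^+ n.+1) ^+ w = 1 :> R.
      by rewrite -exprMn mulVf ?expr1n // gt_eqF.
    move: e1; move: ((2 ^+ n.+1)^-1 ^+ w) ((2 ^+ n.+1) ^+ w) => x y e1.
    transitivity (x * y * (Mp * c^-1 ^+ w * (nc (z + k%:~R))^-1 ^+ w)); first by ring.
    by rewrite e1 mul1r.
  rewrite -[leRHS]mulrA; apply: ler_wpM2l; last by rewrite exprVn.
  by rewrite mulr_ge0 ?exprn_ge0 ?invr_ge0 // ltW.
- move=> k; set v := z + k%:~R.
  (* When [z] is an integer one term sits at the pole; there both the term and its limit are 0 by
     the convention on inverses. *)
  have [v0|v0] := eqVneq v 0.
    rewrite v0 expr0n; have -> : (w == 0)%N = false by case: (w) w2.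
    rewrite invr0 mulr0 (_ : (fun n => _) = (fun=> 0)); first exact: ccvg_cst.
    apply/funext => n; rewrite /qfrac mul0r qpar0 subrr expr0n.
    have -> : (w == 0)%N = false by case: (w) w2.
    by rewrite invr0 !mulr0.
  have h1 := ccvg_shiftS (qpar_scale_cvg v).
  have h2 := ccvg_shiftS (qpar_div_cvg v).
  have tv : - tpi * v != 0 by rewrite mulf_neq0 // oppr_eq0 two_pi_i_neq0.
  rewrite -[p.[1] * _ * _]mulrA -!exprVn -exprMn -invfM (_ : (fun n => _) = (fun n =>
    p.[qpar (v / 2 ^+ n.+1)] * (2 ^+ n.+1 * (1 - qpar (v / 2 ^+ n.+1)))^-1 ^+ w)).
    by apply: ccvgM; [exact: ccvg_horner|apply: ccvgX; exact: ccvgV].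
  apply/funext => n /=; rewrite /qfrac mulrCA; congr (_ * _).
  by rewrite [RHS]exprVn exprMn invfM.
Qed.

End Lipschitz.

(** * Duplication identities, zeta values and the Lipschitz formulas *)

Section LipschitzFormula.
Context {R : realType}.
Local Notation C := R[i].
Local Notation Re := complex.Re.
Local Notation Im := complex.Im.
Local Notation tpi := (two_pi_i R).

Lemma pow2C_neq0 n : (2 ^+ n : C) != 0.
Proof. by rewrite expf_neq0 // pnatr_eq0. Qed.

Lemma dyadic_split (G : nat -> C) n :
  \sum_(0 <= j < 2 ^ n.+1) G j = \sum_(0 <= j < 2 ^ n) (G j + G (j + 2 ^ n)%N).
Proof.
rewrite expnS mul2n -addnn (@big_cat_nat _ _ _ (2 ^ n)) ?leq_addr //= big_split /=.
by congr (_ + _); rewrite -{1}(add0n (2 ^ n)%N) big_addn addnK.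
Qed.

(** Periodicity moves the index -k-1 to 2^(n+1)-k-1. The centred range is the one that converges,
    the range from 0 is the one that duplication produces. *)
Lemma dyadic_center (F : C -> C) z n : (forall v, F (v + 1) = F v) ->
  \sum_(0 <= k < 2 ^ n) (F ((z + k%:R) / 2 ^+ n.+1) + F ((z - k.+1%:R) / 2 ^+ n.+1))
  = \sum_(0 <= j < 2 ^ n.+1) F ((z + j%:R) / 2 ^+ n.+1).
Proof.
move=> per; rewrite dyadic_split !big_split /=; congr (_ + _).
rewrite [RHS]big_nat_rev /= add0n !big_nat; apply: eq_bigr => k /= hk.
rewrite natrD natrB // -[LHS]per; congr F.
have p0 := pow2C_neq0 n; rewrite exprS natrX; field.
by rewrite p0 /=.
Qed.

Lemma qpar_double (u : C) : qpar (u / 2) ^+ 2 = qpar u.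
Proof. by rewrite -qpar_natM; congr qpar; field. Qed.

Lemma qpar_half_shift (u : C) : qpar (u / 2 + 2^-1) = - qpar (u / 2).
Proof. by rewrite qparD qpar_half mulrN1. Qed.

Section Duplication.
Variables (f : C -> C) (K : C).
Hypothesis dup : forall t, t ^+ 2 != 1 -> f t + f (- t) = K * f (t ^+ 2).

Lemma dup_step z n :
  \sum_(0 <= j < 2 ^ n.+1) f (qpar ((z + j%:R) / 2 ^+ n.+1)) =
  \sum_(0 <= j < 2 ^ n)
    (f (qpar ((z + j%:R) / 2 ^+ n / 2)) + f (- qpar ((z + j%:R) / 2 ^+ n / 2))).
Proof.
have p0 := pow2C_neq0 n; rewrite dyadic_split.
apply: eq_bigr => j _; rewrite -qpar_half_shift natrD natrX exprS.
by congr (f (qpar _) + f (qpar _)); field; rewrite p0.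
Qed.

(** The points qpar ((z + j) / 2^n) are the 2^n-th roots of qpar z, and one duplication merges the
    opposite roots t and -t into t^2. *)
Lemma dup_iter z n : qpar z != 1 ->
  \sum_(0 <= j < 2 ^ n) f (qpar ((z + j%:R) / 2 ^+ n)) = K ^+ n * f (qpar z).
Proof.
move=> qz; elim: n => [|n IH].
  by rewrite expn0 big_nat1 expr0 mul1r addr0 divr1.
rewrite dup_step exprS -mulrA -IH mulr_sumr; apply: eq_bigr => j _.
rewrite dup qpar_double //; apply: contra qz => /eqP h; apply/eqP.
have := congr1 (fun x => x ^+ (2 ^ n)%N) h; rewrite expr1n -qpar_natM natrX => <-.
by rewrite mulrCA divff ?mulr1 ?(qparD_int z j%:Z) // pow2C_neq0.
Qed.

Lemma qpar_real_neq1 (x : R) : 0 < x < 1 -> qpar (x%:C) != 1.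
Proof.
move=> /andP[x0 x1]; apply/eqP; rewrite qparE /= mulr0 oppr0 expR0 mul1r.
case=> h _; have := sin_gt0_pi (x := pi * x); have p0 := pi_gt0 R.
have e : 2 * pi * x = (pi * x) *+ 2 by rewrite mulr2n; ring.
move: h; rewrite e cos_mulr2n cos2sin2.
set s := sin _ => h; have : s ^+ 2 = 0 by move: h; rewrite mulr2n; lra.
move/eqP; rewrite sqrf_eq0 => /eqP ->; rewrite ltxx => H.
suff : false by []; apply: H; apply/andP; split; first exact: mulr_gt0.
by rewrite -[ltRHS]mulr1 ltr_pM2l.
Qed.

(** At z = 0 the pair 1, -1 escapes the duplication identity, since 1 is a pole; each step leaves a
    term f (-1), and these form a geometric sum. *)
Lemma dup_iter0 n : f 1 = 0 -> K != 1 ->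
  \sum_(0 <= j < 2 ^ n) f (qpar ((0 + j%:R) / 2 ^+ n)) =
  f (- 1) * (K ^+ n - 1) / (K - 1).
Proof.
move=> f1 K1; have K10 : K - 1 != 0 by rewrite subr_eq0.
elim: n => [|n IH].
  by rewrite expn0 big_nat1 addr0 mul0r qpar0 f1 expr0 subrr mulr0 mul0r.
rewrite dup_step; pose T := \sum_(0 <= j < 2 ^ n) f (qpar ((0 + j%:R) / 2 ^+ n)).
have n2 : (0 < 2 ^ n)%N by rewrite expn_gt0.
have -> : \sum_(0 <= j < 2 ^ n)
   (f (qpar ((0 + j%:R) / 2 ^+ n / 2)) + f (- qpar ((0 + j%:R) / 2 ^+ n / 2))) =
   f (- 1) + K * T.
  rewrite /T !(big_ltn n2) !addr0 !mul0r qpar0 f1 !add0r mulr_sumr; congr (_ + _).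
  rewrite !big_nat; apply: eq_bigr => j /andP[j0 j1]; rewrite dup qpar_double //.
  have E : (0 + j%:R) / 2 ^+ n = (j%:R / 2 ^+ n : R)%:C.
    by rewrite add0r rmorphM fmorphV rmorphXn /= !rmorph_nat.
  rewrite E; apply: qpar_real_neq1; rewrite divr_gt0 ?ltr0n ?exprn_gt0 //=.
  by rewrite ltr_pdivrMr ?exprn_gt0 // mul1r -natrX ltr_nat.
by rewrite /T IH exprS; field.
Qed.

End Duplication.

Lemma pow2_inv_cvg0 : ccvg \oo (fun n => (2 ^+ n)^-1) (0 : C).
Proof.
apply/cvg_seqCP => e /pow2_cvgy[N hN]; exists N => n /hN.
by rewrite subr0 ncV ncX nc_nat.
Qed.

Section FormulaWeight.
Variables (p : {poly C}) (w : nat).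
Hypothesis w2 : (2 <= w)%N.
Local Notation f := (fun t : C => p.[t] * (1 - t) ^- w).
Hypothesis dup : forall t, t ^+ 2 != 1 -> f t + f (- t) = 2 ^+ w * f (t ^+ 2).

Let qfrac_per v : qfrac p w (v + 1) = qfrac p w v.
Proof. by rewrite /qfrac qparD1. Qed.

(** Duplication makes the sequence of [qfrac_limit] constant. *)
Lemma lipschitz z K : shift_bounded z K -> qpar z != 1 ->
  p.[1] * (- tpi) ^- w * sumZ (fun k => (z + k%:~R) ^- w) = qfrac p w z.
Proof.
move=> zK qz; have h := qfrac_limit p w2 zK.
apply: (ccvg_unique h); rewrite (_ : (fun n => _) = (fun=> qfrac p w z)).
  exact: ccvg_cst.
apply/funext => n; under eq_bigr do rewrite -mulrDr.
rewrite -mulr_sumr dyadic_center; last exact: qfrac_per.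
rewrite /qfrac (dup_iter dup) // -exprM mulnC exprM mulKf //.
Qed.

(** By [dup_iter0] the sequence of [qfrac_limit] at 0 is the right-hand side times 1 -
    2^(-w(n+1)). *)
Lemma lipschitz0 :
  p.[1] * (- tpi) ^- w * sumZ (fun k => (k%:~R : C) ^- w) = f (- 1) / (2 ^+ w - 1).
Proof.
have h := qfrac_limit p w2 shift_bounded0.
have -> : sumZ (fun k => (k%:~R : C) ^- w) = sumZ (fun k => (0 + k%:~R) ^- w).
  by apply: eq_sumZ => k; rewrite add0r.
have w0 : (w == 0)%N = false by case: (w) w2.
have K1 : (2 ^+ w : C) != 1.
  rewrite -natrX -[1]/(1%:R) eqr_nat; case: (w) w0 => // m _.
  by rewrite expnS; have := expn_gt0 2 m; lia.
have K10 : (2 ^+ w : C) - 1 != 0 by rewrite subr_eq0.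
apply: (ccvg_unique h).
rewrite (_ : (fun n => _) = (fun n => f (- 1) / (2 ^+ w - 1) * (1 - (2 ^+ n.+1)^-1 ^+ w))).
  rewrite -[X in ccvg _ _ X]mulr1; apply: ccvgM; first exact: ccvg_cst.
  rewrite -[X in ccvg _ _ X]subr0; apply: ccvgB; first exact: ccvg_cst.
  rewrite (_ : 0 = (0 : C) ^+ w); last by rewrite expr0n w0.
  by apply: ccvgX; apply: ccvg_shiftS pow2_inv_cvg0.
apply/funext => n; under eq_bigr do rewrite -mulrDr.
rewrite -mulr_sumr dyadic_center; last exact: qfrac_per.
rewrite /qfrac (dup_iter0 dup) //; last by rewrite subrr expr0n w0 invr0 mulr0.
have e1 : (2 ^+ n.+1) ^- w * (2 ^+ w) ^+ n.+1 = 1 :> C.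
  by rewrite -exprM mulnC exprM mulVf // expf_neq0 // pow2C_neq0.
rewrite exprVn; move: e1; move: ((2 ^+ n.+1) ^- w) ((2 ^+ w) ^+ n.+1) => x y e1.
set g := p.[-1] * _; transitivity (g / (2 ^+ w - 1) * (x * y - x)); first by field.
by rewrite e1.
Qed.

End FormulaWeight.

(** Eulerian polynomials: eul_w(x) (1 - x)^-w is the sum of d^(w-1) x^d, and eul_w(1) = (w-1)!,
    which gives the factors 6 and 120 below. *)
Definition eul2 : {poly C} := Poly [:: 0; 1].
Definition eul4 : {poly C} := Poly [:: 0; 1; 4; 1].
Definition eul6 : {poly C} := Poly [:: 0; 1; 26; 66; 26; 1].

Lemma eul2E x : eul2.[x] = x.
Proof. by rewrite horner_Poly /=; ring. Qed.

Lemma eul4E x : eul4.[x] = x + 4 * x ^+ 2 + x ^+ 3.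
Proof. by rewrite horner_Poly /=; ring. Qed.

Lemma eul6E x : eul6.[x] = x + 26 * x ^+ 2 + 66 * x ^+ 3 + 26 * x ^+ 4 + x ^+ 5.
Proof. by rewrite horner_Poly /=; ring. Qed.

Lemma sqr_neq1 (t : C) : t ^+ 2 != 1 ->
  [/\ 1 - t != 0, 1 - - t != 0, 1 - t ^+ 2 != 0 & 1 + t != 0].
Proof.
move=> h; have h3 : 1 - t ^+ 2 != 0 by rewrite subr_eq0 eq_sym.
have : (1 - t) * (1 + t) != 0.
  by apply: contra h3 => /eqP e; apply/eqP; rewrite -e; ring.
by rewrite mulf_eq0 negb_or => /andP[h1 h2]; split; rewrite ?opprK.
Qed.

Lemma eul2_dup t : t ^+ 2 != 1 ->
  eul2.[t] * (1 - t) ^- 2 + eul2.[- t] * (1 - - t) ^- 2 =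
  2 ^+ 2 * (eul2.[t ^+ 2] * (1 - t ^+ 2) ^- 2).
Proof.
move=> /sqr_neq1[h1 h2 h3 h4]; rewrite !eul2E; field.
by rewrite ?h1 ?h2 ?h3 ?h4.
Qed.

Lemma eul4_dup t : t ^+ 2 != 1 ->
  eul4.[t] * (1 - t) ^- 4 + eul4.[- t] * (1 - - t) ^- 4 =
  2 ^+ 4 * (eul4.[t ^+ 2] * (1 - t ^+ 2) ^- 4).
Proof.
move=> /sqr_neq1[h1 h2 h3 h4]; rewrite !eul4E; field.
by rewrite ?h1 ?h2 ?h3 ?h4.
Qed.

Lemma eul6_dup t : t ^+ 2 != 1 ->
  eul6.[t] * (1 - t) ^- 6 + eul6.[- t] * (1 - - t) ^- 6 =
  2 ^+ 6 * (eul6.[t ^+ 2] * (1 - t ^+ 2) ^- 6).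
Proof.
move=> /sqr_neq1[h1 h2 h3 h4]; rewrite !eul6E; field.
by rewrite ?h1 ?h2 ?h3 ?h4.
Qed.

(** This is 2 zeta(2) = pi^2 / 3, the term at 0 being 0; the next two lemmas are 2 zeta(4) and 2
    zeta(6). *)
Lemma zeta2E : sumZ (fun k => (k%:~R : C) ^- 2) = - tpi ^+ 2 / 12.
Proof.
have := lipschitz0 (isT : (2 <= 2)%N) eul2_dup; rewrite !eul2E.
have t0 := @two_pi_i_neq0 R; set S := sumZ _ => h.
transitivity ((- tpi) ^+ 2 * (1 * (- tpi) ^- 2 * S)); first by field.
by rewrite h; field.
Qed.

Lemma zeta4E : sumZ (fun k => (k%:~R : C) ^- 4) = tpi ^+ 4 / 720.
Proof.
have := lipschitz0 (isT : (2 <= 4)%N) eul4_dup; rewrite !eul4E.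
have t0 := @two_pi_i_neq0 R; set S := sumZ _ => h.
transitivity (tpi ^+ 4 / 6 * ((1 + 4 * 1 ^+ 2 + 1 ^+ 3) * (- tpi) ^- 4 * S)).
  by field.
by rewrite h; field.
Qed.

Lemma zeta6E : sumZ (fun k => (k%:~R : C) ^- 6) = - tpi ^+ 6 / (60 * 504).
Proof.
have := lipschitz0 (isT : (2 <= 6)%N) eul6_dup; rewrite !eul6E.
have t0 := @two_pi_i_neq0 R; set S := sumZ _ => h.
transitivity (tpi ^+ 6 / 120 * ((1 + 26 * 1 ^+ 2 + 66 * 1 ^+ 3 + 26 * 1 ^+ 4 + 1 ^+ 5)
   * (- tpi) ^- 6 * S)); first by field.
by rewrite h; field.
Qed.

Lemma qpar_upper_neq1 z : @upper R z -> qpar z != 1.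
Proof.
by move=> /nc_qpar_lt1 h; apply: contraTneq h => ->; rewrite nc1 ltxx.
Qed.

Lemma upper_shift_bounded z : @upper R z -> exists K, shift_bounded z K.
Proof. by move=> h; apply: shift_boundedP; rewrite gt_eqF. Qed.

Lemma lipschitz2 z : @upper R z ->
  sumZ (fun k => (z + k%:~R) ^- 2) = tpi ^+ 2 * qfrac eul2 2 z.
Proof.
move=> hz; have [K zK] := upper_shift_bounded hz.
rewrite -(lipschitz (isT : (2 <= 2)%N) eul2_dup zK (qpar_upper_neq1 hz)) eul2E.
by have t0 := @two_pi_i_neq0 R; field.
Qed.

Lemma lipschitz4 z : @upper R z ->
  sumZ (fun k => (z + k%:~R) ^- 4) = tpi ^+ 4 / 6 * qfrac eul4 4 z.
Proof.
move=> hz; have [K zK] := upper_shift_bounded hz.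
rewrite -(lipschitz (isT : (2 <= 4)%N) eul4_dup zK (qpar_upper_neq1 hz)) eul4E.
by have t0 := @two_pi_i_neq0 R; field.
Qed.

Lemma lipschitz6 z : @upper R z ->
  sumZ (fun k => (z + k%:~R) ^- 6) = tpi ^+ 6 / 120 * qfrac eul6 6 z.
Proof.
move=> hz; have [K zK] := upper_shift_bounded hz.
rewrite -(lipschitz (isT : (2 <= 6)%N) eul6_dup zK (qpar_upper_neq1 hz)) eul6E.
by have t0 := @two_pi_i_neq0 R; field.
Qed.

Lemma inv1B_dup (t : C) : t ^+ 2 != 1 ->
  (1 - t)^-1 + (1 - - t)^-1 = 2 * (1 - t ^+ 2)^-1.
Proof.
move=> /sqr_neq1[h1 h2 h3 h4]; field.
by rewrite ?h1 ?h2 ?h3 ?h4.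
Qed.

Lemma qpar_neq1 (u : C) : Im u != 0 -> qpar u != 1.
Proof.
move=> h; apply: contraNneq h => e.
have := nc_qpar u; rewrite e nc1 => /esym h.
have /expR_inj/eqP : expR (- (2 * pi * Im u)) = expR 0 by rewrite h expR0.
rewrite oppr_eq0 !mulf_eq0 pnatr_eq0 /=.
by rewrite (gt_eqF (pi_gt0 R)).
Qed.

(* The summands decay quadratically only after subtraction. *)
Lemma lipschitz1 (u v : C) : Im u != 0 -> Im v != 0 ->
  sumZ (fun k => (u + k%:~R)^-1 - (v + k%:~R)^-1) =
  - tpi * ((1 - qpar u)^-1 - (1 - qpar v)^-1).
Proof.
move=> hu hv; have [Ku [Ku0 bu]] := shift_boundedP hu.
have [Kv [Kv0 bv]] := shift_boundedP hv.
have tn0 : - tpi != 0 by rewrite oppr_eq0 two_pi_i_neq0.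
have qu := qpar_neq1 hu; have qv := qpar_neq1 hv.
have [n1 r1] := dyadic_range_bound u; have [n2 r2] := dyadic_range_bound v.
have [c1 c10 h1] := nc_1Bqpar_ge (normr_ge0 (Im u)).
have [c2 c20 h2] := nc_1Bqpar_ge (normr_ge0 (Im v)).
have /cvg_seqCP/(_ _ ltr01)[n3 r3] := ccvg_shiftS (qpar_scale_cvg (v - u)).
set M := expR (2 * pi * `|Im u|); set D := 1 + nc (- tpi * (v - u)).
have shift_neq0 (x : C) (k : int) : Im x != 0 -> x + k%:~R != 0.
  by move=> hx; apply: contraNneq hx => /(congr1 (@complex.Im R)); rewrite ImD Im_int addr0 => ->.
have M0 : 0 <= M by exact: expR_ge0.
have D0 : 0 <= D by rewrite addr_ge0 // nc_ge0.
pose G n (k : int) := (2 ^+ n.+1)^-1 * (1 - qpar ((u + k%:~R) / 2 ^+ n.+1))^-1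
  - (2 ^+ n.+1)^-1 * (1 - qpar ((v + k%:~R) / 2 ^+ n.+1))^-1.
have lim1 (a : C) (k : int) : Im a != 0 ->
    ccvg \oo (fun n => (2 ^+ n.+1)^-1 * (1 - qpar ((a + k%:~R) / 2 ^+ n.+1))^-1)
      ((- tpi)^-1 * (a + k%:~R)^-1).
  move=> ha; rewrite -invfM (_ : (fun n => _) =
     (fun n => (2 ^+ n.+1 * (1 - qpar ((a + k%:~R) / 2 ^+ n.+1)))^-1)).
    apply: ccvgV; first by rewrite mulf_neq0 // shift_neq0.
    exact: ccvg_shiftS (qpar_scale_cvg _).
  by apply/funext => n; rewrite invfM.
have Gl k : ccvg \oo (G^~ k) ((- tpi)^-1 * (u + k%:~R)^-1 - (- tpi)^-1 * (v + k%:~R)^-1).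
  by apply: ccvgB; exact: lim1.
have Gb n (k : int) : (maxn n1 (maxn n2 n3) <= n)%N ->
    - (2 ^ n)%:Z <= k < (2 ^ n)%:Z ->
    nc (G n k) <= M * D * c1^-1 * c2^-1 * Ku * Kv * zb k.
  rewrite !geq_max => /and3P[k1 k2 k3] hk.
  have [a1 a2] := r1 n k k1 hk; have [b1 b2] := r2 n k k2 hk.
  have {}r3 := r3 n k3.
  set N : C := 2 ^+ n.+1 in a1 a2 b1 b2 r3 *.
  have N0 : N != 0 by exact: pow2C_neq0.
  have nN : 0 < nc N by rewrite nc_gt0.
  set x := (u + k%:~R) / N in a1 a2 *; set y := (v + k%:~R) / N in b1 b2 *.
  have x0 : x != 0 by rewrite mulf_neq0 ?invr_neq0 // shift_neq0.
  have y0 : y != 0 by rewrite mulf_neq0 ?invr_neq0 // shift_neq0.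
  have e1 : c1 * nc x <= nc (1 - qpar x) := h1 _ a1 a2.
  have e2 : c2 * nc y <= nc (1 - qpar y) := h2 _ b1 b2.
  have p1 : 0 < nc (1 - qpar x) by apply: lt_le_trans e1; rewrite mulr_gt0 ?nc_gt0.
  have p2 : 0 < nc (1 - qpar y) by apply: lt_le_trans e2; rewrite mulr_gt0 ?nc_gt0.
  have yx : y = x + (v - u) / N by rewrite /x /y; field.
  (* Taking the difference gains a factor of order 1/N, because y - x = (v - u) / N. Together with
     the outer 1/N it compensates the two inverses, each of order N / (1 + |k|). *)
  have -> : G n k = N^-1 * (qpar x * (1 - qpar ((v - u) / N)))
       * (1 - qpar x)^-1 * (1 - qpar y)^-1.
    rewrite /G -/N -/x -/y {1 2}yx qparD.
    by field; rewrite -?qparD -?yx ?N0 -?nc_gt0 ?p1 ?p2.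
  have q1 : nc (qpar x) <= M.
    rewrite nc_qpar ler_expR -mulrN ler_wpM2l ?mulr_ge0 ?pi_ge0 //.
    by apply: le_trans (ler_norm _) _; rewrite normrN.
  have q2 : nc N * nc (1 - qpar ((v - u) / N)) <= D.
    rewrite -ncM /D; have := le_lt_trans (ler_ncB _ _) r3; lra.
  have i1 : (nc (1 - qpar x))^-1 <= nc N * (c1^-1 * (Ku / (1 + `|k%:~R|))).
    apply: le_trans (_ : (c1 * nc x)^-1 <= _).
      by rewrite lef_pV2 ?posrE // mulr_gt0 ?nc_gt0.
    rewrite invfM /x ncM ncV invfM invrK mulrA mulrC.
    apply: ler_wpM2l; first exact: ltW.
    by apply: ler_wpM2l; [rewrite invr_ge0 ltW|exact: bu].
  have i2 : (nc (1 - qpar y))^-1 <= nc N * (c2^-1 * (Kv / (1 + `|k%:~R|))).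
    apply: le_trans (_ : (c2 * nc y)^-1 <= _).
      by rewrite lef_pV2 ?posrE // mulr_gt0 ?nc_gt0.
    rewrite invfM /y ncM ncV invfM invrK mulrA mulrC.
    apply: ler_wpM2l; first exact: ltW.
    by apply: ler_wpM2l; [rewrite invr_ge0 ltW|exact: bv].
  rewrite [nc (_ * (1 - qpar y)^-1)]ncM [nc (_ * (1 - qpar x)^-1)]ncM.
  rewrite [nc (N^-1 * _)]ncM [nc (qpar x * _)]ncM !ncV.
  set s := nc (1 - qpar ((v - u) / N)) in q2 *; have s0 : 0 <= s := nc_ge0 _.
  have q3 : s <= (nc N)^-1 * D by rewrite mulrC ler_pdivlMr // mulrC.
  apply: le_trans (_ : (nc N)^-1 * (M * ((nc N)^-1 * D))
     * (nc N * (c1^-1 * (Ku / (1 + `|k%:~R|)))) * (nc N * (c2^-1 * (Kv / (1 + `|k%:~R|)))) <= _).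
    do 2![apply: ler_pM; rewrite ?mulr_ge0 ?invr_ge0 ?nc_ge0 //].
    apply: ler_wpM2l; first by rewrite invr_ge0 nc_ge0.
    by apply: ler_pM; rewrite ?nc_ge0.
  rewrite le_eqVlt; apply/orP; left; apply/eqP; rewrite /zb.
  have k0 : 1 + `|k%:~R| != 0 :> R by rewrite gt_eqF // ltr_wpDr.
  by field; rewrite k0 (gt_eqF nN) (gt_eqF c10) (gt_eqF c20).
have H := dyadic_limit _ Gb Gl.
have zd : zdec (fun k => (u + k%:~R)^-1 - (v + k%:~R)^-1) (nc (v - u) * Ku * Kv).
  move=> k; have -> : (u + k%:~R)^-1 - (v + k%:~R)^-1 =
      (v - u) * (u + k%:~R)^-1 * (v + k%:~R)^-1.
    by field; rewrite !shift_neq0.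
  rewrite !ncM !ncV.
  apply: le_trans (_ : nc (v - u) * (Ku / (1 + `|k%:~R|)) * (Kv / (1 + `|k%:~R|)) <= _).
    by apply: ler_pM; rewrite ?mulr_ge0 ?invr_ge0 ?nc_ge0 // ler_wpM2l ?nc_ge0.
  rewrite le_eqVlt; apply/orP; left; apply/eqP; rewrite /zb.
  have k0 : 1 + `|k%:~R| != 0 :> R by rewrite gt_eqF // ltr_wpDr.
  by field; rewrite k0.
have E : sumZ (fun k => (- tpi)^-1 * (u + k%:~R)^-1 - (- tpi)^-1 * (v + k%:~R)^-1) =
  (- tpi)^-1 * sumZ (fun k => (u + k%:~R)^-1 - (v + k%:~R)^-1).
  by rewrite -(sumZ_mull _ zd); apply: eq_sumZ => k; rewrite mulrBr.
rewrite E in H.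
suff <- : (- tpi)^-1 * sumZ (fun k => (u + k%:~R)^-1 - (v + k%:~R)^-1) =
   (1 - qpar u)^-1 - (1 - qpar v)^-1 by rewrite mulVKf.
apply: ccvg_unique (H _) _; first by rewrite !mulr_ge0 // invr_ge0 ltW.
rewrite (_ : (fun n => _) = (fun=> (1 - qpar u)^-1 - (1 - qpar v)^-1)).
  exact: ccvg_cst.
(* Each half is computed exactly by duplication for 1 / (1 - t) with factor 2, so the sequence is
   constant. *)
have part (a : C) n : qpar a != 1 ->
    \sum_(0 <= k < 2 ^ n) ((1 - qpar ((a + k%:R) / 2 ^+ n.+1))^-1 +
       (1 - qpar ((a - k.+1%:R) / 2 ^+ n.+1))^-1) = 2 ^+ n.+1 * (1 - qpar a)^-1.
  move=> qa; rewrite (@dyadic_center (fun x => (1 - qpar x)^-1)).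
    exact: (@dup_iter (fun t => (1 - t)^-1) 2 inv1B_dup).
  by move=> x; rewrite qparD1.
apply/funext => n.
have -> : \sum_(0 <= k < 2 ^ n) (G n k%:Z + G n (- k.+1%:Z)) =
  (2 ^+ n.+1)^-1 * (\sum_(0 <= k < 2 ^ n) ((1 - qpar ((u + k%:R) / 2 ^+ n.+1))^-1 +
       (1 - qpar ((u - k.+1%:R) / 2 ^+ n.+1))^-1)) -
  (2 ^+ n.+1)^-1 * (\sum_(0 <= k < 2 ^ n) ((1 - qpar ((v + k%:R) / 2 ^+ n.+1))^-1 +
       (1 - qpar ((v - k.+1%:R) / 2 ^+ n.+1))^-1)).
  rewrite -mulrBr -sumrB mulr_sumr; apply: eq_bigr => k _.
  by rewrite /G !mulrNz; ring.
by rewrite !part // !mulKf // pow2C_neq0.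
Qed.

End LipschitzFormula.

(** * Power series in [q] *)

Section PowerSeries.
Context {R : realType}.
Local Notation C := R[i].
Implicit Types (a : nat -> C) (x h : C).

Lemma ler_succX (x : R) j : 0 <= x ->
  (x + 1) ^+ j.+1 <= x ^+ j.+1 + j.+1%:R * (x + 1) ^+ j.
Proof.
move=> x0; elim: j => [|j IH]; first by rewrite !expr1 expr0 mulr1.
have x1 : 0 <= x + 1 by lra.
have p1 := exprn_ge0 j.+1 x1; have p2 := exprn_ge0 j x1.
rewrite (exprS (x + 1)) mulrDl mul1r (exprS x).
have : x * (x + 1) ^+ j.+1 <= x * (x ^+ j.+1 + j.+1%:R * (x + 1) ^+ j).
  exact: ler_wpM2l.
have : x * (x + 1) ^+ j <= (x + 1) ^+ j.+1 by rewrite exprS ler_wpM2r //; lra.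
rewrite -[j.+2%:R]natr1 mulrDr mulrDl mul1r mulrCA => h1 h2.
have : j.+1%:R * (x * (x + 1) ^+ j) <= j.+1%:R * (x + 1) ^+ j.+1 :> R.
  exact: ler_wpM2l.
lra.
Qed.

(** Induction on [j] by Abel summation: multiplying by 1 - r turns (d+1)^(j+1) into a difference of
    consecutive powers, which [ler_succX] bounds by (j+1) (d+1)^j. *)
Lemma bounded_polyexp (r : R) j : 0 <= r < 1 ->
  bounded_series (fun d : nat => d.+1%:R ^+ j * r ^+ d).
Proof.
move=> /andP[r0 r1]; elim: j => [|j [B hB]].
  exists (1 - r)^-1 => N; under eq_bigr do rewrite expr0 mul1r.
  have -> : \sum_(0 <= d < N) r ^+ d = (1 - r ^+ N) / (1 - r).
    rewrite big_mkord; have := subrX1 r N; rewrite -opprB => h.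
    have h1 : 1 - r != 0 by rewrite gt_eqF // subr_gt0.
    by apply: (mulIf h1); rewrite mulfVK // mulrC; apply: oppr_inj; rewrite h; ring.
  rewrite ler_pdivrMr ?subr_gt0 // mulVf; last by rewrite gt_eqF // subr_gt0.
  by have := exprn_ge0 N r0; lra.
exists ((1 - r)^-1 * (j.+1%:R * B)) => N.
have r1' : 0 < 1 - r by rewrite subr_gt0.
rewrite mulrC ler_pdivlMr //.
set S := \sum_(0 <= d < N) _.
have E : S * (1 - r) + N%:R ^+ j.+1 * r ^+ N =
    \sum_(0 <= d < N) (d.+1%:R ^+ j.+1 - d%:R ^+ j.+1) * r ^+ d.
  rewrite /S; elim: N {S} => [|N IH].
    by rewrite !big_geq // mul0r expr0n mul0r addr0.
  by rewrite !big_nat_recr //= -IH [r ^+ N.+1]exprS; ring.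
apply: (@le_trans _ _ (S * (1 - r) + N%:R ^+ j.+1 * r ^+ N)).
  by rewrite lerDl mulr_ge0 // exprn_ge0.
rewrite E; apply: (@le_trans _ _ (\sum_(0 <= d < N) j.+1%:R * (d.+1%:R ^+ j * r ^+ d))).
  apply: ler_sum => d _; rewrite mulrA ler_wpM2r ?exprn_ge0 //.
  have := @ler_succX d%:R j (ler0n _ _); rewrite natr1; lra.
by rewrite -mulr_sumr ler_wpM2l.
Qed.

Definition poly_bounded a := exists p (B : R), 0 <= B /\
  forall n, nc (a n) <= B * n.+1%:R ^+ p.

Definition psum a x := csum (fun n => a n * x ^+ n).

Lemma bounded_polyexpZ (B r : R) j : 0 <= B -> 0 <= r < 1 ->
  bounded_series (fun d : nat => B * d.+1%:R ^+ j * r ^+ d).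
Proof.
move=> B0 hr; apply: bounded_series_le (bounded_seriesZ B0 (bounded_polyexp j hr)).
by move=> k; rewrite mulrA.
Qed.

Lemma csummable_psum a x : poly_bounded a -> nc x < 1 ->
  csummable (fun n => a n * x ^+ n).
Proof.
move=> [p [B [B0 hB]]] hx.
apply: (csummable_le (b := fun n => B * n.+1%:R ^+ p * nc x ^+ n)).
  by move=> n; rewrite ncM ncX ler_wpM2r // exprn_ge0 // nc_ge0.
by apply: bounded_polyexpZ; rewrite ?nc_ge0.
Qed.

Lemma poly_bounded_deriv a : poly_bounded a ->
  poly_bounded (fun n => n.+1%:R * a n.+1).
Proof.
move=> [p [B [B0 hB]]]; exists p.+1, (B * 2 ^+ p); split.
  by rewrite mulr_ge0 // exprn_ge0.
move=> n; rewrite ncM nc_nat.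
apply: (@le_trans _ _ (n.+1%:R * (B * n.+2%:R ^+ p))).
  by rewrite ler_wpM2l.
have : n.+2%:R ^+ p <= (2 * n.+1%:R) ^+ p :> R.
  case: p {hB} => [|p]; first by rewrite !expr0.
  by rewrite ler_pXn2r ?nnegrE ?mulr_ge0 // -natrM ler_nat; lia.
rewrite exprMn exprS => h.
rewrite [leRHS](_ : _ = n.+1%:R * (B * (2 ^+ p * n.+1%:R ^+ p))); last by ring.
by do 2!apply: ler_wpM2l => //.
Qed.

(** The factor r^2 on the left stands for r^(n-2) on the right, without subtraction of exponents. *)
Lemma taylor2_bound (r : R) x h n : nc x <= r -> nc (x + h) <= r ->
  r ^+ 2 * nc ((x + h) ^+ n - x ^+ n - n%:R * x ^+ n.-1 * h) <=
  n%:R ^+ 2 * r ^+ n * nc h ^+ 2.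
Proof.
move=> hx hxh; have r0 : 0 <= r by apply: le_trans hx; exact: nc_ge0.
elim: n => [|n IH].
  by rewrite !expr0 subrr !mul0r subr0 nc0 mulr0 expr0n /= !mul0r.
set E := (x + h) ^+ n - _ - _ in IH.
have -> : (x + h) ^+ n.+1 - x ^+ n.+1 - n.+1%:R * x ^+ n.+1.-1 * h =
    (x + h) * E + n%:R * x ^+ n.-1 * h ^+ 2.
  rewrite /E; case: n {IH E} => [|n] /=; first by rewrite !expr1 !expr0; ring.
  by rewrite -[n.+2%:R]natr1 !exprS; ring.
have h1 : nc ((x + h) * E + n%:R * x ^+ n.-1 * h ^+ 2) <=
    r * nc E + n%:R * r ^+ n.-1 * nc h ^+ 2.
  apply: le_trans (ncD _ _) _.
  rewrite [nc (_ * E)]ncM [nc (_ * h ^+ 2)]ncM [nc (n%:R * _)]ncM !ncX nc_nat; apply: lerD.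
    by rewrite ler_wpM2r // nc_ge0.
  rewrite ler_wpM2r ?exprn_ge0 ?nc_ge0 // ler_wpM2l //.
  case: (n.-1) => [|m]; first by rewrite !expr0.
  by rewrite ler_pXn2r ?nnegrE ?nc_ge0.
apply: (@le_trans _ _ (r ^+ 2 * (r * nc E + n%:R * r ^+ n.-1 * nc h ^+ 2))).
  by rewrite ler_wpM2l // exprn_ge0.
rewrite mulrDr mulrCA.
apply: (@le_trans _ _ (r * (n%:R ^+ 2 * r ^+ n * nc h ^+ 2) + n%:R * r ^+ n.+1 * nc h ^+ 2)).
  apply: lerD; first by rewrite ler_wpM2l.
  case: n {IH E h1} => [|n] /=; first by rewrite !mul0r mulr0.
  by rewrite le_eqVlt; apply/orP; left; apply/eqP; rewrite !exprS; ring.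
have hh : 0 <= r ^+ n.+1 * nc h ^+ 2 by rewrite mulr_ge0 // exprn_ge0 // nc_ge0.
rewrite [leLHS](_ : _ = (n%:R ^+ 2 + n%:R) * (r ^+ n.+1 * nc h ^+ 2)); last first.
  by rewrite [r ^+ n.+1]exprS; ring.
rewrite -mulrA ler_wpM2r // -[n.+1%:R]natr1.
by have : 0 <= n%:R :> R by []; nra.
Qed.

(** The second-order remainders of the monomials are summed; the radius r halfway between |x| and 1
    leaves room for x + h and for the convergence of the sum of n^(p+2) r^n. *)
Lemma cderiv_psum a x : poly_bounded a -> nc x < 1 ->
  cderiv (psum a) x (psum (fun n => n.+1%:R * a n.+1) x).
Proof.
move=> pa hx; have x0 := nc_ge0 x.
pose r := (1 + nc x) / 2; have r0 : 0 < r by rewrite /r; lra.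
have r1 : r < 1 by rewrite /r; lra.
have rx : nc x < r by rewrite /r; lra.
have [p [B [B0 hB]]] := pa.
have rr : 0 <= r < 1 by rewrite r1 ltW.
have [M hM] := bounded_polyexpZ p.+2 B0 rr.
have M0 : 0 <= M by have := hM 0%N; rewrite big_geq.
have main h : nc (x + h) <= r ->
    nc (psum a (x + h) - psum a x - psum (fun n => n.+1%:R * a n.+1) x * h)
    <= M * r ^- 2 * nc h ^+ 2.
  move=> hh; have xh1 : nc (x + h) < 1 by apply: le_lt_trans hh r1.
  pose E n := (x + h) ^+ n - x ^+ n - n%:R * x ^+ n.-1 * h.
  have s1 := csummable_psum pa xh1; have s2 := csummable_psum pa hx.
  have s3 := csummable_psum (poly_bounded_deriv pa) hx.
  (* The derived series indexed like the original one; its term at 0 vanishes whatever [0.-1] is. *)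
  pose dd n := n%:R * a n * x ^+ n.-1.
  have s4 : csummable dd.
    have [M3 hM3] := s3; exists M3 => -[|N]; first by rewrite big_geq //; apply: le_trans (hM3 0%N); rewrite big_geq.
    rewrite big_nat_recl //= /dd !mul0r nc0 add0r.
    exact: hM3.
  have e4 : psum (fun n => n.+1%:R * a n.+1) x = csum dd.
    by rewrite (csum_shift s4) /dd !mul0r add0r.
  rewrite e4 /psum mulrC -csumZ //.
  have -> : csum (fun n => a n * (x + h) ^+ n) - csum (fun n => a n * x ^+ n)
     - csum (fun n => h * dd n) = csum (fun n => a n * E n).
    rewrite -mulN1r -csumZ // -[- csum _]mulN1r -csumZ; last exact: csummableZ.
    rewrite -csumD //; last exact: csummableZ.
    rewrite -csumD; last by do 2!apply: csummableZ.
      by apply: eq_csum => n; rewrite /E /dd; ring.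
    by apply: csummableD => //; exact: csummableZ.
  have hE n : nc (a n * E n) <= (r ^- 2 * nc h ^+ 2) * (B * n.+1%:R ^+ p.+2 * r ^+ n).
    rewrite ncM; have := taylor2_bound n (ltW rx) hh; rewrite -/(E n) => hn.
    apply: (@le_trans _ _ (B * n.+1%:R ^+ p * (r ^- 2 * (n%:R ^+ 2 * r ^+ n * nc h ^+ 2)))).
      apply: ler_pM; rewrite ?nc_ge0 //.
      by rewrite mulrC ler_pdivlMr ?exprn_gt0 // mulrC.
    have -> : B * n.+1%:R ^+ p * (r ^- 2 * (n%:R ^+ 2 * r ^+ n * nc h ^+ 2)) =
       (r ^- 2 * nc h ^+ 2) * (B * (n.+1%:R ^+ p * n%:R ^+ 2) * r ^+ n) by ring.
    apply: ler_wpM2l; first by rewrite mulr_ge0 ?invr_ge0 ?exprn_ge0 ?nc_ge0 // ltW.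
    rewrite ler_wpM2r ?exprn_ge0 ?(ltW r0) // ler_wpM2l //.
    rewrite -(addn2 p) exprD ler_wpM2l ?exprn_ge0 //.
    by rewrite ler_pXn2r ?nnegrE // ler_nat.
  have hN N : \sum_(0 <= n < N) nc (a n * E n) <= M * r ^- 2 * nc h ^+ 2.
    apply: (@le_trans _ _ ((r ^- 2 * nc h ^+ 2) * \sum_(0 <= n < N) (B * n.+1%:R ^+ p.+2 * r ^+ n))).
      by rewrite mulr_sumr; apply: ler_sum => n _; exact: hE.
    rewrite [leRHS](_ : _ = (r ^- 2 * nc h ^+ 2) * M); last by ring.
    rewrite ler_wpM2l // mulr_ge0 ?invr_ge0 ?exprn_ge0 ?nc_ge0 //.
    exact: ltW.
  by apply: nc_csum_le => //; eexists; exact: hN.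
apply/cderivP => e e0.
have A0 : 0 < M * r ^- 2 + 1.
  by rewrite ltr_wpDl // mulr_ge0 // invr_ge0 exprn_ge0 // ltW.
exists (Num.min (r - nc x) (e / (M * r ^- 2 + 1))).
  by rewrite lt_min subr_gt0 rx divr_gt0.
move=> h; rewrite lt_min => /andP[h1 h2].
apply: le_trans (main _ _) _; first by apply: le_trans (ncD _ _) _; lra.
rewrite expr2 mulrA; apply: ler_wpM2r; first exact: nc_ge0.
move: h2; rewrite ltr_pdivlMr //; have := nc_ge0 h; lra.
Qed.

Lemma psum0 a : psum a 0 = a 0%N.
Proof.
rewrite /psum (@csum_fin _ 1) ?big_nat1 ?expr0 ?mulr1 //.
by case=> // k _; rewrite expr0n mulr0.
Qed.

Lemma qpar_cusp : ccvg (@Im_pinfty R) (@qpar R) 0.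
Proof.
apply/cvg_cuspP => e e0; have p0 := pi_gt0 R.
exists (e^-1) => z hz; rewrite subr0 nc_qpar expRN.
have ei : 0 < e^-1 by rewrite invr_gt0.
have z0 : 0 < complex.Im z by lra.
have h : e^-1 < expR (2 * pi * complex.Im z).
  apply: lt_le_trans (expR_ge1Dx _).
  have : 1 * complex.Im z <= pi * complex.Im z.
    by rewrite ler_wpM2r ?ltW //; have := pi_ge2 R; lra.
  lra.
by rewrite invf_plt ?posrE ?expR_gt0.
Qed.

Lemma psum_cusp a : poly_bounded a ->
  ccvg (@Im_pinfty R) (fun z => psum a (qpar z)) (a 0%N).
Proof.
move=> pa; have x0 : nc (0 : C) < 1 by rewrite nc0.
have /cderiv_cvg/cvg_nbhsCP h := cderiv_psum pa x0.
apply/cvg_cuspP => e /h[d d0 hd].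
have /cvg_cuspP/(_ _ d0)[Y hY] := qpar_cusp.
by exists Y => z /hY hz; rewrite -(psum0 a); apply: hd.
Qed.

(* [divisors 0] is not empty, whence the case distinction. *)
Definition sigma_coef r n : C := if n == 0%N then 0 else (sigma r n)%:R.

Lemma sigma_le r n : (0 < n)%N -> (sigma r n <= n ^ r.+1)%N.
Proof.
rewrite /sigma => n0.
apply: (@leq_trans (\sum_(d <- divisors n) n ^ r)).
  rewrite !big_seq; apply: leq_sum => d; rewrite -dvdn_divisors // => dn.
  by case: r => // r; rewrite leq_exp2r // dvdn_leq.
rewrite big_const_seq count_predT iter_addn_0 expnSr leq_mul //.
apply: leq_trans (_ : size (iota 1 n) <= _)%N; last by rewrite size_iota.
apply: uniq_leq_size; first exact: divisors_uniq.
move=> d; rewrite -dvdn_divisors // mem_iota add1n ltnS => h.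
by rewrite (dvdn_gt0 n0 h) dvdn_leq.
Qed.

Lemma sigma_poly_bounded r : poly_bounded (sigma_coef r).
Proof.
exists r.+1, 1; split=> // n; rewrite /sigma_coef mul1r.
case: eqP => [->|/eqP]; first by rewrite nc0.
rewrite -lt0n => n0; rewrite nc_nat -natrX ler_nat.
by apply: leq_trans (sigma_le r n0) _; rewrite leq_exp2r.
Qed.

Lemma sigma_seriesE r z : @upper R z ->
  sigma_series r z = psum (sigma_coef r) (qpar z).
Proof.
move=> hz; have h := csummable_psum (sigma_poly_bounded r) (nc_qpar_lt1 hz).
by rewrite /psum (csum_shift h) /sigma_coef mul0r add0r.
Qed.

(** The n-th partial sum over the multiples of [m] is the partial sum of rank n / m of the given
    series. *)
Lemma csum_multiples (b : nat -> C) m l : (0 < m)%N ->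
  ccvg \oo (series (fun d => b d.+1)) l ->
  csum (fun n => if (m %| n.+1)%N then b (n.+1 %/ m)%N else 0) = l.
Proof.
move=> m0 /cvg_seqCP h; apply: csum_unique; apply/cvg_seqCP => e /h[N hN].
have E n : series (fun n => if (m %| n.+1)%N then b (n.+1 %/ m)%N else 0) n =
    series (fun d => b d.+1) (n %/ m)%N.
  rewrite /series /=; elim: n => [|n IH]; first by rewrite div0n !big_geq.
  rewrite big_nat_recr //= IH divnS //; case: ifP => hm; last by rewrite add0n addr0.
  by rewrite add1n big_nat_recr //= hm add1n.
by exists (N * m)%N => n hn; rewrite E; apply: hN; rewrite leq_divRL.
Qed.

Lemma sum_divisors (F : nat -> C) n :
  \sum_(d <- divisors n.+1) F d = \sum_(0 <= d < n.+1 | (d.+1 %| n.+1)%N) F d.+1.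
Proof.
rewrite -[RHS](big_map S (fun d => (d %| n.+1)%N) F) -[RHS]big_filter.
apply: perm_big; apply: uniq_perm.
- exact: divisors_uniq.
- by rewrite filter_uniq // map_inj_uniq ?iota_uniq // => i j [].
move=> d; rewrite -dvdn_divisors // mem_filter; apply/idP/andP => [h|[] //].
split=> //; apply/mapP; exists d.-1; last by rewrite prednK // (dvdn_gt0 _ h).
rewrite mem_index_iota /= prednK ?(dvdn_gt0 _ h) //; exact: dvdn_leq.
Qed.

(** After a first exchange the inner sum runs over the multiples of d + 1 and is spread over all n
    with zeros elsewhere; a second exchange collects the divisors of n + 1. *)
Lemma lambert j x : nc x < 1 ->
  csum (fun c => csum (fun d => d.+1%:R ^+ j * (x ^+ c.+1) ^+ d.+1)) =
  csum (fun k => (sigma j k.+1)%:R * x ^+ k.+1).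
Proof.
move=> hx; have x0 := nc_ge0 x; have rr : 0 <= nc x < 1 by rewrite x0.
have b0 := bounded_polyexp 0 rr; have bj := bounded_polyexp j rr.
have bj2 := bounded_polyexp j.+2 rr.
have pX (m n : nat) : (m <= n)%N -> nc x ^+ n <= nc x ^+ m.
  by move=> mn; apply: ler_wiXn2l => //; exact: ltW.
rewrite (@csum_exchange _ _ (fun c => c.+1%:R ^+ 0 * nc x ^+ c)
  (fun d => d.+1%:R ^+ j * nc x ^+ d)) //; first last.
- move=> c d; rewrite ncM ncX nc_nat !ncX expr0 mul1r mulrCA.
  rewrite ler_wpM2l ?exprn_ge0 // -exprM -exprD; apply: pX.
  by rewrite mulSn mulnS; lia.
- by move=> k; rewrite mulr_ge0 ?exprn_ge0.
- by move=> k; rewrite mulr_ge0 ?exprn_ge0.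
pose a d n : C := if (d.+1 %| n.+1)%N then d.+1%:R ^+ j * x ^+ n.+1 else 0.
transitivity (csum (fun d => csum (fun n => a d n))).
  apply: eq_csum => d; have xd : nc (x ^+ d.+1) < 1.
    by rewrite ncX exprn_ilt1.
  have s : csummable (fun c => d.+1%:R ^+ j * (x ^+ c.+1) ^+ d.+1).
    apply: csummableZ; apply: csummable_le b0 => c.
    by rewrite !ncX expr0 mul1r -exprM; apply: pX; nia.
  rewrite -(@csum_multiples (fun c => d.+1%:R ^+ j * (x ^+ c) ^+ d.+1) d.+1 _ isT (csum_cvg s)).
  apply: eq_csum => n; rewrite /a; case: ifP => // h.
  by rewrite -exprM divnK.
(* On the support d + 1 <= n + 1, so two more powers of n + 1 pay for the summable weight in d. *)
rewrite (@csum_exchange _ a (fun d => d.+1%:R ^- 2) (fun n => n.+1%:R ^+ j.+2 * nc x ^+ n)) //.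
- apply: eq_csum => n; rewrite (@csum_fin _ n.+1); last first.
    by move=> d hd; rewrite /a; case: ifP => // /dvdn_leq h; have := h isT; lia.
  rewrite /sigma natr_sum (sum_divisors (fun d => (d ^ j)%:R)) mulr_suml [RHS]big_mkcond /=.
  by apply: eq_bigr => d _; rewrite /a natrX; case: ifP.
- exact: bounded_invsq.
- by move=> k; rewrite mulr_ge0 ?exprn_ge0.
move=> d n; rewrite /a; case: ifP => [/dvdn_leq|_]; last first.
  rewrite nc0; apply: mulr_ge0; first by rewrite invr_ge0 exprn_ge0.
  by rewrite mulr_ge0 ?exprn_ge0.
move=> /(_ isT) dn; rewrite ncM !ncX nc_nat [leRHS]mulrC ler_pdivlMr ?exprn_gt0 // mulrAC -exprD.
rewrite addn2; apply: (@le_trans _ _ (n.+1%:R ^+ j.+2 * nc x ^+ n.+1)).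
  by rewrite ler_wpM2r ?exprn_ge0 // ler_pXn2r ?nnegrE // ler_nat.
by rewrite ler_wpM2l ?exprn_ge0 // pX.
Qed.

Definition powsum j x := csum (fun d => d%:R ^+ j * x ^+ d).

Lemma csummable_powsum j x : nc x < 1 -> csummable (fun d => d%:R ^+ j * x ^+ d).
Proof.
move=> hx; apply: csummable_psum => //; exists j, 1; split=> // n.
rewrite mul1r ncX nc_nat; case: j => // j.
by rewrite ler_pXn2r ?nnegrE // ler_nat.
Qed.

(** Shifting d by 1 and expanding (d + 1)^j gives a triangular linear system, which [powsum_values]
    solves up to j = 5. *)
Lemma powsum_rec j x : nc x < 1 ->
  powsum j x = (j == 0)%:R + x * \sum_(0 <= i < j.+1) 'C(j, i)%:R * powsum i x.
Proof.
move=> hx; have s i := csummable_powsum i hx.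
rewrite {1}/powsum (csum_shift (s j)) expr0 mulr1 expr0n; congr (_ + _).
transitivity (x * csum (fun d => \sum_(0 <= i < j.+1) 'C(j, i)%:R * (d%:R ^+ i * x ^+ d))).
  rewrite -csumZ; last by apply: csummable_sum => i; exact: csummableZ.
  apply: eq_csum => d; rewrite -natr1 [_ + 1]addrC exprDn exprS mulrCA mulr_suml; congr (_ * _).
  by rewrite big_mkord; apply: eq_bigr => i _; rewrite expr1n mul1r -mulr_natl mulrA.
rewrite csum_sum; last by move=> i; exact: csummableZ.
by congr (_ * _); apply: eq_bigr => i _; rewrite csumZ.
Qed.

Lemma powsum_shift j x : nc x < 1 ->
  csum (fun d => d.+1%:R ^+ j.+1 * x ^+ d.+1) = powsum j.+1 x.
Proof.
move=> hx; rewrite /powsum (csum_shift (csummable_powsum _ hx)).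
by rewrite expr0n mul0r add0r.
Qed.

Lemma powsum_values x : nc x < 1 ->
  [/\ powsum 1 x = eul2.[x] * (1 - x) ^- 2,
      powsum 3 x = eul4.[x] * (1 - x) ^- 4
    & powsum 5 x = eul6.[x] * (1 - x) ^- 6].
Proof.
move=> hx; have x1 : 1 - x != 0.
  by rewrite subr_eq0; apply: contraTneq hx => <-; rewrite nc1 ltxx.
have solve (a b : C) : a = x * (b + a) -> a = x * b / (1 - x).
  move=> h; apply: (mulIf x1); rewrite mulfVK // mulrBr mulr1 {1}h; ring.
have e0 : powsum 0 x = (1 - x)^-1.
  have := powsum_rec 0 hx; rewrite big_nat1 /= bin0 mul1r => h.
  by apply: (mulIf x1); rewrite mulVf // mulrBr mulr1 {1}h; ring.
have e1 : powsum 1 x = x / (1 - x) ^+ 2.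
  have := powsum_rec 1 hx; rewrite !big_nat_recr //= big_geq //= !add0r.
  rewrite bin0 binn !mul1r => /solve ->.
  by rewrite e0; field.
have e2 : powsum 2 x = (x + x ^+ 2) / (1 - x) ^+ 3.
  have := powsum_rec 2 hx; rewrite !big_nat_recr //= big_geq //= !add0r.
  rewrite bin0 binn !mul1r => /solve ->.
  by rewrite e0 e1 !bin1; field.
have e3 : powsum 3 x = (x + 4 * x ^+ 2 + x ^+ 3) / (1 - x) ^+ 4.
  have := powsum_rec 3 hx; rewrite !big_nat_recr //= big_geq //= !add0r.
  rewrite bin0 binn !mul1r => /solve ->.
  by rewrite e0 e1 e2 (_ : 'C(3, 1) = 3%N) // (_ : 'C(3, 2) = 3%N) //; field.
have e4 : powsum 4 x = (x + 11 * x ^+ 2 + 11 * x ^+ 3 + x ^+ 4) / (1 - x) ^+ 5.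
  have := powsum_rec 4 hx; rewrite !big_nat_recr //= big_geq //= !add0r.
  rewrite bin0 binn !mul1r => /solve ->.
  by rewrite e0 e1 e2 e3 (_ : 'C(4, 1) = 4%N) // (_ : 'C(4, 2) = 6%N) //
    (_ : 'C(4, 3) = 4%N) //; field.
split; first by rewrite e1 eul2E.
  by rewrite e3 eul4E.
have := powsum_rec 5 hx; rewrite !big_nat_recr //= big_geq //= !add0r.
rewrite bin0 binn !mul1r => /solve ->.
by rewrite e0 e1 e2 e3 e4 eul6E (_ : 'C(5, 1) = 5%N) // (_ : 'C(5, 2) = 10%N) //
  (_ : 'C(5, 3) = 10%N) // (_ : 'C(5, 4) = 5%N) //; field.
Qed.

End PowerSeries.

(** * Eisenstein series *)

Section Eisenstein.
Context {R : realType}.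
Local Notation C := R[i].
Local Notation Re := complex.Re.
Local Notation Im := complex.Im.
Local Notation tpi := (two_pi_i R).
Implicit Types (z : C).

Lemma nc_sumZ_le (f : int -> C) B : zdec f B -> nc (sumZ f) <= 4 * B.
Proof.
move=> h; have B0 := zdec_ge0 h; apply: nc_csum_le; first exact: csummableZ2 h.
move=> N; apply: (@le_trans _ _ (\sum_(0 <= k < N) 2 * B * k.+1%:R ^- 2)).
  apply: ler_sum => k _; apply: le_trans (ncD _ _) _.
  have := zdec_pos h k; have := zdec_neg h k.
  by move: (k.+1%:R ^- 2) => t; lra.
by rewrite -mulr_sumr; have := @sum_invsq_le R N; nra.
Qed.

Lemma zdec_sumZ (a : int -> int -> C) B :
  (forall c d, nc (a c d) <= B * zb c * zb d) -> zdec (fun c => sumZ (a c)) (4 * B).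
Proof. by move=> h c; have := nc_sumZ_le (h c); rewrite mulrA. Qed.

Lemma sumZ_bigsum K (f : nat -> int -> C) (B : nat -> R) : (forall k, zdec (f k) (B k)) ->
  zdec (fun c => \sum_(0 <= k < K) f k c) (\sum_(0 <= k < K) B k) /\
  \sum_(0 <= k < K) sumZ (f k) = sumZ (fun c => \sum_(0 <= k < K) f k c).
Proof.
move=> h; elim: K => [|K [IH1 IH2]].
  split=> [c|]; first by rewrite !big_geq // nc0 mul0r.
  rewrite big_geq // /sumZ -[LHS]csum0; apply: eq_csum => k.
  by rewrite !big_geq // addr0.
split=> [c|].
  by rewrite !big_nat_recr //= (zdecD IH1 (h K)).
rewrite big_nat_recr //= IH2 -(sumZD IH1 (h K)).
by apply: eq_sumZ => c; rewrite big_nat_recr.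
Qed.

Lemma upper_S z : @upper R z -> @upper R (- z^-1).
Proof.
case: z => x y; rewrite /upper /= => y0.
have n0 : 0 < x ^+ 2 + y ^+ 2 by rewrite ltr_wpDl ?sqr_ge0 // exprn_gt0.
by rewrite opprK mulrC mulr_gt0 // invr_gt0.
Qed.

Lemma upper_neq0 z : @upper R z -> z != 0.
Proof. by move=> h; apply: contraTneq h => ->; rewrite /upper /= ltxx. Qed.

Local Notation lat z c d := (c%:~R * z + d%:~R).

(** The imaginary part of c z + d bounds |c|, and then d = (c z + d) - c z bounds |d|. *)
Lemma lattice_bound z : @upper R z -> exists2 A : R, 0 <= A & forall c d,
  (nc (lat z c d))^-1 <= A / (1 + `|c%:~R|) /\ (nc (lat z c d))^-1 <= A / (1 + `|d%:~R|).
Proof.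
move=> hz; have y0 : 0 < Im z := hz.
set y := Im z in y0; have z0 := nc_ge0 z.
pose A := y^-1 + (1 + nc z / y).
have yi : 0 < y^-1 by rewrite invr_gt0.
have zy : 0 <= nc z / y by rewrite divr_ge0 // ltW.
have A0 : 0 < A by rewrite /A; lra.
exists (2 * A); first by lra.
move=> c d; set w := lat z c d.
have hc : 0 <= `|c%:~R| :> R by []; have hd : 0 <= `|d%:~R| :> R by [].
have [w0|w0] := eqVneq w 0.
  by rewrite w0 nc0 invr0 !divr_ge0 ?addr_ge0 //; lra.
have n0 : 0 < nc w by rewrite nc_gt0.
have e1 : `|c%:~R| * y <= nc w.
  apply: le_trans (Im_le_nc _); rewrite /w ImD ImM !Im_int Re_int mul0r !addr0.
  by rewrite normrM (gtr0_norm y0).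
have e2 : `|c%:~R| <= y^-1 * nc w by rewrite mulrC ler_pdivlMr.
have e3 : `|d%:~R| <= (1 + nc z / y) * nc w.
  have -> : `|d%:~R| = nc (w - c%:~R * z) by rewrite /w addrC addKr nc_int.
  apply: le_trans (ncB _ _) _; rewrite ncM nc_int.
  have : `|c%:~R| * nc z <= y^-1 * nc w * nc z by rewrite ler_wpM2r.
  lra.
have f1 : `|c%:~R| <= A * nc w by rewrite /A; nra.
have f2 : `|d%:~R| <= A * nc w by rewrite /A; nra.
(* Off the origin one of the integers c, d has absolute value at least 1. *)
have f3 : 1 <= A * nc w.
  have [c0|c0] := eqVneq c 0; last first.
    by apply: le_trans f1; exact: norm_int_ge1.
  have [d0|d0] := eqVneq d 0; first by move: w0; rewrite /w c0 d0 mul0r addr0 eqxx.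
  by apply: le_trans f2; exact: norm_int_ge1.
split; rewrite ler_pdivlMr ?ltr_wpDr // mulrC ler_pdivrMr //; lra.
Qed.

(** From exponent 4 on, two powers of the inverse pay for c and two for d; exponent 2 would not give
    a product bound. *)
Lemma lattice_zb z w : @upper R z -> exists B : R, forall c d,
  nc ((lat z c d) ^- (4 + w)) <= B * zb c * zb d.
Proof.
move=> /lattice_bound[A A0 h]; exists (A ^+ (4 + w)) => c d.
have [h1 h2] := h c d; rewrite ncV ncX -exprVn.
set v := (nc _)^-1 in h1 h2 *; have v0 : 0 <= v by rewrite invr_ge0 nc_ge0.
have c0 : 0 < 1 + `|c%:~R| :> R by rewrite ltr_wpDr.
have d0 : 0 < 1 + `|d%:~R| :> R by rewrite ltr_wpDr.
have h3 : v <= A.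
  apply: le_trans h1 _; rewrite ler_pdivrMr // ler_peMr // lerDl //.
have e1 : v ^+ 2 <= (A / (1 + `|c%:~R|)) ^+ 2 by rewrite ler_pXn2r ?nnegrE ?divr_ge0 // ltW.
have e2 : v ^+ 2 <= (A / (1 + `|d%:~R|)) ^+ 2 by rewrite ler_pXn2r ?nnegrE ?divr_ge0 // ltW.
have e3 : v ^+ w <= A ^+ w by case: w => // w; rewrite ler_pXn2r ?nnegrE.
have -> : A ^+ (4 + w) * zb c * zb d =
   (A / (1 + `|c%:~R|)) ^+ 2 * (A / (1 + `|d%:~R|)) ^+ 2 * A ^+ w.
  rewrite /zb !exprMn !exprVn exprD; ring.
rewrite exprD (_ : v ^+ 4 = v ^+ 2 * v ^+ 2); last by rewrite -exprD.
by do 2![apply: ler_pM; rewrite ?mulr_ge0 ?exprn_ge0 //].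
Qed.

(** One row of the lattice. [Gser] sums d first and c afterwards; in weight 2 this order matters. *)
Definition Grow w z c : C := sumZ (fun d => (lat z c d) ^- w).
Definition Gser w z : C := sumZ (Grow w z).

(** As z (c (-1/z) + d) = d z - c, the inversion exchanges rows and columns up to a reflection. *)
Lemma Gser_S w z : @upper R z -> z ^- (4 + w) * Gser (4 + w) (- z^-1) = Gser (4 + w) z.
Proof.
move=> hz; have z0 := upper_neq0 hz.
have [B hB] := lattice_zb w hz; have [B' hB'] := lattice_zb w (upper_S hz).
have hB2 d c : nc ((lat z c d) ^- (4 + w)) <= B * zb d * zb c by rewrite mulrAC.
have zc : zdec (fun d => sumZ (fun c => (lat z c d) ^- (4 + w))) (4 * B).
  exact: (@zdec_sumZ (fun d c => (lat z c d) ^- (4 + w))).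
rewrite /Gser -(sumZ_mull _ (zdec_sumZ hB')) /Grow.
rewrite (sumZ_exchange hB) -(sumZN zc); apply: eq_sumZ => c.
rewrite -(sumZ_mull _ (hB' c)); apply: eq_sumZ => d.
rewrite -invfM -exprMn; congr (_ ^- _).
by rewrite mulrNz; field.
Qed.

Section QExpansion.
Variables (w j : nat) (p : {poly C}) (K : C) (z : C) (B : R).
Hypothesis wev : ~~ odd w.
Hypothesis w2 : (2 <= w)%N.
Hypothesis hz : @upper R z.
Hypothesis rowE : forall u, @upper R u ->
  sumZ (fun k => (u + k%:~R) ^- w) = K * qfrac p w u.
Hypothesis powE : forall x : C, nc x < 1 -> powsum j.+1 x = p.[x] * (1 - x) ^- w.
Hypothesis rdec : zdec (Grow w z) B.

(** The row c = 0 is the zeta value, rows c and -c agree because [w] is even, and the row c > 0 is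
    the Lipschitz formula at c z. Decay of the rows is a hypothesis because weight 2 needs a
    different argument for it. *)
Lemma Gser_qexp :
  Gser w z = sumZ (fun k => (k%:~R : C) ^- w) + 2 * K * sigma_series j.+1 z.
Proof.
have upc (k : nat) : @upper R (k.+1%:R * z).
  rewrite /upper /= -(rmorph_nat (real_complex R)) ImM /= mul0r addr0.
  by rewrite mulr_gt0 ?ltr0n.
have rp (k : nat) : Grow w z k.+1%:Z =
    K * csum (fun d => d.+1%:R ^+ j.+1 * (qpar z ^+ k.+1) ^+ d.+1).
  rewrite /Grow -[k.+1%:Z%:~R]/(k.+1%:R) rowE //; congr (_ * _).
  have hx : nc (qpar z ^+ k.+1) < 1 by rewrite ncX exprn_ilt1 ?nc_ge0 ?nc_qpar_lt1.
  by rewrite powsum_shift // powE // /qfrac qpar_natM.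
have rn (k : nat) : Grow w z (- k.+1%:Z) = Grow w z k.+1%:Z.
  have [Ku sK] := upper_shift_bounded (upc k).
  rewrite /Grow -[RHS](sumZN (shift_bounded_zdec w2 sK)); apply: eq_sumZ => d.
  rewrite mulrNz mulNr -[k.+1%:Z%:~R]/(k.+1%:R) mulrNz.
  rewrite -[k.+1%:R * z - _]opprB exprNn -signr_odd (negbTE wev) mul1r.
  by congr (_ ^- _); rewrite addrC.
have r0 : Grow w z 0 = sumZ (fun k => (k%:~R : C) ^- w).
  by apply: eq_sumZ => d; rewrite mul0r add0r.
have e1 : csum (fun k : nat => Grow w z k%:Z) =
    sumZ (fun k => (k%:~R : C) ^- w) + csum (fun k : nat => Grow w z k.+1%:Z).
  by rewrite -r0; exact: (csum_shift (csummable_pos rdec)).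
have e2 : csum (fun k : nat => Grow w z (- k.+1%:Z)) = csum (fun k : nat => Grow w z k.+1%:Z).
  by apply: eq_csum => k; exact: rn.
have e3 : csum (fun k : nat => Grow w z k.+1%:Z) = K * sigma_series j.+1 z.
  rewrite -[sigma_series j.+1 z]/(csum (fun k => (sigma j.+1 k.+1)%:R * qpar z ^+ k.+1)).
  rewrite -(lambert j.+1 (nc_qpar_lt1 hz)).
  (* Summability of the Lambert series is read off from that of the rows by dividing by [K]. *)
  have [K0|K0] := eqVneq K 0.
    by rewrite K0 mul0r -[RHS]csum0; apply: eq_csum => k; rewrite rp K0 mul0r.
  rewrite -csumZ; first by apply: eq_csum => k; exact: rp.
  have -> : (fun c : nat => csum (fun d => d.+1%:R ^+ j.+1 * (qpar z ^+ c.+1) ^+ d.+1)) =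
      (fun k : nat => K^-1 * Grow w z k.+1%:Z).
    by apply/funext => k; rewrite rp mulKf.
  by apply: csummableZ; exact: csummable_shift (csummable_pos rdec).
apply: (etrans (sumZE rdec)).
apply: (etrans (congr2 +%R (etrans e1 (congr1 (+%R _) e3)) (etrans e2 e3))).
by rewrite -addrA -mulrA mulr_natl mulr2n.
Qed.

End QExpansion.

Lemma Gser4E z : @upper R z -> Gser 4 z = tpi ^+ 4 / 720 * (1 + 240 * sigma_series 3 z).
Proof.
move=> hz; have [B hB] := lattice_zb 0 hz.
rewrite (@Gser_qexp 4 2 eul4 (tpi ^+ 4 / 6) z (4 * B)) //; last exact: zdec_sumZ.
- by rewrite zeta4E; field.
- exact: lipschitz4.
by move=> x /powsum_values[].
Qed.

Lemma Gser6E z : @upper R z ->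
  Gser 6 z = - tpi ^+ 6 / (60 * 504) * (1 - 504 * sigma_series 5 z).
Proof.
move=> hz; have [B hB] := lattice_zb 2 hz.
rewrite (@Gser_qexp 6 4 eul6 (tpi ^+ 6 / 120) z (4 * B)) //; last exact: zdec_sumZ.
- by rewrite zeta6E; field.
- exact: lipschitz6.
by move=> x /powsum_values[].
Qed.

(* Subtracting the telescoping series [1 / (w^2 - 1/4)] makes the double series
   of weight 2 absolutely convergent; exchanging the summations then produces
   the anomalous term [tpi / z]. *)
Definition Gtel z c d : C := ((lat z c d) ^+ 2 - 4^-1)^-1.
Definition Gtels z c d : C := (lat z c d - 2^-1)^-1.

(** The half-integral shifts are halves of lattice points with odd second coordinate: they never
    vanish, and [lattice_bound] applies to them. *)
Lemma lat_half z c d : lat z c d - 2^-1 = 2^-1 * lat z (2 * c) (2 * d - 1).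
Proof. by rewrite intrB !intrM; field. Qed.

Lemma lat_halfD z c d : lat z c d + 2^-1 = 2^-1 * lat z (2 * c) (2 * d + 1).
Proof. by rewrite intrD !intrM; field. Qed.

Lemma lat_neq0 z c d : @upper R z -> (c != 0) || (d != 0) -> lat z c d != 0.
Proof.
move=> hz; have y0 : 0 < Im z := hz.
have [->|c0 _] := eqVneq c 0; first by rewrite /= mul0r add0r intr_eq0.
apply/eqP => /(congr1 (@complex.Im R)); rewrite ImD ImM !Im_int Re_int mul0r !addr0 => /eqP.
by rewrite mulf_eq0 (gt_eqF y0) orbF intr_eq0 (negbTE c0).
Qed.

Lemma lat_half_neq0 z c d : @upper R z ->
  lat z c d - 2^-1 != 0 /\ lat z c d + 2^-1 != 0.
Proof.
move=> hz; rewrite lat_half lat_halfD !mulf_neq0 ?invr_neq0 ?lat_neq0 //;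
  by apply/orP; right; lia.
Qed.

Lemma inv_sub (a b : C) : a != 0 -> b != 0 -> a^-1 - b^-1 = (b - a) * (a * b)^-1.
Proof. by move=> h1 h2; field; rewrite h1 h2. Qed.

Lemma inv_telescope (a : C) : a != 0 -> a + 1 != 0 ->
  (a * (a + 1))^-1 = a^-1 - (a + 1)^-1.
Proof. by move=> h1 h2; field; rewrite h1 h2. Qed.

Lemma GtelE z c d : @upper R z -> Gtel z c d = Gtels z c d - Gtels z c (d + 1).
Proof.
move=> hz; have [h1 h2] := lat_half_neq0 c d hz.
rewrite /Gtel /Gtels intrD.
have -> : lat z c d ^+ 2 - 4^-1 = (lat z c d - 2^-1) * (lat z c d + 2^-1) by field.
have -> : c%:~R * z + (d%:~R + 1%:~R) - 2^-1 = lat z c d + 2^-1 by field.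
have e : lat z c d + 2^-1 = lat z c d - 2^-1 + 1 by field.
by rewrite e in h2 *; exact: inv_telescope.
Qed.

Lemma int_half_bound d : 1 + `|d%:~R| <= 1 + `|(2 * d - 1)%:~R| :> R /\
  1 + `|d%:~R| <= 1 + `|(2 * d + 1)%:~R| :> R.
Proof. by split; rewrite lerD2l -!intr_norm ler_int; lia. Qed.

Lemma int_dbl_bound c : 1 + `|c%:~R| <= 1 + `|(2 * c)%:~R| :> R.
Proof. by rewrite lerD2l -!intr_norm ler_int; lia. Qed.

Lemma half_bound z : @upper R z -> exists2 A : R, 0 <= A & forall c d,
  [/\ (nc (lat z c d))^-1 <= A / (1 + `|c%:~R|),
      (nc (lat z c d))^-1 <= A / (1 + `|d%:~R|),
      nc (Gtels z c d) <= A / (1 + `|c%:~R|) & nc (Gtels z c d) <= A / (1 + `|d%:~R|)]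
  /\ nc (lat z c d + 2^-1)^-1 <= A / (1 + `|d%:~R|) /\
  nc (lat z c d + 2^-1)^-1 <= A / (1 + `|c%:~R|).
Proof.
move=> /lattice_bound[A A0 h]; exists (2 * A); first by lra.
have pos (k : int) : 0 < 1 + `|k%:~R| :> R by rewrite ltr_wpDr.
have mono (k l : int) (v : R) : v <= A / (1 + `|l%:~R|) -> 1 + `|k%:~R| <= 1 + `|l%:~R| :> R ->
    2 * v <= 2 * A / (1 + `|k%:~R|).
  move=> h1 h2; rewrite -mulrA ler_pM2l //; apply: le_trans h1 _.
  by rewrite ler_wpM2l // lef_pV2 ?posrE.
have mono1 (k : int) (v : R) : 0 <= v -> v <= A / (1 + `|k%:~R|) -> v <= 2 * A / (1 + `|k%:~R|).
  move=> v0 h1; rewrite -mulrA; lra.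
have n2 : nc (2^-1 : C) = 2^-1 by rewrite ncV nc_nat.
move=> c d; have [h1 h2] := h c d.
have [h3 h4] := h (2 * c) (2 * d - 1); have [h5 h6] := h (2 * c) (2 * d + 1).
have [b1 b2] := int_half_bound d; have b3 := int_dbl_bound c.
rewrite /Gtels lat_half lat_halfD !ncV !ncM !n2 !invfM !invrK.
by split; [split; [apply: mono1| apply: mono1|exact: mono h3 b3|exact: mono h4 b1]
  | split; [exact: mono h6 b2|exact: mono h5 b3]]; rewrite // ?invr_ge0 ?nc_ge0.
Qed.

Lemma Gtel_split z c d : Gtel z c d = Gtels z c d * (lat z c d + 2^-1)^-1.
Proof. by rewrite /Gtel /Gtels -invfM; congr (_^-1); field. Qed.

(** Each term alone is summable along rows and along columns only; their difference is of order
    |w|^-4 and admits a product bound. *)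
Lemma zdec_tel z : @upper R z -> exists A : R, 0 <= A /\
  [/\ forall c, zdec (fun d => (lat z c d) ^- 2) (A ^+ 2),
      forall d, zdec (fun c => (lat z c d) ^- 2) (A ^+ 2),
      forall c, zdec (Gtel z c) (A ^+ 2),
      forall d, zdec (fun c => Gtel z c d) (A ^+ 2)
    & forall c d, nc ((lat z c d) ^- 2 - Gtel z c d) <= (A ^+ 4 + 4) * zb c * zb d].
Proof.
move=> hz; have [A A0 h] := half_bound hz; exists A; split=> //.
have sq (v : R) k : 0 <= v -> v <= A / (1 + `|k%:~R|) -> v ^+ 2 <= A ^+ 2 * zb k.
  move=> v0 hv; rewrite /zb -expr_div_n ler_pXn2r ?nnegrE ?divr_ge0 ?addr_ge0 //.
have pr (v u : R) k : 0 <= v -> 0 <= u -> v <= A / (1 + `|k%:~R|) -> u <= A / (1 + `|k%:~R|) ->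
    v * u <= A ^+ 2 * zb k.
  move=> v0 u0 hv hu; rewrite /zb -expr_div_n expr2; exact: ler_pM.
split=> [c d|d c|c d|d c|c d]; have [[h1 h2 h3 h4] [h5 h6]] := h c d.
- by rewrite ncV ncX -exprVn sq // invr_ge0 nc_ge0.
- by rewrite ncV ncX -exprVn sq // invr_ge0 nc_ge0.
- by rewrite Gtel_split ncM pr ?nc_ge0.
- by rewrite Gtel_split ncM pr ?nc_ge0.
(* At the origin the inverse square is 0 and [Gtel] is -4, whence the summand 4 in the constant. *)
have [w0|w0] := eqVneq (lat z c d) 0.
  have c0 : c = 0 by apply: contra_eq w0 => c0; rewrite lat_neq0 // c0.
  have d0 : d = 0 by apply: contra_eq w0 => d0; rewrite lat_neq0 // d0 orbT.
  rewrite /Gtel w0 expr0n mulr0n invr0 !sub0r invrN invrK opprK nc_nat.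
  by rewrite c0 d0 /zb normr0 addr0 expr1n invr1 !mulr1 lerDr exprn_ge0.
have [n1 n2] := lat_half_neq0 c d hz.
have -> : (lat z c d) ^- 2 - Gtel z c d =
    - 4^-1 * ((lat z c d) ^- 2 * (Gtels z c d * (lat z c d + 2^-1)^-1)).
  rewrite Gtel_split /Gtels -!invfM.
  have w2 : lat z c d ^+ 2 != 0 by rewrite expf_neq0.
  rewrite (inv_sub w2 (mulf_neq0 n1 n2)) !invfM; congr (_ * _); by field.
rewrite !ncM ncN ncV nc_nat.
have p1 : nc (lat z c d ^- 2) <= (A / (1 + `|c%:~R|)) * (A / (1 + `|d%:~R|)).
  by rewrite ncV ncX -exprVn expr2; apply: ler_pM; rewrite ?invr_ge0 ?nc_ge0.
have p2 : nc (Gtels z c d) * nc (lat z c d + 2^-1)^-1 <=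
    (A / (1 + `|c%:~R|)) * (A / (1 + `|d%:~R|)).
  by apply: ler_pM; rewrite ?nc_ge0.
have q0 : 0 <= (A / (1 + `|c%:~R|)) * (A / (1 + `|d%:~R|)).
  by rewrite mulr_ge0 // divr_ge0 // addr_ge0.
set P := (A / (1 + `|c%:~R|)) * _ in p1 p2 q0.
have PE : P * P = A ^+ 4 * zb c * zb d.
  by rewrite /P /zb -!exprVn; ring.
have pp : nc (lat z c d ^- 2) * (nc (Gtels z c d) * nc (lat z c d + 2^-1)^-1) <= P * P.
  by apply: ler_pM; rewrite ?mulr_ge0 ?nc_ge0.
rewrite -mulrA mulrDl [A ^+ 4 * _]mulrA -PE.
have := mulr_ge0 (ltW (@zb_gt0 R c)) (ltW (@zb_gt0 R d)).
have : 0 <= P * P by rewrite mulr_ge0.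
lra.
Qed.

Lemma telescope_partial z c K : @upper R z ->
  \sum_(0 <= k < K) (Gtel z c k%:Z + Gtel z c (- k.+1%:Z)) = Gtels z c (- K%:Z) - Gtels z c K%:Z.
Proof.
move=> hz; elim: K => [|K IH]; first by rewrite big_geq // oppr0 subrr.
rewrite big_nat_recr //= IH !GtelE //.
have -> : - K.+1%:Z + 1 = - K%:Z by lia.
have -> : K%:Z + 1 = K.+1%:Z by lia.
ring.
Qed.

Lemma inv_nat_cvg0 (A : R) (u : nat -> C) : (forall k : nat, nc (u k) <= A / k.+1%:R) ->
  ccvg \oo u 0.
Proof.
move=> h; apply/cvg_seqCP => e e0; have [N hN] : exists N : nat, A / e < N%:R.
  have [s|s] := leP 0 (A / e); last by exists 0%N.
  by exists (Num.bound (A / e)); exact: archi_boundP.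
exists N => n hn; rewrite subr0; apply: le_lt_trans (h _) _.
rewrite ltr_pdivrMr // mulrC -ltr_pdivrMr //; apply: lt_le_trans hN _.
by rewrite ler_nat; exact: leqW.
Qed.

(** So subtracting [Gtel] changes no row sum; only the sums in the other order feel it. *)
Lemma sumZ_Gtel z c : @upper R z -> sumZ (Gtel z c) = 0.
Proof.
move=> hz; have [A A0 h] := half_bound hz.
apply: csum_unique; rewrite /series /= (_ : (fun n => _) = (fun n : nat =>
   Gtels z c (- n%:Z) - Gtels z c n%:Z)); last first.
  by apply/funext => n; exact: telescope_partial.
rewrite -(subr0 0); apply: ccvgB; apply: (@inv_nat_cvg0 A) => k.
  have [[_ _ _]] := h c (- k%:Z); by rewrite mulrNz normrN ger0_norm // addrC natr1.
have [[_ _ _]] := h c k%:Z; by rewrite ger0_norm // addrC natr1.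
Qed.

Lemma zdec_Grow2 z : @upper R z -> exists B, zdec (Grow 2 z) B.
Proof.
move=> hz; have [A [A0 [h1 h2 h3 h4 h5]]] := zdec_tel hz.
exists (4 * (A ^+ 4 + 4)).
have -> : Grow 2 z = (fun c => sumZ (fun d => (lat z c d) ^- 2 - Gtel z c d)).
  apply/funext => c; rewrite /Grow; have h3' := zdecZ (-1) (h3 c).
  have := sumZD (h1 c) h3'; rewrite (sumZ_mull _ (h3 c)) sumZ_Gtel // mulr0 addr0 => <-.
  by apply: eq_sumZ => d; rewrite mulN1r.
exact: zdec_sumZ.
Qed.

Lemma Gser2E z : @upper R z -> Gser 2 z = - tpi ^+ 2 / 12 * (1 - 24 * sigma_series 1 z).
Proof.
move=> hz; have [B hB] := zdec_Grow2 hz.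
rewrite (@Gser_qexp 2 0 eul2 (tpi ^+ 2) z B) //.
- by rewrite zeta2E; field.
- exact: lipschitz2.
by move=> x /powsum_values[].
Qed.

Lemma qpar_tendsto0 (u : nat -> C) (y : R) : 0 < y ->
  (forall k : nat, k%:R * y <= Im (u k)) -> ccvg \oo (fun k => qpar (u k)) 0.
Proof.
move=> y0 h; apply/cvg_seqCP => e /(proj1 (cvg_cuspP _ _) qpar_cusp)[Y hY].
have [N hN] : exists N : nat, Y / y < N%:R.
  have [s|s] := leP 0 (Y / y); last by exists 0%N.
  by exists (Num.bound (Y / y)); exact: archi_boundP.
exists N => n hn; apply: hY; apply: lt_le_trans (h n).
rewrite -ltr_pdivrMr //; apply: lt_le_trans hN _; by rewrite ler_nat.
Qed.

(** After the exchange the correction survives in the column sums [tau]. Their partial sums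
    telescope in d, are evaluated by [lipschitz1] in c, and tend to -tpi / z. *)
Lemma Gser2_S z : @upper R z -> Gser 2 z = z ^- 2 * Gser 2 (- z^-1) + tpi / z.
Proof.
move=> hz; have z0 := upper_neq0 hz; have hS := upper_S hz.
have [A [A0 [h1 h2 h3 h4 h5]]] := zdec_tel hz.
have [B hB] := zdec_Grow2 hS.
have [A' [_ [h1' _ _ _ _]]] := zdec_tel hS.
pose col d := sumZ (fun c => (lat z c d) ^- 2).
have colE d : col d = z ^- 2 * Grow 2 (- z^-1) (- d).
  rewrite /Grow -(sumZ_mull _ (h1' _)); apply: eq_sumZ => c.
  by rewrite -invfM -exprMn; congr (_ ^- _); rewrite mulrNz; field.
have zcol : zdec col (nc (z ^- 2) * B).
  by move=> d; rewrite colE -(zbN d) (zdecZ (z ^- 2) hB).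
have GE : Gser 2 z = sumZ (fun c => sumZ (fun d => (lat z c d) ^- 2 - Gtel z c d)).
  apply: eq_sumZ => c; rewrite /Grow; have h3' := zdecZ (-1) (h3 c).
  have := sumZD (h1 c) h3'; rewrite (sumZ_mull _ (h3 c)) sumZ_Gtel // mulr0 addr0 => <-.
  by apply: eq_sumZ => d; rewrite mulN1r.
have SE : z ^- 2 * Gser 2 (- z^-1) = sumZ col.
  rewrite /Gser -(sumZ_mull _ hB) -(sumZN zcol); apply: eq_sumZ => d.
  by rewrite colE opprK.
rewrite GE (sumZ_exchange h5) SE.
have inner d : sumZ (fun c => (lat z c d) ^- 2 - Gtel z c d) =
    col d - sumZ (fun c => Gtel z c d).
  have h4' := zdecZ (-1) (h4 d).
  have := sumZD (h2 d) h4'; rewrite (sumZ_mull _ (h4 d)) mulN1r => <-.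
  by apply: eq_sumZ => c; rewrite mulN1r.
rewrite (eq_sumZ inner); apply: csum_unique.
pose tau d := sumZ (fun c => Gtel z c d).
rewrite /series /= (_ : (fun n => _) = (fun n : nat =>
   series (fun k : nat => col k%:Z + col (- k.+1%:Z)) n -
   \sum_(0 <= k < n) (tau k%:Z + tau (- k.+1%:Z)))); last first.
  by apply/funext => n; rewrite /series /= -sumrB; apply: eq_bigr => k _; rewrite /tau; ring.
rewrite -[tpi / z]opprK; apply: ccvgB; first by apply: csum_cvg; exact: csummableZ2 zcol.
pose y := Im (- z^-1); have y0 : 0 < y := hS.
(* Dividing by z turns the end terms c z - n - 1/2 and c z + n - 1/2 of the telescoping sum into c +
   u n and c - v n. *)
pose u (n : nat) : C := (n%:R + 2^-1) * (- z^-1).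
pose v (n : nat) : C := (n%:R - 2^-1) * (- z^-1).
have ImU (n : nat) : Im (u n) = (n%:R + 2^-1) * y.
  rewrite /u (_ : n%:R + 2^-1 = (n%:R + 2^-1 : R)%:C); last first.
    by rewrite rmorphD fmorphV /= !rmorph_nat.
  by rewrite ImM /= mul0r addr0.
have ImV (n : nat) : Im (v n) = (n%:R - 2^-1) * y.
  rewrite /v (_ : n%:R - 2^-1 = (n%:R - 2^-1 : R)%:C); last first.
    by rewrite rmorphB fmorphV /= !rmorph_nat.
  by rewrite ImM /= mul0r addr0.
have half0 (n : nat) : n%:R - 2^-1 != 0 :> R.
  rewrite subr_eq0; apply/eqP => /(congr1 (fun x : R => x * 2)).
  by rewrite mulVf // -natrM => /eqP; rewrite -[1]/(1%:R) eqr_nat => /eqP; lia.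
have tauE (n : nat) : \sum_(0 <= k < n) (tau k%:Z + tau (- k.+1%:Z)) =
    z^-1 * (- tpi * ((1 - qpar (u n))^-1 - (1 - qpar (- v n))^-1)).
  have t1 (k : nat) : tau k%:Z + tau (- k.+1%:Z) =
      sumZ (fun c => Gtel z c k%:Z + Gtel z c (- k.+1%:Z)).
    by rewrite (sumZD (h4 _) (h4 _)).
  under eq_bigr do rewrite t1.
  have [_ ->] := sumZ_bigsum n (fun k : nat => zdecD (h4 k%:Z) (h4 (- k.+1%:Z))).
  have hu : Im (u n) != 0.
    by rewrite ImU mulf_neq0 // ?gt_eqF // ltr_wpDl // invr_gt0.
  have hv : Im (- v n) != 0 by rewrite ImN oppr_eq0 ImV mulf_neq0 // gt_eqF.
  rewrite -(lipschitz1 hu hv).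
  have E c : \sum_(0 <= k < n) (Gtel z c k%:Z + Gtel z c (- k.+1%:Z)) =
      z^-1 * ((u n + c%:~R)^-1 - (- v n + c%:~R)^-1).
    rewrite telescope_partial // mulrBr -!invfM /Gtels /u /v mulrNz.
    by congr (_^-1 - _^-1); rewrite -[n%:Z%:~R]/(n%:R); field.
  rewrite (eq_sumZ E).
  have [Ku [Ku0 bu]] := shift_boundedP hu; have [Kv [Kv0 bv]] := shift_boundedP hv.
  apply: (@sumZ_mull _ _ _ (nc (- v n - u n) * Ku * Kv)) => k.
  have nz (x : C) : Im x != 0 -> x + k%:~R != 0.
    by move=> hx; apply: contraNneq hx => /(congr1 (@complex.Im R)); rewrite ImD Im_int addr0 => ->.
  have -> : (u n + k%:~R)^-1 - (- v n + k%:~R)^-1 =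
      (- v n - u n) * (u n + k%:~R)^-1 * (- v n + k%:~R)^-1.
    by field; rewrite !nz.
  rewrite !ncM !(ncV (_ + _)).
  apply: le_trans (_ : nc (- v n - u n) * (Ku / (1 + `|k%:~R|)) * (Kv / (1 + `|k%:~R|)) <= _).
    by apply: ler_pM; rewrite ?mulr_ge0 ?invr_ge0 ?nc_ge0 // ler_wpM2l ?nc_ge0.
  rewrite le_eqVlt; apply/orP; left; apply/eqP; rewrite /zb.
  have k0 : 1 + `|k%:~R| != 0 :> R by rewrite gt_eqF // ltr_wpDr.
  by field; rewrite k0.
(* The value at - v n is rewritten through q (v n), which tends to 0, whereas q (- v n) is
   unbounded. *)
rewrite (_ : (fun n => _) = (fun n =>
   z^-1 * (- tpi * ((1 - qpar (u n))^-1 - qpar (v n) * (qpar (v n) - 1)^-1)))); last first.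
  apply/funext => n; rewrite tauE qparN; congr (_ * (_ * (_ - _))).
  have q0 := qpar_neq0 (v n).
  have q1 : qpar (v n) - 1 != 0.
    by rewrite subr_eq0 qpar_neq1 // ImV mulf_neq0 // gt_eqF.
  by field; rewrite q0 q1.
have -> : - (tpi / z) = z^-1 * (- tpi * ((1 - 0)^-1 - 0 * (0 - 1)^-1)).
  by rewrite mul0r !subr0 invr1; ring.
have qu0 : ccvg \oo (fun n => qpar (u n)) 0.
  apply: (qpar_tendsto0 y0) => k; rewrite ImU ler_pM2r //; lra.
have qv0 : ccvg \oo (fun n => qpar (v n)) 0.
  have y2 : 0 < y / 2 by lra.
  (* The point v 0 lies in the lower half-plane and is replaced, so that the linear lower bound on
     the imaginary parts holds from n = 0. *)
  apply: near_ccvg (_ : ccvg \oo (fun n => qpar (if n is 0 then u 0%N else v n)) 0).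
    by exists 1%N => // -[].
  apply: (qpar_tendsto0 y2) => -[|k]; first by rewrite mul0r ImU add0r mulr_ge0 ?invr_ge0 // ltW.
  rewrite ImV mulrA mulrAC ler_pM2r // -natr1; have : 0 <= k%:R :> R by [].
  lra.
have o0 : (1 - 0 : C) != 0 by rewrite subr0 oner_eq0.
have o1 : (0 - 1 : C) != 0 by rewrite sub0r oppr_eq0 oner_eq0.
apply: ccvgM; first exact: ccvg_cst.
apply: ccvgM; first exact: ccvg_cst.
apply: ccvgB.
  by apply: ccvgV; [exact: o0|apply: ccvgB; [exact: ccvg_cst|exact: qu0]].
apply: ccvgM; first exact: qv0.
by apply: ccvgV; [exact: o1|apply: ccvgB; [exact: qv0|exact: ccvg_cst]].
Qed.

End Eisenstein.

(** * Transformation laws *)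

Section ModularLaws.
Context {R : realType}.
Local Notation C := R[i].
Local Notation Re := complex.Re.
Local Notation Im := complex.Im.
Local Notation tpi := (two_pi_i R).
Local Notation g1 := (@g1 R).
Local Notation g2 := (@g2 R).
Local Notation g3 := (@g3 R).
Local Notation cusp := (@Im_pinfty R).
Implicit Types (z : C).

Lemma upper_near z x : @upper R z -> nc (x - z) < Im z -> @upper R x.
Proof.
move=> hz h; have h1 := ler_norm (- Im (x - z)); rewrite normrN ImD ImN in h1.
have := le_lt_trans (Im_le_nc (x - z)) h; rewrite ImD ImN /upper /=; lra.
Qed.

Lemma near_upper_cderiv f g z a : @upper R z -> (forall x, @upper R x -> f x = g x) ->
  cderiv f z a -> cderiv g z a.
Proof.
move=> hz fg; apply: (@near_cderiv _ f g z a (Im z)) => // x hx.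
by apply: fg; exact: upper_near hz hx.
Qed.

Lemma near_upper_cusp (f g : C -> C) l : (forall x, @upper R x -> f x = g x) ->
  ccvg cusp f l -> ccvg cusp g l.
Proof. by move=> fg; apply: near_ccvg; exists 0 => z hz; exact: fg. Qed.

Lemma g1_Gser z : @upper R z -> g1 z = - Gser 2 z / tpi.
Proof. by move=> hz; rewrite Gser2E // /Defs.g1; have t0 := @two_pi_i_neq0 R; field. Qed.

Lemma g2_Gser z : @upper R z -> g2 z = 60 * Gser 4 z / tpi ^+ 2.
Proof. by move=> hz; rewrite Gser4E // /Defs.g2; have t0 := @two_pi_i_neq0 R; field. Qed.

Lemma g3_Gser z : @upper R z -> g3 z = - 140 * Gser 6 z / tpi ^+ 3.
Proof. by move=> hz; rewrite Gser6E // /Defs.g3; have t0 := @two_pi_i_neq0 R; field. Qed.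

Lemma g1_S z : @upper R z -> g1 (- z^-1) = z ^+ 2 * g1 z + z.
Proof.
move=> hz; have z0 := upper_neq0 hz; have t0 := @two_pi_i_neq0 R.
rewrite (g1_Gser hz) (g1_Gser (upper_S hz)) (Gser2_S hz).
by field; rewrite z0 t0.
Qed.

Lemma g2_S z : @upper R z -> g2 (- z^-1) = z ^+ 4 * g2 z.
Proof.
move=> hz; have z0 := upper_neq0 hz; have t0 := @two_pi_i_neq0 R.
have E : z ^- 4 * Gser 4 (- z^-1) = Gser 4 z := Gser_S 0 hz.
rewrite (g2_Gser hz) (g2_Gser (upper_S hz)) -E.
by field; rewrite z0 t0.
Qed.

Lemma g3_S z : @upper R z -> g3 (- z^-1) = z ^+ 6 * g3 z.
Proof.
move=> hz; have z0 := upper_neq0 hz; have t0 := @two_pi_i_neq0 R.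
have E : z ^- 6 * Gser 6 (- z^-1) = Gser 6 z := Gser_S 2 hz.
rewrite (g3_Gser hz) (g3_Gser (upper_S hz)) -E.
by field; rewrite z0 t0.
Qed.

Lemma sigma_series_per r z (n : int) : sigma_series r (z + n%:~R) = sigma_series r z.
Proof. by rewrite /sigma_series qparD_int. Qed.

Lemma g1_T z (n : int) : g1 (z + n%:~R) = g1 z.
Proof. by rewrite /Defs.g1 sigma_series_per. Qed.

Lemma g2_T z (n : int) : g2 (z + n%:~R) = g2 z.
Proof. by rewrite /Defs.g2 sigma_series_per. Qed.

Lemma g3_T z (n : int) : g3 (z + n%:~R) = g3 z.
Proof. by rewrite /Defs.g3 sigma_series_per. Qed.

Lemma cderiv_psum_qpar (a : nat -> C) z : poly_bounded a -> @upper R z ->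
  cderiv (fun x => psum a (qpar x)) z
   (psum (fun n => n.+1%:R * a n.+1) (qpar z) * (tpi * qpar z)).
Proof.
move=> pa hz; apply: (@cderiv_comp _ (@qpar R) (psum a)); first exact: cderiv_qpar.
by apply: cderiv_psum => //; exact: nc_qpar_lt1.
Qed.

Lemma sigma_series_hol r z : @upper R z -> exists d, cderiv (@sigma_series R r) z d.
Proof.
move=> hz; eexists.
apply: (near_upper_cderiv hz _ (cderiv_psum_qpar (sigma_poly_bounded r) hz)).
by move=> x hx; rewrite sigma_seriesE.
Qed.

Lemma affine_hol (a b c : C) f z : (exists d, cderiv f z d) ->
  exists d, cderiv (fun x => a * (b + c * f x)) z d.
Proof.
move=> [d h]; eexists; apply: cderivZ; apply: cderivD; first exact: cderiv_cst.
exact: cderivZ h.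
Qed.

Lemma g1_hol : holomorphic g1.
Proof.
apply/holomorphicP => z /(sigma_series_hol 1) /(affine_hol (tpi / 12) 1 (- 24)) [d h].
exists d; apply: near_cderiv ltr01 _ h => x _; rewrite /Defs.g1; ring.
Qed.

Lemma g2_hol : holomorphic g2.
Proof.
apply/holomorphicP => z /(sigma_series_hol 3) /(affine_hol _ 1 240) h; exact: h.
Qed.

Lemma g3_hol : holomorphic g3.
Proof.
apply/holomorphicP => z /(sigma_series_hol 5) /(affine_hol (8 * (tpi / 12) ^+ 3) 1 (- 504)) [d h].
exists d; apply: near_cderiv ltr01 _ h => x _; rewrite /Defs.g3; ring.
Qed.

Lemma sigma_series_cusp r : ccvg cusp (@sigma_series R r) 0.
Proof.
apply: (near_upper_cusp _ (psum_cusp (sigma_poly_bounded r))) => x hx.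
by rewrite sigma_seriesE.
Qed.

Lemma affine_cusp (a b c : C) f : ccvg cusp f 0 ->
  ccvg cusp (fun x => a * (b + c * f x)) (a * b).
Proof.
move=> h; rewrite -[b in a * b]addr0 -[X in b + X](mulr0 c).
apply: ccvgM; first exact: ccvg_cst.
apply: ccvgD; first exact: ccvg_cst.
by apply: ccvgM => //; exact: ccvg_cst.
Qed.

Lemma g1_cusp : ccvg cusp g1 (tpi / 12).
Proof.
have := affine_cusp (tpi / 12) 1 (- 24) (sigma_series_cusp 1); rewrite mulr1.
by apply: near_upper_cusp => x _; rewrite /Defs.g1; ring.
Qed.

Lemma g2_cusp : ccvg cusp g2 (12 * (tpi / 12) ^+ 2).
Proof.
by have := affine_cusp (12 * (tpi / 12) ^+ 2) 1 240 (sigma_series_cusp 3); rewrite mulr1.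
Qed.

Lemma g3_cusp : ccvg cusp g3 (8 * (tpi / 12) ^+ 3).
Proof.
have := affine_cusp (8 * (tpi / 12) ^+ 3) 1 (- 504) (sigma_series_cusp 5); rewrite mulr1.
by apply: near_upper_cusp => x _; rewrite /Defs.g3; ring.
Qed.

(** The mean value theorem is applied to the real and imaginary parts of [f] along the segment from
    [z] to [w]. *)
Lemma cderiv0_const f z w : (forall x, @upper R x -> cderiv f x 0) ->
  @upper R z -> @upper R w -> f z = f w.
Proof.
move=> hf hz hw; pose u (t : R) := z + t%:C * (w - z).
have hu (t : R) : 0 <= t <= 1 -> @upper R (u t).
  move=> /andP[t0 t1]; rewrite /upper /u /= ImD ImM /= mul0r addr0 ImD ImN.
  have h1 : 0 < Im z := hz; have h2 : 0 < Im w := hw.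
  have [->|t0'] := eqVneq t 0; first by rewrite mul0r addr0.
  have tp : 0 < t by rewrite lt_def t0' t0.
  have -> : Im z + t * (Im w - Im z) = (1 - t) * Im z + t * Im w by ring.
  by apply: ltr_wpDl; [rewrite mulr_ge0 ?subr_ge0 // ltW|exact: mulr_gt0].
have key (p : C -> R) : (forall x y, p (x - y) = p x - p y) -> (forall x, `|p x| <= nc x) ->
    p (f (u 1)) = p (f (u 0)).
  move=> pB pn.
  have dr (t : R) : 0 <= t <= 1 -> is_derive t 1 (fun s => p (f (u s))) 0.
    move=> ht; apply/rderivP => e e0; have W : 0 < 1 + nc (w - z) by rewrite ltr_wpDr ?nc_ge0.
    have /cderivP/(_ (e / (1 + nc (w - z)))) := hf _ (hu _ ht).
    case; first exact: divr_gt0.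
    move=> r r0 hr; exists (r / (1 + nc (w - z))); first exact: divr_gt0.
    move=> h hh; have nh : nc (h%:C * (w - z)) <= `|h| * (1 + nc (w - z)).
      by rewrite ncM nc_real ler_wpM2l // lerDr.
    have := hr (h%:C * (w - z)); rewrite !mul0r !subr0.
    have -> : u t + h%:C * (w - z) = u (t + h) by rewrite /u rmorphD; ring.
    move=> H; rewrite -pB; apply: le_trans (pn _) _; apply: le_trans (H _) _.
      by apply: le_lt_trans nh _; rewrite -ltr_pdivlMr.
    rewrite mulrAC ler_pdivrMr // -mulrA; apply: ler_wpM2l; first exact: ltW.
    exact: nh.
  have [||c _] := @MVT R (fun s => p (f (u s))) (fun=> 0) 0 1 ltr01.
  - by move=> x; rewrite in_itv /= => /andP[x0 x1]; apply: dr; rewrite !ltW.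
  - apply: derivable_within_continuous => x; rewrite in_itv /= => hx.
    by case: (dr x hx).
  by rewrite mul0r => /eqP; rewrite subr_eq0 => /eqP.
have u0 : u 0 = z by rewrite /u mul0r addr0.
have u1 : u 1 = w by rewrite /u mul1r addrC subrK.
rewrite -u0 -u1; apply: complex_eq; symmetry; apply: key.
- by move=> x y; rewrite ReD ReN.
- exact: Re_le_nc.
- by move=> x y; rewrite ImD ImN.
- exact: Im_le_nc.
Qed.

(* The discriminant [q * prod (1 - q^n)^24], written as an exponential so that
   its nonvanishing and its logarithmic derivative [12 g1] are immediate. *)
Definition Delta z : C :=
  qpar z * cexp (- 24 * psum (fun n => sigma_coef 1 n / n%:R) (qpar z)).

Lemma log_coef_bounded : poly_bounded (fun n => @sigma_coef R 1 n / n%:R).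
Proof.
have [p [B [B0 h]]] := @sigma_poly_bounded R 1; exists p, B; split=> // n.
rewrite ncM ncV nc_nat; apply: le_trans (h n); rewrite -[leRHS]mulr1.
apply: ler_wpM2l; first exact: nc_ge0.
by case: n => [|n]; rewrite ?invr0 // invf_le1 ?ltr0n // ler1n.
Qed.

Lemma Delta_neq0 z : Delta z != 0.
Proof. by apply: mulf_neq0; [exact: qpar_neq0|exact: cexp_neq0]. Qed.

Lemma cderiv_Delta z : @upper R z -> cderiv Delta z (12 * g1 z * Delta z).
Proof.
move=> hz; set a := fun n => @sigma_coef R 1 n / n%:R.
have h1 := cderivZ (- 24) (cderiv_psum_qpar log_coef_bounded hz).
have h2 := cderiv_comp h1 (cderiv_cexp _).
have h3 := cderivM (cderiv_qpar z) h2.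
have E : psum (fun n => n.+1%:R * (sigma_coef 1 n.+1 / n.+1%:R)) (qpar z) * qpar z =
    sigma_series 1 z.
  rewrite sigma_seriesE // {2}/psum.
  rewrite (csum_shift (csummable_psum (sigma_poly_bounded 1) (nc_qpar_lt1 hz))).
  rewrite {2}/sigma_coef /= mul0r add0r mulrC -csumZ; last first.
    by apply: csummable_psum (nc_qpar_lt1 hz); exact: (poly_bounded_deriv log_coef_bounded).
  apply: eq_csum => n; rewrite exprS; field.
  by rewrite addrC natr1 pnatr_eq0.
rewrite (_ : 12 * g1 z * Delta z = qpar z * (cexp (- 24 * psum a (qpar z)) *
    (- 24 * (psum (fun n => n.+1%:R * a n.+1) (qpar z) * (tpi * qpar z)))) +
    cexp (- 24 * psum a (qpar z)) * (tpi * qpar z)) //.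
by rewrite /Delta /Defs.g1 -E -/a; field.
Qed.

Lemma Delta_T z : Delta (z + 1) = Delta z.
Proof. by rewrite /Delta qparD1. Qed.

Lemma upper_i : @upper R 'i.
Proof. by rewrite /upper /= ltr01. Qed.

(** The logarithmic derivative of [Delta] is 12 g1, and the anomaly of g1 under inversion matches
    the factor z^12 exactly. So the quotient of the two sides is constant, and it is 1 at the fixed
    point i. *)
Lemma Delta_S z : @upper R z -> Delta (- z^-1) = z ^+ 12 * Delta z.
Proof.
move=> hz; pose h x := Delta (- x^-1) * (x ^+ 12)^-1 * (Delta x)^-1.
have hd x : @upper R x -> cderiv h x 0.
  move=> hx; have x0 := upper_neq0 hx; have hS := upper_S hx.
  have d1 := cderivN (cderivV x0 (cderiv_id x)).
  have d2 := cderiv_comp d1 (cderiv_Delta hS).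
  have x12 : x ^+ 12 != 0 by rewrite expf_neq0.
  have d3 := @cderivV _ (fun y => y ^+ 12) x _ x12 (cderivX 12 (cderiv_id x)).
  have d4 := cderivM d2 d3.
  have d5 := cderivV (Delta_neq0 x) (cderiv_Delta hx).
  have d6 := cderivM d4 d5; move: d6.
  rewrite g1_S //; congr cderiv.
  have D0 := Delta_neq0 x; set D' := Delta (- x^-1); set D := Delta x in D0 *.
  by field; rewrite x0 D0.
have ei : - ('i : C)^-1 = 'i.
  by apply: (mulIf (upper_neq0 upper_i)); rewrite mulNr (mulVf (upper_neq0 upper_i)) -expr2 sqr_i.
have hi : h 'i = 1.
  rewrite /h ei (_ : 'i ^+ 12 = 1 :> C); last first.
    by rewrite (exprM _ 2 6) sqr_i -signr_odd.
  by rewrite invr1 mulr1 divff // Delta_neq0.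
have := cderiv0_const hd hz upper_i; rewrite hi /h => H.
have D0 := Delta_neq0 z; have z12 : z ^+ 12 != 0 by rewrite expf_neq0 // upper_neq0.
rewrite -[LHS](mulfVK z12) -[X in X * _](mulfVK D0) H; ring.
Qed.

Lemma Delta_cusp : ccvg cusp (fun z => Delta z / qpar z) 1.
Proof.
have h := psum_cusp log_coef_bounded.
have a0 : @sigma_coef R 1 0 / 0%:R = 0 by rewrite /sigma_coef eqxx mul0r.
rewrite a0 in h.
have /cvg_nbhsCP H := cderiv_cvg (cderiv_cexp (0 : C)).
apply/cvg_cuspP => e /H[d d0 hd].
have d24 : 0 < d / 24 by lra.
have /cvg_cuspP/(_ _ d24)[Y hY] := h.
exists Y => z /hY hz; rewrite /Delta mulrAC divff ?qpar_neq0 // mul1r.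
have := hd (- 24 * psum (fun n => sigma_coef 1 n / n%:R) (qpar z)).
rewrite cexp0 !subr0; apply; rewrite ncM ncN nc_nat.
by move: hz; rewrite subr0 ltr_pdivlMr // mulrC.
Qed.

End ModularLaws.

(** * From the generators to all of SL(2, Z) *)

Section SL2.
Context {R : realType}.
Local Notation C := R[i].
Local Notation Im := complex.Im.

(** Euclidean algorithm on the lower row: with A' the matrix in the premise, A' S T^q = -A, and for
    q the quotient of d by c its lower left entry is the remainder. *)
Lemma SL2_ind (P : int -> int -> int -> int -> Prop) :
  (forall b, P 1 b 0 1) -> (forall b, P (-1) b 0 (-1)) ->
  (forall a b c d q, a * d - b * c = 1 ->
     P (b - q * a) (- a) (d - q * c) (- c) -> P a b c d) ->
  forall a b c d, a * d - b * c = 1 -> P a b c d.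
Proof.
move=> h1 h2 h3 a b c d; have [n] := ubnP `|c|%N; elim: n a b c d => // n IH a b c d hn det.
have [c0|c0] := eqVneq c 0.
  move: det; rewrite c0 mulr0 subr0 => ad.
  have /orP[/eqP ha|/eqP ha] : (a == 1) || (a == -1).
    have : (`|a| * `|d|)%N = 1%N by rewrite -abszM ad.
    by move/eqP; rewrite muln_eq1 => /andP[/eqP h _]; apply/orP; lia.
  - by rewrite (_ : d = 1) ?ha //; move: ad; rewrite ha mul1r.
  - by rewrite (_ : d = -1) ?ha //; move: ad; rewrite ha mulN1r => /(congr1 -%R); rewrite opprK.
apply: (h3 _ _ _ _ (d %/ c)%Z) => //; apply: IH.
  have -> : d - (d %/ c)%Z * c = (d %% c)%Z by rewrite {1}(divz_eq d c) addrC addKr.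
  by have := ltz_mod d c0; have := modz_ge0 d c0; lia.
by rewrite -det; ring.
Qed.

Lemma Im_moebius (a b c d : int) (z : C) : a * d - b * c = 1 -> @upper R z ->
  c%:~R * z + d%:~R != 0 /\ @upper R ((a%:~R * z + b%:~R) / (c%:~R * z + d%:~R)).
Proof.
move=> det hz; have cd : (c != 0) || (d != 0).
  by apply/orP; have [c0|] := eqVneq c 0; [right; lia|left].
have j0 := lat_neq0 hz cd; split=> //.
have nj : 0 < nc (c%:~R * z + d%:~R) ^+ 2 by rewrite exprn_gt0 // nc_gt0.
suff E : Im ((a%:~R * z + b%:~R) / (c%:~R * z + d%:~R)) * nc (c%:~R * z + d%:~R) ^+ 2 = Im z.
  by move: hz; rewrite /upper /= -E pmulr_lgt0.
have detR : a%:~R * d%:~R - b%:~R * c%:~R = 1 :> R.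
  by rewrite -!intrM -intrB det.
case: z {hz j0} nj => x y nj; move: nj; rewrite nc_sqr !(ReD, ImD, ReM, ImM) !Re_int !Im_int /=.
rewrite !mul0r !subr0 !addr0 => nj.
have -> : Im ((c%:~R * (x +i* y) + d%:~R)^-1 : C) =
   - (c%:~R * y) / ((c%:~R * x + d%:~R) ^+ 2 + (c%:~R * y) ^+ 2).
  have -> : c%:~R * (x +i* y) + d%:~R = (c%:~R * x + d%:~R) +i* (c%:~R * y) :> C.
    by apply: complex_eq; rewrite !(ReD, ImD, ReM, ImM) !Re_int !Im_int /=; ring.
  by rewrite mulNr.
have -> : complex.Re ((c%:~R * (x +i* y) + d%:~R)^-1 : C) =
   (c%:~R * x + d%:~R) / ((c%:~R * x + d%:~R) ^+ 2 + (c%:~R * y) ^+ 2).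
  have -> : c%:~R * (x +i* y) + d%:~R = (c%:~R * x + d%:~R) +i* (c%:~R * y) :> C.
    by apply: complex_eq; rewrite !(ReD, ImD, ReM, ImM) !Re_int !Im_int /=; ring.
  by [].
set N := _ + _ in nj *; have N0 : N != 0 by rewrite gt_eqF.
transitivity (y * (a%:~R * d%:~R - b%:~R * c%:~R)); first by field.
by rewrite detR mulr1.
Qed.

Section Transformation.
Variables (g : C -> C) (w : nat) (kap : C).
Hypothesis wev : ~~ odd w.
Hypothesis kapw : kap = 0 \/ w = 2%N.
Hypothesis gT : forall z (n : int), @upper R z -> g (z + n%:~R) = g z.
Hypothesis gS : forall z, @upper R z -> g (- z^-1) = z ^+ w * (g z + kap / z).

Lemma SL2_transformation (a b c d : int) : a * d - b * c = 1 -> forall z, @upper R z ->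
  g ((a%:~R * z + b%:~R) / (c%:~R * z + d%:~R)) =
  (c%:~R * z + d%:~R) ^+ w * (g z + kap * c%:~R / (c%:~R * z + d%:~R)).
Proof.
move: a b c d; apply: SL2_ind => [b z hz|b z hz|a b c d q det IH z hz].
- by rewrite !mul1r !mul0r add0r mulr0 mul0r addr0 divr1 (gT _ hz) expr1n mul1r.
- rewrite !mul0r add0r mulr0 mul0r addr0.
  have -> : ((-1)%:~R * z + b%:~R) / (-1)%:~R = z + (- b)%:~R :> C.
    by rewrite !mulrNz; field.
  by rewrite (gT _ hz) -signr_odd (negbTE wev) mul1r.
have hq : @upper R (z + q%:~R).
  by move: hz; rewrite /upper /= ImD Im_int addr0.
have hu := upper_S hq.
have zq0 := upper_neq0 hq.
have [j0 _] := Im_moebius det hz.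
have det' : (b - q * a) * (- c) - (- a) * (d - q * c) = 1 by rewrite -det; ring.
have [j0' _] := Im_moebius det' hu.
have := IH _ hu; rewrite gS // (gT _ hz).
have E1 : (d - q * c)%:~R * - (z + q%:~R)^-1 + (- c)%:~R =
    - (c%:~R * z + d%:~R) / (z + q%:~R) :> C.
  by rewrite intrB intrM mulrNz; field.
rewrite E1.
have -> : ((b - q * a)%:~R * - (z + q%:~R)^-1 + (- a)%:~R) /
    (- (c%:~R * z + d%:~R) / (z + q%:~R)) = (a%:~R * z + b%:~R) / (c%:~R * z + d%:~R) :> C.
  by rewrite intrB intrM mulrNz; field; rewrite j0 zq0.
move=> ->.
have sgn : (- (c%:~R * z + d%:~R) / (z + q%:~R)) ^+ w =
    (c%:~R * z + d%:~R) ^+ w * (z + q%:~R) ^- w :> C.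
  by rewrite exprMn exprNn -signr_odd (negbTE wev) mul1r exprVn.
have zw : (z + q%:~R) ^+ w != 0 by rewrite expf_neq0.
rewrite sgn; case: kapw => [->|w2].
  by rewrite !mul0r !addr0; field.
rewrite w2 intrB intrM; field.
by rewrite zq0 j0.
Qed.

End Transformation.

End SL2.

(** * Goursat's lemma and Cauchy's formula in a strip *)

Section RealVariable.
Context {R : realType}.
Local Notation C := R[i].
Local Notation Re := complex.Re.
Local Notation Im := complex.Im.
Implicit Types (H h k : R -> C) (a b c d t : R).

Definition rcder H t (d : C) := forall e : R, 0 < e -> exists2 r : R, 0 < r &
  forall s, `|s| < r -> nc (H (t + s) - H t - d * s%:C) <= e * `|s|.

Definition rcont h := forall t (e : R), 0 < e -> exists2 r : R, 0 < r &
  forall s, `|s - t| < r -> nc (h s - h t) < e.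

Lemma rcder_Re H t (d : C) : rcder H t d -> is_derive t 1 (fun s => Re (H s)) (Re d).
Proof.
move=> h; apply/rderivP => e /h[r r0 hr]; exists r => // s /hr.
apply: le_trans; apply: le_trans (Re_le_nc _).
by rewrite !ReD !ReN ReM /= mulr0 subr0.
Qed.

Lemma rcder_Im H t (d : C) : rcder H t d -> is_derive t 1 (fun s => Im (H s)) (Im d).
Proof.
move=> h; apply/rderivP => e /h[r r0 hr]; exists r => // s /hr.
apply: le_trans; apply: le_trans (Im_le_nc _).
by rewrite !ImD !ImN ImM /= mulr0 add0r.
Qed.

Lemma rcder_ReIm (u v : R -> R) t x y : is_derive t 1 u x -> is_derive t 1 v y ->
  rcder (fun s => u s +i* v s) t (x +i* y).
Proof.
move=> /rderivP hu /rderivP hv e e0; have e2 : 0 < e / 2 by lra.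
have [r1 r10 h1] := hu _ e2; have [r2 r20 h2] := hv _ e2.
exists (Num.min r1 r2); first by rewrite lt_min r10.
move=> s; rewrite lt_min => /andP[/h1 k1 /h2 k2].
apply: le_trans (nc_le_ReIm _) _.
rewrite !ReD !ReN ReM !ImD !ImN ImM /= !mulr0 subr0 add0r; lra.
Qed.

Lemma rcderD H K t (x y : C) : rcder H t x -> rcder K t y ->
  rcder (fun s => H s + K s) t (x + y).
Proof.
move=> hu hv e e0; have e2 : 0 < e / 2 by lra.
have [r1 r10 h1] := hu _ e2; have [r2 r20 h2] := hv _ e2.
exists (Num.min r1 r2); first by rewrite lt_min r10.
move=> s; rewrite lt_min => /andP[/h1 k1 /h2 k2].
have -> : H (t + s) + K (t + s) - (H t + K t) - (x + y) * s%:C =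
  (H (t + s) - H t - x * s%:C) + (K (t + s) - K t - y * s%:C) by ring.
apply: le_trans (ncD _ _) _; lra.
Qed.

Lemma rcderZ (z : C) H t x : rcder H t x -> rcder (fun s => z * H s) t (z * x).
Proof.
move=> h e e0; have z1 : 0 < 1 + nc z by rewrite ltr_wpDr ?nc_ge0.
have [|r r0 hr] := h (e / (1 + nc z)); first exact: divr_gt0.
exists r => // s /hr hs.
have -> : z * H (t + s) - z * H t - z * x * s%:C = z * (H (t + s) - H t - x * s%:C) by ring.
rewrite ncM; apply: le_trans (_ : (1 + nc z) * (e / (1 + nc z) * `|s|) <= _).
  by apply: ler_pM; rewrite ?nc_ge0 // lerDr.
by rewrite mulrA (mulrC (1 + nc z)) mulfVK // gt_eqF.
Qed.

Lemma rcder_affine (x y : C) t :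
  rcder (fun s => x * s%:C + y * (s%:C ^+ 2 / 2)) t (x + y * t%:C).
Proof.
move=> e e0; have z1 : 0 < 1 + nc y by rewrite ltr_wpDr ?nc_ge0.
exists (e / (1 + nc y)); first exact: divr_gt0.
move=> s; rewrite ltr_pdivlMr // => hs.
have -> : x * (t + s)%:C + y * ((t + s)%:C ^+ 2 / 2) - (x * t%:C + y * (t%:C ^+ 2 / 2))
  - (x + y * t%:C) * s%:C = (y * (s%:C / 2)) * s%:C by rewrite rmorphD; field.
rewrite 3!ncM ncV nc_nat !nc_real; apply: ler_wpM2r => //.
have := normr_ge0 s; have := nc_ge0 y; nra.
Qed.

(** The factor 2 comes from treating real and imaginary parts separately; it persists in all
    integral bounds below and is harmless. *)
Lemma rcder_mvt H h a b M : a <= b ->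
  (forall t, a <= t <= b -> rcder H t (h t)) ->
  (forall t, a <= t <= b -> nc (h t) <= M) ->
  nc (H b - H a) <= 2 * M * (b - a).
Proof.
rewrite le_eqVlt => /orP[/eqP <-|ab] hd hM.
  by rewrite !subrr nc0 mulr0.
have key (p : C -> R) : (forall x, `|p x| <= nc x) ->
    (forall t, a <= t <= b -> is_derive t 1 (fun s => p (H s)) (p (h t))) ->
    `|p (H b) - p (H a)| <= M * (b - a).
  move=> pn pd.
  have [||c] := @MVT R (fun s => p (H s)) (fun s => p (h s)) a b ab.
  - by move=> x; rewrite in_itv /= => /andP[x0 x1]; apply: pd; rewrite !ltW.
  - apply: derivable_within_continuous => x; rewrite in_itv /= => hx.
    by case: (pd x hx).
  rewrite in_itv /= => /andP[c0 c1] ->; rewrite normrM (gtr0_norm (_ : 0 < b - a)) ?subr_gt0 //.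
  apply: ler_wpM2r; first by rewrite subr_ge0 ltW.
  by apply: le_trans (pn _) _; apply: hM; rewrite !ltW.
apply: le_trans (nc_le_ReIm _) _; rewrite ReD ImD ReN ImN.
have := key _ Re_le_nc (fun t ht => rcder_Re (hd t ht)).
have := key _ Im_le_nc (fun t ht => rcder_Im (hd t ht)); lra.
Qed.

Lemma real_antideriv (u : R -> R) a : continuous u ->
  exists U : R -> R, forall x, a < x -> is_derive x 1 U (u x).
Proof.
move=> cu; exists (fun x => (\int[@lebesgue_measure R]_(t in [set` `[a, x]]) (u t))%R).
move=> x ax.
have lt1 : x < x + 1 by rewrite ltrDl.
have int1 : (@lebesgue_measure R).-integrable [set` `[a, x + 1]] (EFin \o u).
  apply: continuous_compact_integrable; first exact: segment_compact.
  by apply: continuous_subspaceT.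
have [h1 h2] := continuous_FTC1_closed lt1 int1 ax (cu x).
apply: (DeriveDef h1); rewrite -derive1E; exact: h2.
Qed.

Lemma rcont_Re h : rcont h -> continuous (fun s => Re (h s)).
Proof.
move=> H t; apply/cvgrPdist_lt => e /(H t)[r r0 hr]; apply/nbhs_ballP; exists r => // s.
rewrite /ball /= distrC => /hr; apply: le_lt_trans.
by rewrite nc_distC; apply: le_trans (Re_le_nc _); rewrite ReD ReN.
Qed.

Lemma rcont_Im h : rcont h -> continuous (fun s => Im (h s)).
Proof.
move=> H t; apply/cvgrPdist_lt => e /(H t)[r r0 hr]; apply/nbhs_ballP; exists r => // s.
rewrite /ball /= distrC => /hr; apply: le_lt_trans.
by rewrite nc_distC; apply: le_trans (Im_le_nc _); rewrite ImD ImN.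
Qed.

Lemma antideriv h a : rcont h -> exists H, forall x, a < x -> rcder H x (h x).
Proof.
move=> hc; have [U hU] := real_antideriv a (rcont_Re hc).
have [V hV] := real_antideriv a (rcont_Im hc).
exists (fun s => U s +i* V s) => x ax.
by have := rcder_ReIm (hU x ax) (hV x ax); case: (h x).
Qed.

(* The integral of a continuous function, as the increment of an antiderivative
   chosen classically. *)
Definition cprim h a : R -> C :=
  if pselect (exists H, forall x, a < x -> rcder H x (h x)) is left e
  then projT1 (cid e) else fun=> 0.

(** The base point is [a - 1] because [antideriv] gives derivatives only strictly to its right, and
    [a] itself is needed. *)
Definition cint a b h : C := cprim h (a - 1) b - cprim h (a - 1) a.

Lemma cprimP h a : rcont h -> forall x, a < x -> rcder (cprim h a) x (h x).
Proof.
move=> hc; rewrite /cprim; case: pselect => [e|]; last by case; exact: antideriv.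
exact: projT2 (cid e).
Qed.

Lemma cintE h H a b : rcont h -> a <= b ->
  (forall t, a <= t <= b -> rcder H t (h t)) -> cint a b h = H b - H a.
Proof.
move=> hc ab hH; pose D s := cprim h (a - 1) s + -1 * H s.
have dD t : a <= t <= b -> rcder D t 0.
  move=> ht; have := rcderD (cprimP (a := a - 1) hc (x := t) _) (rcderZ (-1) (hH t ht)).
  by rewrite mulN1r subrr; apply; case/andP: ht; lra.
have := @rcder_mvt D (fun=> 0) a b 0 ab dD; rewrite mulr0 mul0r nc0.
move=> /(_ (fun _ _ => lexx _)) h0.
have /eqP : nc (D b - D a) = 0 by apply/eqP; rewrite eq_le h0 nc_ge0.
rewrite nc_eq0 /D /cint => /eqP E.
apply/eqP; rewrite -subr_eq0; apply/eqP; rewrite -[RHS]E; ring.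
Qed.

Lemma cint_add h a m b : rcont h -> a <= m -> m <= b ->
  cint a b h = cint a m h + cint m b h.
Proof.
move=> hc am mb; pose H := cprim h (a - 1).
have hH t : a <= t -> rcder H t (h t) by move=> ht; apply: cprimP => //; lra.
rewrite (@cintE h H a b) ?(@cintE h H a m) ?(@cintE h H m b) //.
- by ring.
- by move=> t /andP[h1 h2]; apply: hH; lra.
- by move=> t /andP[h1 h2]; apply: hH; lra.
- exact: le_trans mb.
- by move=> t /andP[h1 h2]; apply: hH; lra.
Qed.

Lemma rcontD h k : rcont h -> rcont k -> rcont (fun s => h s + k s).
Proof.
move=> hh hk t e e0; have e2 : 0 < e / 2 by lra.
have [r1 r10 h1] := hh t _ e2; have [r2 r20 h2] := hk t _ e2.
exists (Num.min r1 r2); first by rewrite lt_min r10.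
move=> s; rewrite lt_min => /andP[/h1 k1 /h2 k2].
have -> : h s + k s - (h t + k t) = (h s - h t) + (k s - k t) by ring.
apply: le_lt_trans (ncD _ _) _; lra.
Qed.

Lemma rcontZ (z : C) h : rcont h -> rcont (fun s => z * h s).
Proof.
move=> hh t e e0; have z1 : 0 < 1 + nc z by rewrite ltr_wpDr ?nc_ge0.
have [|r r0 hr] := hh t (e / (1 + nc z)); first exact: divr_gt0.
exists r => // s /hr; rewrite ltr_pdivlMr // => hs.
rewrite -mulrBr ncM; apply: le_lt_trans hs; have := nc_ge0 (h s - h t); nra.
Qed.

Lemma rcont_cst (z : C) : rcont (fun=> z).
Proof. by move=> t e e0; exists 1 => // s _; rewrite subrr nc0. Qed.

Lemma cintD h k a b : rcont h -> rcont k -> a <= b ->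
  cint a b (fun s => h s + k s) = cint a b h + cint a b k.
Proof.
move=> hh hk ab; pose H := cprim h (a - 1); pose K := cprim k (a - 1).
have hH t : a <= t <= b -> rcder H t (h t).
  by move=> /andP[ht _]; apply: cprimP => //; lra.
have hK t : a <= t <= b -> rcder K t (k t).
  by move=> /andP[ht _]; apply: cprimP => //; lra.
rewrite (@cintE h H) // (@cintE k K) // (@cintE _ (fun s => H s + K s)) //.
- by ring.
- exact: rcontD.
- by move=> t ht; apply: rcderD; [exact: hH|exact: hK].
Qed.

Lemma cintZ (z : C) h a b : rcont h -> a <= b ->
  cint a b (fun s => z * h s) = z * cint a b h.
Proof.
move=> hh ab; pose H := cprim h (a - 1).
have hH t : a <= t <= b -> rcder H t (h t).
  by move=> /andP[ht _]; apply: cprimP => //; lra.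
rewrite (@cintE h H) // (@cintE _ (fun s => z * H s)) //.
- by ring.
- exact: rcontZ.
- by move=> t ht; apply: rcderZ; exact: hH.
Qed.

Lemma nc_cint_le h a b M : rcont h -> a <= b ->
  (forall t, a <= t <= b -> nc (h t) <= M) -> nc (cint a b h) <= 2 * M * (b - a).
Proof.
move=> hh ab hM; apply: rcder_mvt hM => // t /andP[ht _].
by apply: cprimP => //; lra.
Qed.

Lemma rcont_affine (x y : C) : rcont (fun s => x + y * s%:C).
Proof.
apply: rcontD; first exact: rcont_cst.
apply: rcontZ => t e e0; exists e => // s.
by rewrite -rmorphB nc_real.
Qed.

Lemma cint_affine (x y : C) a b : a <= b ->
  cint a b (fun s => x + y * s%:C) =
  x * (b - a)%:C + y * ((b%:C ^+ 2 - a%:C ^+ 2) / 2).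
Proof.
move=> ab; rewrite (@cintE _ (fun s => x * s%:C + y * (s%:C ^+ 2 / 2))) //.
- by rewrite rmorphB; field.
- exact: rcont_affine.
- by move=> t _; exact: rcder_affine.
Qed.

Lemma cint_cst (x : C) a b : a <= b -> cint a b (fun=> x) = x * (b - a)%:C.
Proof.
move=> ab; have := cint_affine x 0 ab; rewrite mul0r addr0 => <-.
by congr cint; apply/funext => s; rewrite mul0r addr0.
Qed.

End RealVariable.

(** * Goursat's lemma on rectangles *)

Section Goursat.
Context {R : realType}.
Local Notation C := R[i].
Local Notation Re := complex.Re.
Local Notation Im := complex.Im.
Implicit Types (a b c d : R).

Definition ccont (G : C -> C) := forall z (e : R), 0 < e -> exists2 r : R, 0 < r &
  forall w, nc (w - z) < r -> nc (G w - G z) < e.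

Lemma ccont_h G y : ccont G -> rcont (fun x => G (x +i* y)).
Proof.
move=> hG t e /(hG (t +i* y))[r r0 hr]; exists r => // s hs; apply: hr.
have -> : s +i* y - t +i* y = (s - t)%:C by apply: complex_eq => /=; rewrite ?subrr.
by rewrite nc_real.
Qed.

Lemma ccont_v G x : ccont G -> rcont (fun y => G (x +i* y)).
Proof.
move=> hG t e /(hG (x +i* t))[r r0 hr]; exists r => // s hs; apply: hr.
apply: le_lt_trans (nc_le_ReIm _) _.
by rewrite /= subrr normr0 add0r.
Qed.

(** The contour integral, counterclockwise, around the rectangle with lower left corner a + i c,
    width l and height h. *)
Definition rectint (G : C -> C) a c l h : C :=
  cint a (a + l) (fun x => G (x +i* c)) - cint a (a + l) (fun x => G (x +i* (c + h)))
  + 'i * (cint c (c + h) (fun y => G ((a + l) +i* y)) - cint c (c + h) (fun y => G (a +i* y))).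

Lemma rectint_split G a c l h : ccont G -> 0 <= l -> 0 <= h ->
  rectint G a c l h = rectint G a c (l / 2) (h / 2) + rectint G (a + l / 2) c (l / 2) (h / 2)
   + rectint G a (c + h / 2) (l / 2) (h / 2) + rectint G (a + l / 2) (c + h / 2) (l / 2) (h / 2).
Proof.
move=> hG l0 h0.
have el : a + l / 2 + l / 2 = a + l by field.
have eh : c + h / 2 + h / 2 = c + h by field.
rewrite /rectint !el !eh.
have sh y : cint a (a + l) (fun x => G (x +i* y)) =
    cint a (a + l / 2) (fun x => G (x +i* y)) + cint (a + l / 2) (a + l) (fun x => G (x +i* y)).
  by apply: cint_add; rewrite ?lerD2l; [exact: ccont_h|lra|lra].
have sv x : cint c (c + h) (fun y => G (x +i* y)) =
    cint c (c + h / 2) (fun y => G (x +i* y)) + cint (c + h / 2) (c + h) (fun y => G (x +i* y)).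
  by apply: cint_add; rewrite ?lerD2l; [exact: ccont_v|lra|lra].
by rewrite !sh !sv; ring.
Qed.

(** Corner of a quarter whose integral is at least a quarter of the integral of the parent: if the
    first three candidates fail, the last one cannot. *)
Definition quadrant (G : C -> C) (l h : R) (p : R * R) (n : nat) : R * R :=
  let l' := l / 2 ^+ n / 2 in let h' := h / 2 ^+ n / 2 in
  let J q := nc (rectint G q.1 q.2 l' h') in
  let t := nc (rectint G p.1 p.2 (l / 2 ^+ n) (h / 2 ^+ n)) / 4 in
  if t <= J p then p else
  if t <= J (p.1 + l', p.2) then (p.1 + l', p.2) else
  if t <= J (p.1, p.2 + h') then (p.1, p.2 + h') else (p.1 + l', p.2 + h').

Fixpoint corner (G : C -> C) (l h : R) (p : R * R) (n : nat) : R * R :=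
  if n is m.+1 then quadrant G l h (corner G l h p m) m else p.

Lemma half_pow (l : R) n : l / 2 ^+ n.+1 = l / 2 ^+ n / 2.
Proof. by rewrite exprSr invfM mulrA. Qed.

Lemma corner_rect G l h p n : ccont G -> 0 <= l -> 0 <= h ->
  nc (rectint G p.1 p.2 l h) / 4 ^+ n <=
  nc (rectint G (corner G l h p n).1 (corner G l h p n).2 (l / 2 ^+ n) (h / 2 ^+ n)).
Proof.
move=> hG l0 h0; elim: n => [|n IH]; first by rewrite !expr0 !divr1.
rewrite exprSr invfM mulrA; apply: le_trans (_ : _ <= nc (rectint G (corner G l h p n).1
  (corner G l h p n).2 (l / 2 ^+ n) (h / 2 ^+ n)) / 4) _.
  by rewrite ler_wpM2r // invr_ge0.
rewrite !half_pow /= /quadrant; set q := corner _ _ _ _ _.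
have p2 : 0 <= 2 ^+ n :> R by rewrite exprn_ge0.
have := @rectint_split G q.1 q.2 (l / 2 ^+ n) (h / 2 ^+ n) hG (divr_ge0 l0 p2) (divr_ge0 h0 p2).
set J := rectint G q.1 q.2 (l / 2 ^+ n) _; move=> E.
case: ifPn => // n1; case: ifPn => // n2; case: ifPn => // n3 /=.
move: n1 n2 n3; rewrite -!ltNge /= => n1 n2 n3.
have : nc J <= nc (rectint G q.1 q.2 (l / 2 ^+ n / 2) (h / 2 ^+ n / 2))
  + nc (rectint G (q.1 + l / 2 ^+ n / 2) q.2 (l / 2 ^+ n / 2) (h / 2 ^+ n / 2))
  + nc (rectint G q.1 (q.2 + h / 2 ^+ n / 2) (l / 2 ^+ n / 2) (h / 2 ^+ n / 2))
  + nc (rectint G (q.1 + l / 2 ^+ n / 2) (q.2 + h / 2 ^+ n / 2) (l / 2 ^+ n / 2) (h / 2 ^+ n / 2)).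
  rewrite E; apply: le_trans (ncD _ _) _; rewrite lerD2r.
  apply: le_trans (ncD _ _) _; rewrite lerD2r; exact: ncD.
lra.
Qed.

Lemma corner_step G l h p n : 0 <= l -> 0 <= h ->
  [/\ (corner G l h p n).1 <= (corner G l h p n.+1).1,
      (corner G l h p n.+1).1 + l / 2 ^+ n.+1 <= (corner G l h p n).1 + l / 2 ^+ n,
      (corner G l h p n).2 <= (corner G l h p n.+1).2
    & (corner G l h p n.+1).2 + h / 2 ^+ n.+1 <= (corner G l h p n).2 + h / 2 ^+ n].
Proof.
move=> l0 h0; rewrite !half_pow /= /quadrant; set q := corner _ _ _ _ _.
have p2 : 0 <= 2 ^+ n :> R by rewrite exprn_ge0.
have := divr_ge0 l0 p2; have := divr_ge0 h0 p2.
move: (l / 2 ^+ n) (h / 2 ^+ n) => x y hx hy.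
by do ![case: ifP => _ /=]; split; lra.
Qed.

Lemma nested_point (u : nat -> R) (l : R) : 0 <= l ->
  (forall n, u n <= u n.+1 /\ u n.+1 + l / 2 ^+ n.+1 <= u n + l / 2 ^+ n) ->
  exists x, forall n, u n <= x <= u n + l / 2 ^+ n.
Proof.
move=> l0 hu.
have mono m n : (m <= n)%N -> u m <= u n /\ u n + l / 2 ^+ n <= u m + l / 2 ^+ m.
  move=> /subnK <-; elim: (n - m)%N => [|k [IH1 IH2]]; first by rewrite add0n.
  by rewrite addSn; have [h1 h2] := hu (k + m)%N; split; [exact: le_trans h1|exact: le_trans IH2].
have up m n : u m <= u n + l / 2 ^+ n.
  have pos k : 0 <= l / 2 ^+ k by rewrite divr_ge0 // exprn_ge0.
  case: (leqP m n) => mn.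
    by apply: le_trans (mono _ _ mn).1 _; rewrite lerDl.
  by apply: le_trans (mono _ _ (ltnW mn)).2; rewrite lerDl.
pose S := [set u n | n in [set: nat]].
have sS : has_sup S.
  split; first by exists (u 0%N); exists 0%N.
  by exists (u 0%N + l / 2 ^+ 0) => _ [n _ <-]; exact: up.
exists (sup S) => n; apply/andP; split.
  by apply: sup_upper_bound => //; exists n.
by apply: ge_sup; [case: sS|move=> _ [m _ <-]; exact: up].
Qed.

(** Differentiability relative to the closed rectangle, which a continuous extension beyond a strip
    still satisfies. *)
Definition rect_diff (G : C -> C) a c l h := forall x y, a <= x <= a + l -> c <= y <= c + h ->
  exists D : C, forall e : R, 0 < e -> exists2 r : R, 0 < r &
    forall x' y', a <= x' <= a + l -> c <= y' <= c + h ->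
      `|x' - x| + `|y' - y| < r ->
      nc (G (x' +i* y') - G (x +i* y) - D * (x' +i* y' - x +i* y)) <= e * (`|x' - x| + `|y' - y|).

Lemma rectint_affine (A D : C) a c l h : 0 <= l -> 0 <= h ->
  rectint (fun z => A + D * z) a c l h = 0.
Proof.
move=> l0 h0.
have ch y : (fun x : R => A + D * (x +i* y)) = (fun x => (A + D * 'i * y%:C) + D * x%:C).
  apply/funext => x; have -> : x +i* y = x%:C + 'i * y%:C.
    by apply: complex_eq; rewrite !(ReD, ImD, ReM, ImM) /=; ring.
  ring.
have cv x : (fun y : R => A + D * (x +i* y)) = (fun y => (A + D * x%:C) + D * 'i * y%:C).
  apply/funext => y; have -> : x +i* y = x%:C + 'i * y%:C.
    by apply: complex_eq; rewrite !(ReD, ImD, ReM, ImM) /=; ring.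
  ring.
have ai u v : (u + v - u)%:C = v%:C :> C by congr (_%:C); ring.
rewrite /rectint !ch !cv !cint_affine ?lerDl // !ai !rmorphD.
by field.
Qed.

Lemma rectintB (G F : C -> C) a c l h : ccont G -> ccont F -> 0 <= l -> 0 <= h ->
  rectint (fun z => G z + -1 * F z) a c l h = rectint G a c l h - rectint F a c l h.
Proof.
move=> hG hF l0 h0; rewrite /rectint.
have sh y : cint a (a + l) (fun x => G (x +i* y) + -1 * F (x +i* y)) =
    cint a (a + l) (fun x => G (x +i* y)) - cint a (a + l) (fun x => F (x +i* y)).
  rewrite cintD ?lerDl //; [|exact: ccont_h|by apply: rcontZ; exact: ccont_h].
  by rewrite cintZ ?lerDl ?mulN1r //; exact: ccont_h.
have sv x : cint c (c + h) (fun y => G (x +i* y) + -1 * F (x +i* y)) =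
    cint c (c + h) (fun y => G (x +i* y)) - cint c (c + h) (fun y => F (x +i* y)).
  rewrite cintD ?lerDl //; [|exact: ccont_v|by apply: rcontZ; exact: ccont_v].
  by rewrite cintZ ?lerDl ?mulN1r //; exact: ccont_v.
by rewrite !sh !sv; ring.
Qed.

Lemma ccont_affine (A D : C) : ccont (fun z => A + D * z).
Proof.
move=> z e e0; have z1 : 0 < 1 + nc D by rewrite ltr_wpDr ?nc_ge0.
exists (e / (1 + nc D)); first exact: divr_gt0.
move=> w; rewrite ltr_pdivlMr // => hw.
have -> : A + D * w - (A + D * z) = D * (w - z) by ring.
rewrite ncM; apply: le_lt_trans hw; have := nc_ge0 (w - z); nra.
Qed.

Lemma nc_rectint_le (G : C -> C) a c l h M : ccont G -> 0 <= l -> 0 <= h ->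
  (forall x y, a <= x <= a + l -> c <= y <= c + h -> nc (G (x +i* y)) <= M) ->
  nc (rectint G a c l h) <= 4 * M * (l + h).
Proof.
move=> hG l0 h0 hM.
have sh y : c <= y <= c + h -> nc (cint a (a + l) (fun x => G (x +i* y))) <= 2 * M * l.
  move=> hy; have := @nc_cint_le R (fun x => G (x +i* y)) a (a + l) M.
  rewrite addrAC subrr add0r; apply; [exact: ccont_h|by rewrite lerDl|].
  by move=> t ht; exact: hM.
have sv x : a <= x <= a + l -> nc (cint c (c + h) (fun y => G (x +i* y))) <= 2 * M * h.
  move=> hx; have := @nc_cint_le R (fun y => G (x +i* y)) c (c + h) M.
  rewrite addrAC subrr add0r; apply; [exact: ccont_v|by rewrite lerDl|].
  by move=> t ht; exact: hM.
rewrite /rectint; apply: le_trans (ncD _ _) _; rewrite ncM.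
have -> : nc ('i : C) = 1 by rewrite /= expr0n /= add0r expr1n sqrtr1.
rewrite mul1r; apply: le_trans (lerD (ncB _ _) (ncB _ _)) _.
have := sh c; have := sh (c + h); have := sv a; have := sv (a + l).
rewrite !lexx !lerDl !l0 !h0 /= => /(_ isT) ? /(_ isT) ? /(_ isT) ? /(_ isT) ?.
lra.
Qed.

Lemma ccontD (G F : C -> C) : ccont G -> ccont F -> ccont (fun z => G z + -1 * F z).
Proof.
move=> hG hF z e e0; have e2 : 0 < e / 2 by lra.
have [r1 r10 h1] := hG z _ e2; have [r2 r20 h2] := hF z _ e2.
exists (Num.min r1 r2); first by rewrite lt_min r10.
move=> w; rewrite lt_min => /andP[/h1 k1 /h2 k2].
have -> : G w + -1 * F w - (G z + -1 * F z) = (G w - G z) - (F w - F z) by ring.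
apply: le_lt_trans (ncB _ _) _; lra.
Qed.

Theorem goursat (G : C -> C) a c l h : ccont G -> 0 <= l -> 0 <= h ->
  rect_diff G a c l h -> rectint G a c l h = 0.
Proof.
move=> hG l0 h0 dG.
pose q := corner G l h (a, c).
have [x hx] : exists x, forall n, (q n).1 <= x <= (q n).1 + l / 2 ^+ n.
  by apply: (nested_point l0) => n; have [? ? _ _] := corner_step G (a, c) n l0 h0.
have [y hy] : exists y, forall n, (q n).2 <= y <= (q n).2 + h / 2 ^+ n.
  by apply: (nested_point h0) => n; have [_ _ ? ?] := corner_step G (a, c) n l0 h0.
have inside n : a <= (q n).1 /\ (q n).1 + l / 2 ^+ n <= a + l /\
    c <= (q n).2 /\ (q n).2 + h / 2 ^+ n <= c + h.
  elim: n => [|n [i1 [i2 [i3 i4]]]]; first by rewrite /q /= !expr0 !divr1.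
  have [s1 s2 s3 s4] := corner_step G (a, c) n l0 h0.
  split; first exact: le_trans s1.
  split; first exact: le_trans i2.
  by split; [exact: le_trans s3|exact: le_trans i4].
have [D hD] : exists D : C, forall e : R, 0 < e -> exists2 r : R, 0 < r &
    forall x' y', a <= x' <= a + l -> c <= y' <= c + h ->
      `|x' - x| + `|y' - y| < r ->
      nc (G (x' +i* y') - G (x +i* y) - D * (x' +i* y' - x +i* y)) <= e * (`|x' - x| + `|y' - y|).
  apply: dG; have := hx 0%N; have := hy 0%N; by rewrite /q /= !expr0 !divr1.
pose A := G (x +i* y) - D * (x +i* y).
pose S := l + h; have S0 : 0 <= S by rewrite addr_ge0.
have main (e : R) : 0 < e -> nc (rectint G a c l h) <= 4 * e * S ^+ 2.
  move=> e0; have [r r0 hr] := hD _ e0.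
  have [n hn] : exists n, S / 2 ^+ n < r.
    have S1 : 0 < S + 1 by lra.
    have [|N hN] := @pow2_cvgy R (r / (S + 1)); first exact: divr_gt0.
    exists N; have := hN N (leqnn N); rewrite ltr_pdivlMr // => h1.
    by apply: le_lt_trans h1; rewrite mulrC ler_wpM2l ?invr_ge0 ?exprn_ge0 //; lra.
  have p0 : 0 < 2 ^+ n :> R by rewrite exprn_gt0.
  have ln : 0 <= l / 2 ^+ n by rewrite divr_ge0 // ltW.
  have kn : 0 <= h / 2 ^+ n by rewrite divr_ge0 // ltW.
  have Sn : S / 2 ^+ n = l / 2 ^+ n + h / 2 ^+ n by rewrite /S mulrDl.
  have [i1 [i2 [i3 i4]]] := inside n.
  (* The affine part integrates to 0; the remainder is at most e S / 2^n on a rectangle of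
     half-perimeter S / 2^n, so the factor 4^n lost by the bisection is recovered. *)
  have b1 : nc (rectint (fun z => G z + -1 * (A + D * z)) (q n).1 (q n).2 (l / 2 ^+ n) (h / 2 ^+ n))
      <= 4 * (e * (S / 2 ^+ n)) * (S / 2 ^+ n).
    rewrite {2}Sn; apply: nc_rectint_le => //.
      by apply: ccontD => //; exact: ccont_affine.
    move=> x' y' hx' hy'.
    have dx : `|x' - x| <= l / 2 ^+ n.
      move: (hx n) hx' => /andP[? ?] /andP[? ?]; rewrite ler_norml; apply/andP; split; lra.
    have dy : `|y' - y| <= h / 2 ^+ n.
      move: (hy n) hy' => /andP[? ?] /andP[? ?]; rewrite ler_norml; apply/andP; split; lra.
    have -> : G (x' +i* y') + -1 * (A + D * (x' +i* y')) =
        G (x' +i* y') - G (x +i* y) - D * (x' +i* y' - x +i* y) by rewrite /A; ring.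
    apply: le_trans (hr _ _ _ _ _) _.
    - by move: hx' => /andP[? ?]; apply/andP; split; lra.
    - by move: hy' => /andP[? ?]; apply/andP; split; lra.
    - apply: le_lt_trans hn; rewrite Sn; lra.
    - by rewrite ler_pM2l // Sn lerD.
  rewrite rectintB // in b1; last exact: ccont_affine.
  rewrite rectint_affine // subr0 in b1.
  have := le_trans (corner_rect (a, c) n hG l0 h0) b1 => /= H.
  have -> : 4 * e * S ^+ 2 = 4 * (e * (S / 2 ^+ n)) * (S / 2 ^+ n) * 4 ^+ n.
    rewrite (_ : 4 ^+ n = 2 ^+ n * 2 ^+ n :> R); last by rewrite -exprMn; congr (_ ^+ _); ring.
    by field; rewrite gt_eqF.
  by rewrite -ler_pdivrMr // exprn_gt0.
apply/eqP; rewrite -nc_eq0 eq_le nc_ge0 andbT.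
apply/ler_addgt0Pr => e e0; rewrite add0r.
have S1 : 0 < 4 * S ^+ 2 + 1 by rewrite ltr_wpDl // mulr_ge0 // exprn_ge0.
have [e' e'0 He] : exists2 e' : R, 0 < e' & 4 * e' * S ^+ 2 <= e.
  exists (e / (4 * S ^+ 2 + 1)); first exact: divr_gt0.
  have -> : 4 * (e / (4 * S ^+ 2 + 1)) * S ^+ 2 = e * (4 * S ^+ 2 / (4 * S ^+ 2 + 1)).
    by field; rewrite gt_eqF.
  rewrite ger_pMr // ler_pdivrMr // mul1r lerDl //.
exact: le_trans (main _ e'0) He.
Qed.

End Goursat.

(** * Line integrals of periodic functions and Cauchy's formula *)

Section Strip.
Context {R : realType}.
Local Notation C := R[i].
Local Notation Re := complex.Re.
Local Notation Im := complex.Im.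
Local Notation tpi := (two_pi_i R).
Local Notation cusp := (@Im_pinfty R).
Implicit Types (c d y : R) (z w : C) (f g : C -> C).

Definition ccont_at g z := forall e : R, 0 < e -> exists2 r : R, 0 < r &
  forall w, nc (w - z) < r -> nc (g w - g z) < e.

Definition line_int g y : C := cint 0 1 (fun x => g (x +i* y)).

Lemma cderiv_cont g z D : cderiv g z D -> ccont_at g z.
Proof. by move=> /cderiv_cvg/cvg_nbhsCP. Qed.

Lemma ccont_at_line g y : (forall z, Im z = y -> ccont_at g z) ->
  rcont (fun x => g (x +i* y)).
Proof.
move=> hg t e /(hg (t +i* y) erefl)[r r0 hr]; exists r => // s hs; apply: hr.
have -> : s +i* y - t +i* y = (s - t)%:C by apply: complex_eq => /=; rewrite ?subrr.
by rewrite nc_real.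
Qed.

Lemma line_int_le g y (M : R) : (forall z, Im z = y -> ccont_at g z) ->
  (forall z, Im z = y -> nc (g z) <= M) -> nc (line_int g y) <= 2 * M.
Proof.
move=> hc hM; have := @nc_cint_le R (fun x => g (x +i* y)) 0 1 M.
rewrite subr0 mulr1; apply; [exact: ccont_at_line|exact: ler01|by move=> *; exact: hM].
Qed.

Lemma line_intB g f y : (forall z, Im z = y -> ccont_at g z) ->
  (forall z, Im z = y -> ccont_at f z) ->
  line_int (fun z => g z - f z) y = line_int g y - line_int f y.
Proof.
move=> /ccont_at_line hg /ccont_at_line hf; rewrite /line_int.
have -> : (fun x => g (x +i* y) - f (x +i* y)) = (fun x => g (x +i* y) + -1 * f (x +i* y)).
  by apply/funext => x; rewrite mulN1r.
by rewrite cintD ?ler01 // ?cintZ ?ler01 ?mulN1r //; exact: rcontZ.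
Qed.

Lemma line_intZ (a : C) f y : (forall z, Im z = y -> ccont_at f z) ->
  line_int (fun z => a * f z) y = a * line_int f y.
Proof. by move=> /ccont_at_line hf; rewrite /line_int cintZ ?ler01. Qed.

(** Used to extend a function from a closed strip to a continuous one on the whole plane, as [ccont]
    is a global condition. *)
Definition clamp c d y := Num.max c (Num.min y d).

Lemma clamp_in c d y : c <= d -> c <= clamp c d y <= d.
Proof. by move=> cd; rewrite /clamp le_max lexx /= ge_max cd ge_min lexx orbT. Qed.

Lemma clamp_id c d y : c <= y <= d -> clamp c d y = y.
Proof. by move=> /andP[cy yd]; rewrite /clamp (min_idPl yd) (max_idPr cy). Qed.

Lemma clamp_lip c d y y' : c <= d -> `|clamp c d y - clamp c d y'| <= `|y - y'|.
Proof.
move=> cd; rewrite ler_norml /clamp.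
have := ler_norm (y - y'); have := ler_norm (y' - y); rewrite (distrC y' y).
case: (leP y d) => h1; case: (leP y' d) => h2; rewrite ?(max_idPr cd).
- by case: (leP c y) => h3; case: (leP c y') => h4 *; apply/andP; split; lra.
- by case: (leP c y) => h3 *; apply/andP; split; lra.
- by case: (leP c y') => h3 *; apply/andP; split; lra.
- by move=> *; apply/andP; split; lra.
Qed.

(** On a rectangle of width 1 the two vertical sides cancel by periodicity. *)
Lemma strip_const g c d : c <= d ->
  (forall z, c <= Im z <= d -> exists D, cderiv g z D) ->
  (forall z, c <= Im z <= d -> g (z + 1) = g z) -> line_int g c = line_int g d.
Proof.
move=> cd hd hp; pose G z := g (Re z +i* clamp c d (Im z)).
have GE x y : c <= y <= d -> G (x +i* y) = g (x +i* y) by move=> hy; rewrite /G /= clamp_id.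
have cG : ccont G.
  move=> z e e0; have [|D hD] := hd (Re z +i* clamp c d (Im z)); first exact: clamp_in.
  have [r r0 hr] := cderiv_cont hD e0.
  exists (r / 2); first by lra.
  move=> w hw; apply: hr; apply: le_lt_trans (nc_le_ReIm _) _ => /=.
  have := Re_le_nc (w - z); have := Im_le_nc (w - z); rewrite ReD ImD ReN ImN.
  by have := clamp_lip (Im w) (Im z) cd; lra.
have : rectint G 0 c 1 (d - c) = 0.
  apply: goursat => //; first by rewrite subr_ge0.
  rewrite /rect_diff add0r (addrC c) subrK => x y hx hy; have [D /cderivP hD] := hd (x +i* y) hy.
  exists D => e e0; have [r r0 hr] := hD e e0; exists r; rewrite // => x' y' hx' hy' hxy.
  rewrite !GE //; have hn : nc (x' +i* y' - x +i* y) <= `|x' - x| + `|y' - y|.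
    exact: le_trans (nc_le_ReIm _) _.
  have := hr (x' +i* y' - x +i* y) (le_lt_trans hn hxy).
  rewrite [x +i* y + _]addrC subrK => /le_trans; apply; apply: ler_wpM2l hn; exact: ltW.
rewrite /rectint !add0r (addrC c) subrK.
have -> : (fun y => G (1 +i* y)) = (fun y => G (0 +i* y)).
  apply/funext => y; rewrite /G /= -(hp (0 +i* clamp c d y)); last exact: clamp_in.
  by congr g; apply: complex_eq => /=; rewrite ?add0r ?addr0.
rewrite subrr mulr0 addr0 => /eqP; rewrite subr_eq0 => /eqP.
rewrite /line_int.
have -> : (fun x => G (x +i* c)) = (fun x => g (x +i* c)).
  by apply/funext => x; rewrite GE // lexx cd.
have -> // : (fun x => G (x +i* d)) = (fun x => g (x +i* d)).
by apply/funext => x; rewrite GE // lexx cd.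
Qed.

(** Compactness of the unit segment makes the continuity in the height uniform in the abscissa. *)
Lemma line_int_cont g c d y0 (e : R) : c < y0 < d ->
  (forall z, c < Im z < d -> ccont_at g z) -> 0 < e ->
  exists2 r : R, 0 < r & forall y, c < y < d -> `|y - y0| < r ->
    nc (line_int g y - line_int g y0) <= e.
Proof.
move=> hy0 hc e0; have e2 : 0 < e / 2 by lra.
pose P y x := nc (g (x +i* y) - g (x +i* y0)) < e / 2.
have := (compact_near_coveringP _).1 (@segment_compact R 0 1) R (nbhs y0) P _.
have hP : forall x : R, [set` `[0, 1]] x -> \forall x' \near x & i \near nbhs y0, P i x'.
  move=> x _; have e4 : 0 < e / 4 by lra.
  have [r r0 hr] := hc (x +i* y0) hy0 _ e4.
  have r2 : 0 < r / 2 by lra.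
  exists (ball x (r / 2), ball y0 (r / 2)); first by split; exact: nbhsx_ballx.
  move=> [x' y] /= []; rewrite /ball /= => hx hy; rewrite /P.
  have k1 : nc (g (x' +i* y) - g (x +i* y0)) < e / 4.
    by apply: hr; apply: le_lt_trans (nc_le_ReIm _) _ => /=; rewrite (distrC x') (distrC y); lra.
  have k2 : nc (g (x' +i* y0) - g (x +i* y0)) < e / 4.
    apply: hr; apply: le_lt_trans (nc_le_ReIm _) _ => /=; rewrite (distrC x') subrr normr0; lra.
  have -> : g (x' +i* y) - g (x' +i* y0) = (g (x' +i* y) - g (x +i* y0)) - (g (x' +i* y0) - g (x +i* y0)) by ring.
  apply: le_lt_trans (ncB _ _) _; lra.
move=> /(_ _ hP)/nbhs_ballP[r /= r0 hr]; exists r => // y hy hyy.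
have hin (x : R) : 0 <= x <= 1 -> P y x.
  by move=> hx; apply: hr => /=; [rewrite /ball /= distrC|rewrite in_itv].
have cl y' : c < y' < d -> rcont (fun x => g (x +i* y')).
  by move=> h'; apply: ccont_at_line => z hz; apply: hc; rewrite hz.
rewrite /line_int; have := @nc_cint_le R (fun x => g (x +i* y) + -1 * g (x +i* y0)) 0 1 (e / 2).
rewrite cintD ?ler01 ?cintZ ?ler01 //; try exact: cl; try exact: rcontZ (cl _ _).
rewrite mulN1r subr0 mulr1 (_ : 2 * (e / 2) = e); last by field.
apply.
- by apply: rcontD; [exact: cl|apply: rcontZ; exact: cl].
- by [].
- by move=> x /hin /ltW; rewrite mulN1r.
Qed.

Lemma nc_small0 (a : C) : (forall e : R, 0 < e -> nc a <= e) -> a = 0.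
Proof.
move=> h; apply/eqP; rewrite -nc_eq0 eq_le nc_ge0 andbT.
by apply/ler_addgt0Pr => e e0; rewrite add0r; exact: h.
Qed.

(* Differentiability may fail on one horizontal line: the integrals over lines
   are constant on either side of it and continuous in the height. *)
Lemma strip_cross g c d y0 : c < y0 < d ->
  (forall z, c <= Im z <= d -> Im z != y0 -> exists D, cderiv g z D) ->
  (forall z, Im z = y0 -> ccont_at g z) ->
  (forall z, c <= Im z <= d -> g (z + 1) = g z) -> line_int g c = line_int g d.
Proof.
move=> /andP[cy yd] hd hy hp.
have hc z : c < Im z < d -> ccont_at g z.
  move=> /andP[h1 h2]; have [/hy //|ne] := eqVneq (Im z) y0.
  have [|D hD] := hd z _ ne; first by rewrite !ltW.
  exact: cderiv_cont hD.
have L : line_int g c - line_int g y0 = 0.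
  apply: nc_small0 => e e0.
  have [|r r0 hr] := line_int_cont (c := c) (d := d) (y0 := y0) _ hc e0; first by rewrite cy.
  pose y := Num.max ((c + y0) / 2) (y0 - r / 2).
  have y1 : y < y0 by rewrite /y gt_max; apply/andP; split; lra.
  have y2 : c < y by rewrite /y lt_max; apply/orP; left; lra.
  have y3 : y0 - r / 2 <= y by rewrite /y le_max lexx orbT.
  rewrite (@strip_const g c y (ltW y2)).
  - apply: hr; first by rewrite y2 (lt_trans y1).
    rewrite distrC ger0_norm; lra.
  - by move=> z /andP[h1 h2]; apply: hd; [rewrite h1 /=; lra|rewrite lt_eqF //; lra].
  - by move=> z /andP[h1 h2]; apply: hp; rewrite h1 /=; lra.
have L' : line_int g d - line_int g y0 = 0.
  apply: nc_small0 => e e0.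
  have [|r r0 hr] := line_int_cont (c := c) (d := d) (y0 := y0) _ hc e0; first by rewrite cy.
  pose y := Num.min ((d + y0) / 2) (y0 + r / 2).
  have y1 : y0 < y by rewrite /y lt_min; apply/andP; split; lra.
  have y2 : y < d by rewrite /y gt_min; apply/orP; left; lra.
  have y3 : y <= y0 + r / 2 by rewrite /y ge_min lexx orbT.
  rewrite -(@strip_const g y d (ltW y2)).
  - apply: hr; first by rewrite y2 (lt_trans cy).
    rewrite ger0_norm; lra.
  - by move=> z /andP[h1 h2]; apply: hd; [rewrite h2 andbT; lra|rewrite gt_eqF //; lra].
  - by move=> z /andP[h1 h2]; apply: hp; rewrite h2 andbT; lra.
by move/eqP: L; move/eqP: L'; rewrite !subr_eq0 => /eqP -> /eqP ->.
Qed.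

Lemma line_int_eq g f y : (forall z, Im z = y -> g z = f z) -> line_int g y = line_int f y.
Proof. by move=> h; congr cint; apply/funext => x; exact: h. Qed.

Lemma line_int_cst (a : C) y : line_int (fun=> a) y = a.
Proof. by rewrite /line_int cint_cst ?ler01 // subr0 mulr1. Qed.

Lemma ccont_at_cst (a : C) z : ccont_at (fun=> a) z.
Proof. by move=> e e0; exists 1 => // w _; rewrite subrr nc0. Qed.

Lemma line_int_cusp g (l J : C) (y0 : R) : ccvg cusp g l ->
  (forall z, y0 < Im z -> ccont_at g z) ->
  (forall y, y0 < y -> line_int g y = J) -> J = l.
Proof.
move=> /cvg_cuspP hl hc hJ; apply/eqP; rewrite -subr_eq0; apply/eqP/nc_small0 => e e0.
have e2 : 0 < e / 2 by lra.
have [Y hY] := hl _ e2; pose y := Num.max y0 Y + 1.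
have yy0 : y0 < y by rewrite /y ltr_pwDr // le_max lexx.
have yY : Y < y by rewrite /y ltr_pwDr // le_max lexx orbT.
rewrite -(hJ _ yy0) -{1}(line_int_cst l y) -line_intB.
- rewrite (_ : e = 2 * (e / 2)); last by field.
  apply: line_int_le => z hz; last by apply/ltW/hY; rewrite hz.
  move=> e' e'0; have [|r r0 hr] := hc z _ _ e'0; first by rewrite hz.
  exists r => // w /hr; rewrite (_ : g w - l - (g z - l) = g w - g z) //; ring.
- by move=> z hz; apply: hc; rewrite hz.
- by move=> z _; exact: ccont_at_cst.
Qed.

Lemma qpar_eq z w : qpar z = qpar w -> exists n : int, z = w + n%:~R.
Proof.
move=> e; have e1 : qpar (z - w) = 1 by rewrite qparD qparN e divff // qpar_neq0.
have im0 : Im (z - w) = 0.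
  by apply/eqP/negPn/negP => /qpar_neq1; rewrite e1 eqxx.
pose n := Num.floor (Re (z - w)); exists n.
pose x := Re (z - w) - n%:~R.
have E : z - w = x%:C + n%:~R.
  rewrite /x rmorphB rmorph_int subrK; apply: complex_eq => //=.
have e2 : qpar x%:C = 1 by rewrite -e1 E qparD_int.
have := floor_itv (Re (z - w)); rewrite -/n => /andP[n1 n2].
have x0 : x = 0.
  apply/eqP/negPn/negP => xn; have := @qpar_real_neq1 R x; rewrite e2 eqxx => H.
  suff : false by []. apply: H; rewrite lt_neqAle eq_sym xn /= /x subr_ge0 n1 /=.
  by move: n2; rewrite intrD /= => n2; rewrite ltrBlDl addrC; rewrite addrC in n2; exact: n2.
by rewrite -[LHS](subrK w) E x0 add0r addrC.
Qed.

(** The divided difference of [f] with respect to q has a removable singularity at z, filled by the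
    ratio of the derivatives. Continuity is enough, thanks to [strip_cross]. *)
Lemma quotient_cont f z (a b : C) : b != 0 -> cderiv f z a -> cderiv (@qpar R) z b ->
  ccont_at (fun x => if qpar x == qpar z then a / b else (f x - f z) / (qpar x - qpar z)) z.
Proof.
move=> b0 /cderivP hf /cderivP hq e e0; rewrite eqxx.
have nb : 0 < nc b by rewrite nc_gt0.
(* The first bound keeps the increment of q above |b| |h| / 2, the second makes the numerator small
   against the resulting denominator. *)
pose t := Num.min (nc b / 2) (e * nc b ^+ 2 / (4 * (nc a + nc b))).
have ab : 0 < nc a + nc b by rewrite ltr_wpDl ?nc_ge0.
have t0 : 0 < t.
  rewrite lt_min divr_gt0 //= divr_gt0 ?mulr_gt0 ?exprn_gt0 //; lra.
have t1 : t <= nc b / 2 by rewrite ge_min lexx.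
have t2 : 4 * (nc a + nc b) * t <= e * nc b ^+ 2.
  rewrite mulrC -ler_pdivlMr; last by rewrite mulr_gt0.
  by rewrite ge_min lexx orbT.
have [r1 r10 h1] := hf _ t0; have [r2 r20 h2] := hq _ t0.
exists (Num.min r1 r2); first by rewrite lt_min r10.
move=> w; rewrite lt_min => /andP[/h1 k1 /h2 k2].
move: k1 k2; rewrite [z + _]addrC subrK => k1 k2.
case: ifPn => [_|qn]; first by rewrite subrr nc0.
have B0 : qpar w - qpar z != 0 by rewrite subr_eq0.
have h0 : 0 < nc (w - z).
  by rewrite nc_gt0 subr_eq0; apply: contraNneq qn => ->.
move: k1 k2 B0; set A := f w - f z; set B := qpar w - qpar z; set h := w - z in h0 *.
move=> k1 k2 B0.
have -> : A / B - a / b = (b * (A - a * h) - a * (B - b * h)) / (B * b) by field; rewrite b0.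
have nB : nc b * nc h / 2 <= nc B.
  have : nc (b * h) <= nc (b * h - B) + nc B.
    by apply: le_trans (ncD _ _); rewrite subrK.
  rewrite nc_distC ncM => H; nra.
have num : nc (b * (A - a * h) - a * (B - b * h)) <= (nc a + nc b) * t * nc h.
  apply: le_trans (ncB _ _) _; rewrite !ncM; have := nc_ge0 a; have := nc_ge0 b; nra.
rewrite ncM ncV ncM ltr_pdivrMr; last by rewrite mulr_gt0 // nc_gt0.
apply: le_lt_trans num _.
have : 4 * (nc a + nc b) * t * nc h <= e * nc b ^+ 2 * nc h by rewrite ler_pM2r.
have : e * nc b * (nc b * nc h / 2) <= e * nc b * nc B by rewrite ler_pM2l // mulr_gt0.
have : 0 < e * nc b ^+ 2 * nc h by rewrite !mulr_gt0 // exprn_gt0.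
move: (nc a + nc b) (nc b) (nc h) (nc B) => u v x y; lra.
Qed.

Lemma cderiv_kernel w z : qpar z != qpar w ->
  exists D, cderiv (fun x => (qpar x - qpar w)^-1) z D.
Proof.
move=> h; eexists; apply: cderivV; first by rewrite subr_eq0.
apply: cderivD; [exact: cderiv_qpar|exact: cderiv_cst].
Qed.

Lemma qpar_neq_Im z w : Im z != Im w -> qpar z != qpar w.
Proof.
apply: contraNneq => /qpar_eq[n ->]; rewrite ImD (_ : Im n%:~R = 0) ?addr0 //.
by rewrite -(rmorph_int (real_complex R)).
Qed.

(** Below [w] there is no pole, so the line can be lowered indefinitely; q grows there and the
    kernel tends to 0. *)
Lemma kernel_line0 w y : y < Im w -> line_int (fun z => (qpar z - qpar w)^-1) y = 0.
Proof.
move=> yw; apply: nc_small0 => e e0.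
(* On the line Im = -t one has |q| >= 1 + t, so the kernel is at most e/2. *)
pose t := `|y| + nc (qpar w) + 2 / e.
have t0 : 0 <= t by rewrite !addr_ge0 ?nc_ge0 // divr_ge0 // ltW.
have ty : - t <= y.
  have : 0 <= 2 / e by rewrite divr_ge0 // ltW.
  have := ler_norm (- y); rewrite normrN; have := nc_ge0 (qpar w); rewrite /t; lra.
rewrite -(@strip_const _ (- t) y ty); first last.
- by move=> z _; rewrite qparD1.
- by move=> z /andP[_ h]; apply: cderiv_kernel; apply: qpar_neq_Im; rewrite lt_eqF //; lra.
rewrite (_ : e = 2 * (e / 2)); last by field.
apply: line_int_le => z hz.
  have [|D hD] := @cderiv_kernel w z; last exact: cderiv_cont hD.
  by apply: qpar_neq_Im; rewrite lt_eqF // hz; lra.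
have h1 : 1 + t <= nc (qpar z).
  rewrite nc_qpar hz mulrN opprK; apply: le_trans (expR_ge1Dx _).
  by have := @pi_ge2 R; nra.
have h2 : 2 / e <= nc (qpar z - qpar w).
  apply: le_trans (ler_ncB _ _); move: h1; have := normr_ge0 y; rewrite /t; lra.
have e2 : 0 < 2 / e by rewrite divr_gt0.
by rewrite ncV -(invf_div 2 e) lef_pV2 ?posrE //; exact: lt_le_trans h2.
Qed.

Section CuspForm.
Variable f : C -> C.
Hypotheses (fh : forall z, @upper R z -> exists D, cderiv f z D)
  (fp : forall z, @upper R z -> f (z + 1) = f z) (f0 : ccvg cusp f 0).

Lemma periodic_int z (n : int) : @upper R z -> f (z + n%:~R) = f z.
Proof.
have nat (m : nat) x : @upper R x -> f (x + m%:R) = f x.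
  elim: m x => [|m IH] x ux; first by rewrite addr0.
  rewrite -natr1 addrA fp ?IH //.
  by rewrite /upper /= ImD (_ : Im m%:R = 0) ?addr0 // -(rmorph_nat (real_complex R)).
move=> uz; case: n => m; first exact: nat.
rewrite NegzE mulrNz -[in RHS](subrK (m.+1%:R) z) nat //.
by rewrite /upper /= ImD ImN (_ : Im m.+1%:R = 0) ?subr0 // -(rmorph_nat (real_complex R)).
Qed.

(** The divided difference k of [f] with respect to q has the same integral below and above [w].
    Above, it tends to (0 - f w) / (0 - q w) at the cusp; below, the part with f w integrates to 0
    by [kernel_line0]. *)
Lemma cauchy_cusp w y : 0 < y < Im w ->
  f w = qpar w * line_int (fun z => f z * (qpar z - qpar w)^-1) y.
Proof.
move=> /andP[y0 yw]; have uw : @upper R w by exact: lt_trans yw.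
have [a ha] := fh uw; have hb := cderiv_qpar w.
have b0 : tpi * qpar w != 0 by rewrite mulf_neq0 ?two_pi_i_neq0 ?qpar_neq0.
pose k x := if qpar x == qpar w then a / (tpi * qpar w) else (f x - f w) / (qpar x - qpar w).
have kE z : Im z != Im w -> k z = (f z - f w) / (qpar z - qpar w).
  by move=> /qpar_neq_Im/negPf h; rewrite /k h.
have kd z : 0 < Im z -> qpar z != qpar w -> exists D, cderiv k z D.
  move=> uz qn; have [D1 h1] := fh uz; have [D2 h2] := cderiv_kernel qn.
  have q0 : 0 < nc (qpar z - qpar w) by rewrite nc_gt0 subr_eq0.
  have [r r0 hr] := cderiv_cont (cderiv_qpar z) q0.
  exists ((f z - f w) * D2 + (qpar z - qpar w)^-1 * (D1 + 0)).
  apply: (@near_cderiv _ (fun x => (f x - f w) * (qpar x - qpar w)^-1) _ _ _ r r0).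
    move=> x hx; rewrite /k ifN //; apply/eqP => e; have := hr x hx.
    by rewrite e nc_distC ltxx.
  apply: cderivM h2; apply: cderivD => //; exact: cderiv_cst.
have kp z : 0 < Im z -> k (z + 1) = k z by move=> uz; rewrite /k qparD1 fp.
have kc z : 0 < Im z -> ccont_at k z.
  move=> uz; have [E|/(kd z uz)[D hD]] := eqVneq (qpar z) (qpar w); last exact: cderiv_cont hD.
  (* The singular points are the translates w + n; continuity there is transported from [w] by
     periodicity. *)
  have [n zn] := qpar_eq E; move=> e e0.
  have [r r0 hr] := quotient_cont b0 ha hb e0; exists (Num.min r (Im z)); first by rewrite lt_min r0.
  move=> x; rewrite lt_min => /andP[h1 h2].
  have ux := upper_near uz h2.
  have xE : x = (x - n%:~R) + n%:~R by rewrite subrK.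
  have I0 : Im n%:~R = 0 :> R by rewrite -(rmorph_int (real_complex R)).
  have ux' : @upper R (x - n%:~R) by rewrite /upper /= ImD ImN I0 subr0.
  have := hr (x - n%:~R); rewrite (_ : x - n%:~R - w = x - z); last by rewrite zn; ring.
  have fx : f (x - n%:~R) = f x by rewrite [in RHS]xE periodic_int.
  have qx : qpar (x - n%:~R) = qpar x by rewrite [in RHS]xE qparD_int.
  by rewrite fx qx eqxx -/(k x) {3}/k E eqxx; apply.
have J y' : Im w < y' -> line_int k y' = line_int k y.
  move=> h; apply/esym/(@strip_cross _ _ _ (Im w)); first by rewrite yw.
  - by move=> z /andP[h1 _] h2; apply: kd; [exact: lt_le_trans h1|exact: qpar_neq_Im].
  - by move=> z hz; apply: kc; rewrite hz.
  - by move=> z /andP[h1 _]; apply: kp; exact: lt_le_trans h1.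
have kl : ccvg cusp k (f w / qpar w).
  apply: (@near_ccvg _ _ _ _ (fun z => (f z - f w) * (qpar z - qpar w)^-1)).
    by exists (Im w) => z hz; rewrite kE // gt_eqF.
  rewrite (_ : f w / qpar w = (0 - f w) * (0 - qpar w)^-1); last first.
    by rewrite !sub0r invrN mulrNN.
  apply: ccvgM; first by apply: ccvgB f0 _; exact: ccvg_cst.
  apply: ccvgV; first by rewrite sub0r oppr_eq0 qpar_neq0.
  by apply: ccvgB; [exact: qpar_cusp|exact: ccvg_cst].
have Jv : line_int k y = f w / qpar w.
  apply: (line_int_cusp kl (y0 := Im w)) => // z hz; apply: kc; exact: lt_trans hz.
have cK z : Im z = y -> ccont_at (fun z => (qpar z - qpar w)^-1) z.
  move=> hz; have [|D hD] := @cderiv_kernel w z; last exact: cderiv_cont hD.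
  by apply: qpar_neq_Im; rewrite lt_eqF // hz.
have cf z : Im z = y -> ccont_at (fun z => f z * (qpar z - qpar w)^-1) z.
  move=> hz; have [|D hD] := @cderiv_kernel w z.
    by apply: qpar_neq_Im; rewrite lt_eqF // hz.
  have [|D' hD'] := @fh z; first by rewrite /upper /= hz.
  exact: cderiv_cont (cderivM hD' hD).
have cK' z : Im z = y -> ccont_at (fun z => f w * (qpar z - qpar w)^-1) z.
  move=> hz; have [|D hD] := @cderiv_kernel w z; last exact: cderiv_cont (cderivZ (f w) hD).
  by apply: qpar_neq_Im; rewrite lt_eqF // hz.
move: Jv; rewrite (@line_int_eq _ (fun z => f z * (qpar z - qpar w)^-1 - f w * (qpar z - qpar w)^-1)).
  rewrite line_intB // line_intZ // kernel_line0 // mulr0 subr0 => ->.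
  by rewrite mulrC divfK // qpar_neq0.
by move=> z hz; rewrite kE ?mulrBl // hz lt_eqF.
Qed.

(** Plays the role of the Schwarz lemma in the variable q: a bound on a lower line gives decay
    proportional to q above it. *)
Lemma cusp_bound w y (B : R) : 0 < y < Im w -> (forall z, Im z = y -> nc (f z) <= B) ->
  nc (f w) <= 2 * B * (nc (qpar w) / (expR (- (2 * pi * y)) - nc (qpar w))).
Proof.
move=> hy hB; have /andP[y0 yw] := hy; rewrite (cauchy_cusp hy) ncM.
have q1 : nc (qpar w) < expR (- (2 * pi * y)).
  by rewrite nc_qpar ltr_expR ltrN2 ltr_pM2l // mulr_gt0 ?pi_gt0.
have Q0 : 0 < expR (- (2 * pi * y)) - nc (qpar w) by rewrite subr_gt0.
have B0 : 0 <= B by apply: le_trans (hB (0 +i* y) erefl); exact: nc_ge0.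
rewrite [leRHS](_ : _ = nc (qpar w) * (2 * (B / (expR (- (2 * pi * y)) - nc (qpar w))))); last by ring.
apply: ler_wpM2l; first exact: nc_ge0.
apply: line_int_le => z hz.
  have [|D hD] := @cderiv_kernel w z.
    by apply: qpar_neq_Im; rewrite lt_eqF // hz.
  have [|D' hD'] := @fh z; first by rewrite /upper /= hz.
  exact: cderiv_cont (cderivM hD' hD).
rewrite ncM ncV; apply: ler_pM; rewrite ?nc_ge0 ?invr_ge0 ?nc_ge0 //; first exact: hB.
rewrite lef_pV2 ?posrE //.
  by apply: le_trans (ler_ncB _ _); rewrite (nc_qpar z) hz.
by apply: lt_le_trans (ler_ncB _ _); rewrite (nc_qpar z) hz.
Qed.

Lemma line_bounded y : 0 < y -> exists B : R, forall z, Im z = y -> nc (f z) <= B.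
Proof.
move=> y0; have hc : continuous (fun x : R => nc (f (x +i* y))).
  move=> x; apply/cvgrPdist_lt => e e0; have [|D hD] := @fh (x +i* y); first by [].
  have [r r0 hr] := cderiv_cont hD e0; apply/nbhs_ballP; exists r => // s; rewrite /ball /= => hs.
  have h : nc (f (s +i* y) - f (x +i* y)) < e.
    apply: hr; rewrite (_ : s +i* y - x +i* y = (s - x)%:C); last by apply: complex_eq => /=; rewrite ?subrr.
    by rewrite nc_real distrC.
  rewrite ltr_norml; have := ler_ncB (f (s +i* y)) (f (x +i* y)).
  have := ler_ncB (f (x +i* y)) (f (s +i* y)); rewrite (nc_distC (f (x +i* y))) => *.
  by apply/andP; split; lra.
have [x0 _ hx0] := @EVT_max R (fun x : R => nc (f (x +i* y))) 0 1 ler01 (continuous_subspaceT hc).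
exists (nc (f (x0 +i* y))) => z hz.
pose n := Num.floor (Re z); have := floor_itv (Re z); rewrite -/n => /andP[n1 n2].
have I0 : Im n%:~R = 0 :> R by rewrite -(rmorph_int (real_complex R)).
have E : z = ((Re z - n%:~R) +i* y) + n%:~R.
  apply: complex_eq; rewrite ?ReD ?ImD /= ?I0 ?addr0 //.
  by rewrite -(rmorph_int (real_complex R)) /= subrK.
rewrite E periodic_int //; apply: hx0; rewrite in_itv /= subr_ge0 n1 /=.
move: n2; rewrite intrD /=; lra.
Qed.

(** By [cauchy_cusp], f w / q w is a line integral with kernel 1 / (q z - q w), which converges to
    the one with kernel 1 / q z as q w tends to 0. *)
Lemma cusp_div_qpar : exists l, ccvg cusp (fun z => f z / qpar z) l.
Proof.
have [B hB] := line_bounded ltr01.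
have cq z : Im z = 1 -> exists D, cderiv (fun x => f x * (qpar x)^-1) z D.
  move=> hz; have [|D hD] := @fh z; first by rewrite /upper /= hz.
  by eexists; apply: cderivM hD (cderivV (qpar_neq0 z) (cderiv_qpar z)).
exists (line_int (fun z => f z * (qpar z)^-1) 1).
have B0 : 0 <= B by apply: le_trans (hB (0 +i* 1) erefl); exact: nc_ge0.
pose q1 : R := expR (- (2 * pi * 1)); have q10 : 0 < q1 by exact: expR_gt0.
apply/cvg_cuspP => e e0.
(* For |q w| < t the denominator stays above q1/2 on the line, and the two kernels times f differ by
   at most e/4; [line_int_le] doubles this. *)
pose t := Num.min (q1 / 2) (e * q1 ^+ 2 / (8 * (B + 1))).
have B1 : 0 < 8 * (B + 1) by lra.
have t0 : 0 < t by rewrite lt_min !divr_gt0 //= ?mulr_gt0 ?exprn_gt0.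
have [Y hY] := (cvg_cuspP _ _).1 (@qpar_cusp R) t t0.
exists (Num.max 1 Y) => w; rewrite gt_max => /andP[w1 /hY]; rewrite subr0 => qw.
have qw1 : nc (qpar w) < q1 / 2 by apply: lt_le_trans qw _; rewrite ge_min lexx.
have qw2 : nc (qpar w) * (8 * (B + 1)) < e * q1 ^+ 2.
  by rewrite -ltr_pdivlMr //; apply: lt_le_trans qw _; rewrite ge_min lexx orbT.
have fw : f w / qpar w = line_int (fun z => f z * (qpar z - qpar w)^-1) 1.
  by rewrite (@cauchy_cusp w 1) ?ltr01 // mulrC mulKf // qpar_neq0.
have c1 z : Im z = 1 -> ccont_at (fun z => f z * (qpar z - qpar w)^-1) z.
  move=> hz; have [|D hD] := @cderiv_kernel w z.
    by apply: qpar_neq_Im; rewrite lt_eqF // hz.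
  have [|D' hD'] := @fh z; first by rewrite /upper /= hz.
  exact: cderiv_cont (cderivM hD' hD).
have c2 z : Im z = 1 -> ccont_at (fun z => f z * (qpar z)^-1) z.
  by move=> hz; have [D hD] := cq z hz; exact: cderiv_cont hD.
rewrite fw -line_intB //; apply: le_lt_trans (_ : 2 * (e / 4) < e); last by lra.
apply: line_int_le => z hz.
  move=> e' e'0; have e2 : 0 < e' / 2 by lra.
  have [r1 r10 h1] := c1 z hz _ e2; have [r2 r20 h2] := c2 z hz _ e2.
  exists (Num.min r1 r2); first by rewrite lt_min r10.
  move=> x; rewrite lt_min => /andP[/h1 k1 /h2 k2].
  have -> : f x / (qpar x - qpar w) - f x / qpar x - (f z / (qpar z - qpar w) - f z / qpar z) =
    (f x / (qpar x - qpar w) - f z / (qpar z - qpar w)) - (f x / qpar x - f z / qpar z) by ring.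
  apply: le_lt_trans (ncB _ _) _; lra.
have qz : nc (qpar z) = q1 by rewrite nc_qpar hz.
have qn0 := qpar_neq0 z.
have d1 : q1 / 2 <= nc (qpar z - qpar w).
  by apply: le_trans (ler_ncB _ _); rewrite qz; lra.
have dn : qpar z - qpar w != 0 by rewrite -nc_gt0; apply: lt_le_trans d1; lra.
have -> : f z * (qpar z - qpar w)^-1 - f z * (qpar z)^-1 = f z * qpar w / ((qpar z - qpar w) * qpar z).
  by field; rewrite dn qn0.
rewrite ncM ncV [nc (f z * _)]ncM [nc (_ * qpar z)]ncM qz ler_pdivrMr; last by rewrite mulr_gt0 // nc_gt0.
apply: le_trans (_ : e / 4 * (q1 / 2 * q1) <= _); last first.
  by apply: ler_wpM2l; [lra|apply: ler_wpM2r => //; exact: ltW].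
have := hB z hz; have := nc_ge0 (f z); have := nc_ge0 (qpar w).
move: (nc (f z)) (nc (qpar w)) qw2 => u v; rewrite expr2 => *; nra.
Qed.

End CuspForm.

End Strip.

(** * Modular forms *)

Section ModularForms.
Context {R : realType}.
Local Notation C := R[i].
Local Notation Re := complex.Re.
Local Notation Im := complex.Im.
Local Notation tpi := (two_pi_i R).
Local Notation g1 := (@g1 R).
Local Notation g2 := (@g2 R).
Local Notation g3 := (@g3 R).
Local Notation Delta := (@Delta R).
Local Notation cusp := (@Im_pinfty R).
Implicit Types (z w : C) (f g : C -> C) (k l : int).

(** Only the generators of the modular group occur, and the behaviour at the cusp is kept apart, so
    that the class contains the inverse of [Delta]. *)
Definition weakmod k f := [/\ forall z, @upper R z -> exists D, cderiv f z D,
  forall z, @upper R z -> f (z + 1) = f z &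
  forall z, @upper R z -> f (- z^-1) = z ^ k * f z].

Lemma Im_oppV z : Im (- z^-1) = Im z / nc z ^+ 2.
Proof. by rewrite nc_sqr ImN; case: z => x y /=; rewrite ?(mulNr, opprK). Qed.

Lemma upper_translate z (n : int) : @upper R z -> @upper R (z + n%:~R).
Proof. by rewrite /upper /= ImD -(rmorph_int (real_complex R)) /= addr0. Qed.

(** After a translation to |Re| <= 1/2, inversion divides the imaginary part by at most 1/4 + 9/16 =
    13/16. The height 3/4, below that of the corners of the fundamental domain, makes the gain
    uniform. *)
Lemma orbit_step f z : weakmod 0 f -> @upper R z -> Im z < 3 / 4 ->
  exists2 w, f w = f z & 16 / 13 * Im z <= Im w.
Proof.
move=> [fh fp fS] uz z34.
pose n := Num.floor (Re z + 2^-1); have := floor_itv (Re z + 2^-1); rewrite -/n => /andP[n1 n2].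
pose x := z + (- n)%:~R; have ux : @upper R x by exact: upper_translate.
have Imx : Im x = Im z by rewrite /x ImD -(rmorph_int (real_complex R)) /= addr0.
have Rex : Re x = Re z - n%:~R by rewrite /x ReD -(rmorph_int (real_complex R)) /= mulrNz.
exists (- x^-1); first by rewrite fS // expr0z mul1r (periodic_int fp).
rewrite Im_oppV Imx ler_pdivlMr; last by rewrite exprn_gt0 // nc_gt0; exact: upper_neq0.
have xb : Re x ^+ 2 <= 4^-1.
  by move: n2; rewrite intrD /= => n2; rewrite Rex expr2; nra.
have z0 : 0 < Im z by [].
rewrite nc_sqr Imx; nra.
Qed.

Lemma orbit_high f z : weakmod 0 f -> @upper R z ->
  exists2 w, f w = f z & 3 / 4 <= Im w.
Proof.
move=> hf uz.
have [n hn] : exists n : nat, 3 / 4 <= Im z * (16 / 13) ^+ n.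
  have z0 : 0 < Im z by [].
  have [n hn] : exists n : nat, (13 / Im z) <= n%:R.
    by exists (Num.bound (13 / Im z)); apply/ltW/archi_boundP; rewrite divr_ge0 // ltW.
  exists n; have : 1 + n%:R * (3 / 13) <= (16 / 13 : R) ^+ n.
    elim: n {hn} => [|n IH]; first by rewrite mul0r addr0 expr0.
    rewrite exprSr -natr1; have := ler0n R n; nra.
  move: hn; rewrite ler_pdivrMr // => h1 h2; have := ler0n R n; nra.
elim: n z uz hn => [|n IH] z uz hn; first by exists z; rewrite // -[Im z]mulr1.
case: (leP (3 / 4) (Im z)) => [h|h]; first by exists z.
have [w <- hw] := orbit_step hf uz h; apply: IH; last first.
  by apply: le_trans hn _; rewrite exprS mulrCA mulrA ler_wpM2r // exprn_ge0 //; lra.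
by have z0 : 0 < Im z by []; rewrite /upper /=; lra.
Qed.

(** From exp(pi/4) >= 1 + pi/4 >= 3/2 and (3/2)^4 > 5. It measures the decay of q between heights
    1/4 and 3/4. *)
Lemma expR_pi_ge5 : 5 <= expR (pi : R).
Proof.
have -> : pi = 4%:R * (pi / 4) :> R by field.
rewrite expRM_natl; have := @expR_ge1Dx R (pi / 4); have := @pi_ge2 R.
move: (expR _) => u h1 h2; have u1 : 3 / 2 <= u by lra.
have : (3 / 2) ^+ 4 <= u ^+ 4 by rewrite lerXn2r ?nnegrE //; lra.
lra.
Qed.

(* A bound [B] on the line [Im z = 1/4] gives the bound [B / 2] for [Im z >= 3/4],
   a region which every orbit meets; hence [B / 2] is a bound everywhere. *)
Theorem weight0_cusp f : weakmod 0 f -> ccvg cusp f 0 -> forall z, @upper R z -> f z = 0.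
Proof.
move=> hf f0; have [fh fp fS] := hf.
have y0 : 0 < 1 / 4 :> R by lra.
have half (B : R) : (forall z, Im z = 1 / 4 -> nc (f z) <= B) ->
    forall z, @upper R z -> nc (f z) <= B / 2.
  move=> hB z uz; have [w <- hw] := orbit_high hf uz.
  have B0 : 0 <= B by apply: le_trans (hB (0 +i* (1 / 4)) erefl); exact: nc_ge0.
  have h4 : 0 < (1 / 4 : R) < Im w by rewrite y0 /=; lra.
  apply: le_trans (cusp_bound fh fp f0 h4 hB) _.
  (* Since |q w| <= s/5, the fraction in [cusp_bound] is at most 1/4, and 2 B / 4 = B / 2. *)
  pose s : R := expR (- (2 * pi * (1 / 4))); have s0 : 0 < s by exact: expR_gt0.
  have : nc (qpar w) <= s / 5.
    rewrite nc_qpar; apply: le_trans (_ : expR (- (2 * pi * (1 / 4)) + - pi) <= _).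
      by rewrite ler_expR; have := pi_gt0 R; nra.
    rewrite expRD [expR (- pi)]expRN ler_pM2l // lef_pV2 ?posrE ?expR_gt0 //; exact: expR_pi_ge5.
  rewrite -/s; move: (nc (qpar w)) (nc_ge0 (qpar w)) => t t0 ts.
  have : t / (s - t) <= 4^-1 by rewrite ler_pdivrMr; lra.
  move: (t / (s - t)) => u hu; nra.
have [B hB] := line_bounded fh fp y0.
have bound n : forall z, @upper R z -> nc (f z) <= B / 2 / 2 ^+ n.
  elim: n => [|n IH]; first by rewrite expr0 divr1; exact: half.
  have -> : B / 2 / 2 ^+ n.+1 = B / 2 / 2 ^+ n / 2 by rewrite exprSr invfM mulrA.
  by apply: half => z hz; apply: IH; rewrite /upper /= hz.
move=> z uz; apply: nc_small0 => e e0.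
have B0 : 0 <= B by apply: le_trans (hB (0 +i* (1 / 4)) erefl); exact: nc_ge0.
have [|n hn] := @pow2_cvgy R (e / (B / 2 + 1)); first by rewrite divr_gt0 //; lra.
apply: le_trans (bound n z uz) _; have := hn n (leqnn n).
rewrite ltr_pdivlMr; last by lra.
have : 0 <= (2 ^+ n)^-1 :> R by rewrite invr_ge0 exprn_ge0.
move: ((2 ^+ n)^-1) => t; nra.
Qed.

Lemma weakmodM k l f g : weakmod k f -> weakmod l g ->
  weakmod (k + l) (fun z => f z * g z).
Proof.
move=> [f1 f2 f3] [h1 h2 h3]; split=> z uz.
- by have [a ha] := f1 z uz; have [b hb] := h1 z uz; eexists; exact: cderivM ha hb.
- by rewrite f2 // h2.
- by rewrite f3 // h3 // expfzDr ?upper_neq0 //; ring.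
Qed.

Lemma weakmodD k f g : weakmod k f -> weakmod k g -> weakmod k (fun z => f z + g z).
Proof.
move=> [f1 f2 f3] [h1 h2 h3]; split=> z uz.
- by have [a ha] := f1 z uz; have [b hb] := h1 z uz; eexists; exact: cderivD ha hb.
- by rewrite f2 // h2.
- by rewrite f3 // h3 // mulrDr.
Qed.

Lemma weakmod_cst (c : C) : weakmod 0 (fun=> c).
Proof. by split=> // z uz; [exists 0; exact: cderiv_cst|rewrite expr0z mul1r]. Qed.

Lemma weakmodZ (c : C) k f : weakmod k f -> weakmod k (fun z => c * f z).
Proof. by move=> h; have := weakmodM (weakmod_cst c) h; rewrite add0r. Qed.

Lemma weakmodX k f n : weakmod k f -> weakmod (k * n%:Z) (fun z => f z ^+ n).
Proof.
move=> h; elim: n => [|n IH]; first by rewrite mulr0; exact: weakmod_cst.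
have := weakmodM h IH; rewrite (_ : k + k * n = k * n.+1); last by rewrite intS mulrDr mulr1.
by congr weakmod; apply/funext => z; rewrite exprS.
Qed.

Lemma weakmodV k f : (forall z, @upper R z -> f z != 0) -> weakmod k f ->
  weakmod (- k) (fun z => (f z)^-1).
Proof.
move=> nz [f1 f2 f3]; split=> z uz.
- by have [a ha] := f1 z uz; eexists; exact: cderivV (nz z uz) ha.
- by rewrite f2.
- by rewrite f3 // invfM -invr_expz.
Qed.

Lemma weakmod_g2 : weakmod 4 g2.
Proof.
split=> z uz; [by move/holomorphicP: (@g2_hol R) => /(_ z uz)| |exact: g2_S].
by rewrite -(g2_T z 1).
Qed.

Lemma weakmod_g3 : weakmod 6 g3.
Proof.
split=> z uz; [by move/holomorphicP: (@g3_hol R) => /(_ z uz)| |exact: g3_S].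
by rewrite -(g3_T z 1).
Qed.

Lemma weakmod_Delta : weakmod 12 Delta.
Proof.
split=> z uz; [by eexists; exact: cderiv_Delta|exact: Delta_T|exact: Delta_S].
Qed.

Lemma Delta_cusp0 : ccvg cusp Delta 0.
Proof.
rewrite -(mulr0 1); apply: (@near_upper_cusp _ (fun z => Delta z / qpar z * qpar z)).
  by move=> z _; rewrite divfK // qpar_neq0.
by apply: ccvgM; [exact: Delta_cusp|exact: qpar_cusp].
Qed.

Lemma weight0_const f (c : C) : weakmod 0 f -> ccvg cusp f c ->
  forall z, @upper R z -> f z = c.
Proof.
move=> h hl z uz; have h' := weakmodD h (weakmod_cst (- c)).
have hl' : ccvg cusp (fun z => f z - c) 0.
  by rewrite -(subrr c); apply: ccvgB => //; exact: ccvg_cst.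
by have /eqP := weight0_cusp h' hl' uz; rewrite subr_eq0 => /eqP.
Qed.

Lemma cusp_div_Delta k f : weakmod k f -> ccvg cusp f 0 ->
  weakmod (k - 12) (fun z => f z / Delta z) /\
  exists c, ccvg cusp (fun z => f z / Delta z) c.
Proof.
move=> hf f0; split.
  by apply: weakmodM hf _; apply: weakmodV weakmod_Delta => z _; exact: Delta_neq0.
have [fh fp _] := hf; have [c hc] := cusp_div_qpar fh fp f0.
exists (c * 1^-1); apply: (@near_upper_cusp _ (fun z => f z / qpar z * (Delta z / qpar z)^-1)).
  by move=> z _; rewrite invf_div mulrA divfK // qpar_neq0.
by apply: ccvgM hc _; apply: ccvgV; [exact: oner_neq0|exact: Delta_cusp].
Qed.

(** The product f^12 Delta^(-k) is a cusp form of weight 0, hence zero, and [Delta] has no zeros. *)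
Lemma weight_neg k f (c : C) : k < 0 -> weakmod k f -> ccvg cusp f c ->
  forall z, @upper R z -> f z = 0.
Proof.
case: k => // k _ hf fc z uz.
have hF := weakmodM (weakmodX 12 hf) (weakmodX k.+1 weakmod_Delta).
have E : Negz k * 12 + 12 * k.+1 = 0 by rewrite NegzE; ring.
rewrite E in hF.
have F0 : ccvg cusp (fun z => f z ^+ 12 * Delta z ^+ k.+1) 0.
  rewrite (_ : 0 = c ^+ 12 * 0 ^+ k.+1); last by rewrite expr0n mulr0.
  by apply: ccvgM; apply: ccvgX => //; exact: Delta_cusp0.
have /eqP := weight0_cusp hF F0 uz.
by rewrite mulf_eq0 !expf_eq0 /= (negPf (Delta_neq0 z)) orbF => /eqP.
Qed.

Lemma cusp_low k f : k < 12 -> weakmod k f -> ccvg cusp f 0 ->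
  forall z, @upper R z -> f z = 0.
Proof.
move=> k12 hf f0 z uz; have [h1 [c h2]] := cusp_div_Delta hf f0.
have k0 : k - 12 < 0 by rewrite subr_lt0.
have /eqP := weight_neg k0 h1 h2 uz.
by rewrite mulf_eq0 invr_eq0 (negPf (Delta_neq0 z)) orbF => /eqP.
Qed.

(** Applying the inversion twice gives f = (-1)^k f. *)
Lemma weakmod_odd k f : odd `|k| -> weakmod k f -> forall z, @upper R z -> f z = 0.
Proof.
move=> ok [_ _ fS] z uz.
have z0 := upper_neq0 uz.
have := fS _ (upper_S uz); rewrite invrN invrK opprK (fS z uz) mulrA -expfzMl mulNr mulVf //.
have -> : (-1 : C) ^ k = -1.
  case: k ok {fS} => n /= on; first by rewrite -exprnP -signr_odd on.
  by rewrite NegzE -exprz_inv invrN1 -exprnP -signr_odd /= on.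
rewrite mulN1r => /eqP; rewrite -subr_eq0 opprK -mulr2n mulrn_eq0 /=.
by move/eqP.
Qed.

Lemma sigma_div_qpar r : ccvg cusp (fun z => sigma_series r z / qpar z) 1.
Proof.
have n0 : nc (0 : C) < 1 by rewrite nc0.
have /cderivP h := cderiv_psum (sigma_poly_bounded (R := R) r) n0.
apply/cvg_cuspP => e e0; have e2 : 0 < e / 2 by lra.
have [d d0 hd] := h _ e2.
have [Y hY] := (cvg_cuspP _ _).1 (@qpar_cusp R) d d0.
exists (Num.max 0 Y) => z; rewrite gt_max => /andP[uz /hY]; rewrite subr0 => /hd.
have s1 : sigma_coef r 1 = 1 :> C by rewrite /sigma_coef /sigma /= big_seq1 exp1n.
rewrite add0r !psum0 /= mul1r s1 mul1r {2}/sigma_coef eqxx subr0 -sigma_seriesE //.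
move=> H; apply: le_lt_trans (_ : _ <= e / 2) _; last by lra.
have q0 := qpar_neq0 z.
have -> : sigma_series r z / qpar z - 1 = (sigma_series r z - qpar z) / qpar z by field.
by rewrite ncM ncV ler_pdivrMr // nc_gt0.
Qed.

Definition g2_lim : C := 12 * (tpi / 12) ^+ 2.
Definition g3_lim : C := 8 * (tpi / 12) ^+ 3.

Lemma g2_lim_neq0 : g2_lim != 0.
Proof. by rewrite mulf_neq0 ?pnatr_eq0 // expf_neq0 // mulf_neq0 ?two_pi_i_neq0 // invr_eq0 pnatr_eq0. Qed.

Lemma g3_lim_neq0 : g3_lim != 0.
Proof. by rewrite mulf_neq0 ?pnatr_eq0 // expf_neq0 // mulf_neq0 ?two_pi_i_neq0 // invr_eq0 pnatr_eq0. Qed.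

(** The left side vanishes at the cusp, so its quotient by [Delta] is a form of weight 0, hence
    constant. The constant is the first coefficient in q, 3 * 240 + 2 * 504 = 1728. *)
Lemma Delta_g2g3 z : @upper R z ->
  (g2 z / g2_lim) ^+ 3 - (g3 z / g3_lim) ^+ 2 = 1728 * Delta z.
Proof.
move=> uz.
have h2 : weakmod 12 (fun z => g2_lim ^- 3 * g2 z ^+ 3) by apply: weakmodZ; exact: (weakmodX 3 weakmod_g2).
have h3 : weakmod 12 (fun z => - g3_lim ^- 2 * g3 z ^+ 2) by apply: weakmodZ; exact: (weakmodX 2 weakmod_g3).
have h := weakmodD h2 h3.
pose F (z : C) : C := g2_lim ^- 3 * g2 z ^+ 3 + - g3_lim ^- 2 * g3 z ^+ 2.
have FE : F z = (g2 z / g2_lim) ^+ 3 - (g3 z / g3_lim) ^+ 2.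
  rewrite /F; move: g2_lim g3_lim g2_lim_neq0 g3_lim_neq0 (g2 z) (g3 z) => a b a0 b0 c d; have c0 := a0.
  by field; rewrite ?a0 ?b0 ?c0.
pose s r z := sigma_series (R := R) r z; pose t r z := s r z / qpar z.
have F1 x : F x = (720 * t 3 x + 1008 * t 5 x + 3 * 240 ^+ 2 * t 3 x * s 3 x
   + 240 ^+ 3 * t 3 x * s 3 x * s 3 x - 504 ^+ 2 * t 5 x * s 5 x) * qpar x.
  rewrite /F /Defs.g2 /Defs.g3 -/g2_lim -/g3_lim /t /s.
  have q0 := qpar_neq0 x; move: g2_lim_neq0 g3_lim_neq0 q0 => l2 l3 q0.
  move: g2_lim g3_lim (qpar x) (sigma_series 3 x) (sigma_series 5 x) l2 l3 q0 => a b c d e a0 b0 c0.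
  by field; rewrite ?a0 ?b0 ?c0.
have s0 r : ccvg cusp (s r) 0 by exact: sigma_series_cusp.
have t1 r : ccvg cusp (t r) 1 by exact: sigma_div_qpar.
have lF : ccvg cusp (fun x => F x / qpar x) 1728.
  pose H := fun x : C => 720 * t 3 x + 1008 * t 5 x + 3 * 240 ^+ 2 * t 3 x * s 3 x
   + 240 ^+ 3 * t 3 x * s 3 x * s 3 x - 504 ^+ 2 * t 5 x * s 5 x.
  have E : (fun x => F x / qpar x) = H.
    by apply/funext => x; rewrite F1 mulfK // qpar_neq0.
  rewrite E (_ : 1728 = 720 * 1 + 1008 * 1 + 3 * 240 ^+ 2 * 1 * 0 + 240 ^+ 3 * 1 * 0 * 0 - 504 ^+ 2 * 1 * 0); last by ring.
  apply: ccvgB; [apply: ccvgD; [apply: ccvgD; [apply: ccvgD|]|]|].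
  - by apply: ccvgM => //; exact: ccvg_cst.
  - by apply: ccvgM => //; exact: ccvg_cst.
  - by apply: ccvgM => //; apply: ccvgM => //; exact: ccvg_cst.
  - by apply: ccvgM => //; apply: ccvgM => //; apply: ccvgM => //; exact: ccvg_cst.
  - by apply: ccvgM => //; apply: ccvgM => //; exact: ccvg_cst.
have F0 : ccvg cusp F 0.
  rewrite -(mulr0 1728); apply: (@near_upper_cusp _ (fun z => F z / qpar z * qpar z)).
    by move=> x _; rewrite divfK // qpar_neq0.
  by apply: ccvgM lF _; exact: qpar_cusp.
have [hD _] := cusp_div_Delta h F0.
have lD : ccvg cusp (fun x => F x / Delta x) (1728 * 1^-1).
  apply: (@near_upper_cusp _ (fun z => F z / qpar z * (Delta z / qpar z)^-1)).
    by move=> x _; rewrite invf_div mulrA divfK // qpar_neq0.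
  by apply: ccvgM lF _; apply: ccvgV; [exact: oner_neq0|exact: Delta_cusp].
have := weight0_const hD lD uz; rewrite invr1 mulr1 => E.
by rewrite -FE -E divfK // Delta_neq0.
Qed.

(* Otherwise [f^2] and [f^3] are nonzero multiples of [g2] and [g3], against
   [Delta_g2g3]. *)
Lemma weight2 f (c : C) : weakmod 2 f -> ccvg cusp f c -> forall z, @upper R z -> f z = 0.
Proof.
move=> hf fc z uz.
have [c0|c0] := eqVneq c 0; first by apply: cusp_low hf _ _ uz => //; rewrite -c0.
have key (g : C -> C) (k : nat) (L : C) : (k%:Z * 2 < 12) -> L != 0 -> weakmod (2 * k%:Z) g ->
   ccvg cusp g L -> f z ^+ k = c ^+ k * (g z / L).
  move=> k12 L0 hg gL; have h := weakmodD (weakmodX k hf) (weakmodZ (- (c ^+ k / L)) hg).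
  have hl : ccvg cusp (fun z => f z ^+ k + - (c ^+ k / L) * g z) 0.
    rewrite (_ : 0 = c ^+ k + - (c ^+ k / L) * L); last by rewrite mulNr divfK // subrr.
    apply: ccvgD; first exact: ccvgX.
    by apply: ccvgM => //; exact: ccvg_cst.
  rewrite mulrC in k12; have /eqP := cusp_low k12 h hl uz.
  by rewrite mulNr subr_eq0 => /eqP ->; ring.
have f2 := key g2 2 g2_lim isT g2_lim_neq0 weakmod_g2 (@g2_cusp R).
have f3 := key g3 3 g3_lim isT g3_lim_neq0 weakmod_g3 (@g3_cusp R).
have E := Delta_g2g3 uz.
have : c ^+ 6 * ((g2 z / g2_lim) ^+ 3 - (g3 z / g3_lim) ^+ 2) = 0.
  have -> : c ^+ 6 * ((g2 z / g2_lim) ^+ 3 - (g3 z / g3_lim) ^+ 2) =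
    (c ^+ 2 * (g2 z / g2_lim)) ^+ 3 - (c ^+ 3 * (g3 z / g3_lim)) ^+ 2 by ring.
  by rewrite -f2 -f3; ring.
rewrite E => /eqP; apply: contraTeq => _; apply: mulf_neq0; first exact: expf_neq0.
by apply: mulf_neq0; [rewrite pnatr_eq0|exact: Delta_neq0].
Qed.

End ModularForms.

(** * Modular forms as polynomials in g2 and g3 *)

Section PolynomialForms.
Context {R : realType}.
Local Notation C := R[i].
Local Notation tpi := (two_pi_i R).
Local Notation g1 := (@g1 R).
Local Notation g2 := (@g2 R).
Local Notation g3 := (@g3 R).
Local Notation Delta := (@Delta R).
Local Notation cusp := (@Im_pinfty R).
Local Notation mp := (mpoly 3 C).
Implicit Types (z w : C) (f g : C -> C) (k l : int) (P Q : mp) (a b : multinom 3).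

Definition o1 : 'I_3 := lift ord0 ord0.
Definition o2 : 'I_3 := lift ord0 (lift ord0 ord0).

Lemma wdegE a : wdeg a = (2 * a ord0 + 4 * a o1 + 6 * a o2)%N.
Proof. by rewrite /wdeg !big_ord_recl big_ord0 addn0 /= addnA. Qed.

Lemma gs_prod z (a : 'I_3 -> nat) : \prod_(i < 3) @gs R i z ^+ a i =
  g1 z ^+ a ord0 * g2 z ^+ a o1 * g3 z ^+ a o2.
Proof. by rewrite !big_ord_recl big_ord0 mulr1 mulrA. Qed.

Definition poly_form (n : nat) k f := exists P : mp,
  (forall a, a \in msupp P -> (wdeg a)%:Z = k /\ (a ord0 <= n)%N) /\
  eq_upper f (peval (@gs R) P).

Lemma poly_form_eq n k f g : eq_upper f g -> poly_form n k f -> poly_form n k g.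
Proof. by move=> fg [P [hP fP]]; exists P; split=> // z uz; rewrite -fg // fP. Qed.

Lemma poly_form0 n k : poly_form n k (fun=> 0).
Proof. by exists 0; split=> [a|z _]; rewrite ?msupp0 // /peval meval0. Qed.

Lemma poly_form_weaken n n' k f : (n <= n')%N -> poly_form n k f -> poly_form n' k f.
Proof.
move=> nn [P [hP fP]]; exists P; split=> // a /hP[-> an]; split=> //.
exact: leq_trans nn.
Qed.

Lemma poly_formD n k f g : poly_form n k f -> poly_form n k g ->
  poly_form n k (fun z => f z + g z).
Proof.
move=> [P [hP fP]] [Q [hQ gQ]]; exists (P + Q); split=> [a|z uz].
  by move/msuppD_le; rewrite mem_cat => /orP[/hP|/hQ].
by rewrite /peval mevalD fP // gQ.
Qed.

Lemma poly_formZ n k (c : C) f : poly_form n k f -> poly_form n k (fun z => c * f z).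
Proof.
move=> [P [hP fP]]; exists (c *: P); split=> [a /msuppZ_le/hP //|z uz].
by rewrite /peval mevalZ fP.
Qed.

Lemma poly_formM n n' k l f g : poly_form n k f -> poly_form n' l g ->
  poly_form (n + n') (k + l) (fun z => f z * g z).
Proof.
move=> [P [hP fP]] [Q [hQ gQ]]; exists (P * Q); split=> [a|z uz].
  move/msuppM_le => /allpairsP[[a1 a2] /= [/hP[d1 e1] /hQ[d2 e2] ->]].
  by rewrite wdegD PoszD d1 d2 mnmDE leq_add.
by rewrite /peval mevalM fP // gQ.
Qed.

Lemma poly_form_cst n (c : C) : poly_form n 0 (fun=> c).
Proof.
exists (mpolyC 3 c); split=> [a|z uz]; last by rewrite /peval mevalC.
rewrite msuppC; case: ifP => // _; rewrite inE => /eqP ->.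
by rewrite wdeg0 mnm0E.
Qed.

Lemma poly_form_X n k f m : poly_form n k f ->
  poly_form (n * m) (k * m%:Z) (fun z => f z ^+ m).
Proof.
move=> h; elim: m => [|m IH]; first by rewrite muln0 mulr0; exact: poly_form_cst.
rewrite mulnS (_ : k * m.+1 = k + k * m); last by rewrite intS mulrDr mulr1.
by apply: poly_form_eq (poly_formM h IH) => z _; rewrite exprS.
Qed.

Lemma poly_form_gs (i : 'I_3) : poly_form (i == ord0) (2 * i.+1)%:Z (@gs R i).
Proof.
exists (mpolyX C (mnm1 i)); split=> [a|z uz]; last by rewrite /peval mevalXU.
rewrite msuppX inE => /eqP ->; rewrite mnm1E; split=> //; congr Posz.
rewrite /wdeg (bigD1 i) //= big1 ?addn0 => [|j /negPf ji]; rewrite mnm1E ?eqxx ?muln1 //.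
by rewrite eq_sym ji muln0.
Qed.

Lemma poly_form_g1 : poly_form 1 2 g1.
Proof. exact: (poly_form_gs ord0). Qed.

Lemma poly_form_g2 : poly_form 0 4 g2.
Proof. exact: (poly_form_gs o1). Qed.

Lemma poly_form_g3 : poly_form 0 6 g3.
Proof. exact: (poly_form_gs o2). Qed.

Lemma poly_form_g2g3 (i j : nat) :
  poly_form 0 (4 * i + 6 * j)%N (fun z => g2 z ^+ i * g3 z ^+ j).
Proof.
have := poly_formM (poly_form_X i poly_form_g2) (poly_form_X j poly_form_g3).
by rewrite !mul0n.
Qed.

Lemma poly_form_Delta : poly_form 0 12 Delta.
Proof.
have h2 := poly_formZ (1728^-1 * (@g2_lim R) ^- 3) (poly_form_X 3 poly_form_g2).
have h3 := poly_formZ (- (1728^-1 * (@g3_lim R) ^- 2)) (poly_form_X 2 poly_form_g3).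
apply: poly_form_eq (poly_formD h2 h3) => z uz.
have key (N u v x a b : C) : N != 0 -> a != 0 -> b != 0 ->
    (u / a) ^+ 3 - (v / b) ^+ 2 = N * x ->
    N^-1 / a ^+ 3 * u ^+ 3 + - (N^-1 / b ^+ 2) * v ^+ 2 = x.
  move=> N0 a0 b0 E; apply: (mulfI N0); rewrite -E.
  by field; rewrite N0 a0 b0.
by apply: key (Delta_g2g3 uz); [rewrite pnatr_eq0|exact: g2_lim_neq0|exact: g3_lim_neq0].
Qed.

Theorem modform_poly k f (c : C) : weakmod k f -> ccvg cusp f c -> poly_form 0 k f.
Proof.
have [N] : exists N : nat, k < N%:Z by exists `|k|.+1; lia.
elim: N k f c => [|N IH] k f c kN hf fc.
  by apply: poly_form_eq (poly_form0 0 k) => z uz; rewrite (weight_neg kN hf fc uz).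
have [k0|k0] := ltP k 0; first by apply: IH hf fc; lia.
case: k => // k in kN hf k0 *; have [ok|ek] := boolP (odd k).
  by apply: poly_form_eq (poly_form0 0 _) => z uz; rewrite (weakmod_odd _ hf uz).
have [E|E] := eqVneq k 0%N.
  rewrite E in hf *; apply: poly_form_eq (poly_form_cst 0 c) => z uz.
  by rewrite (weight0_const hf fc uz).
have [E2|E2] := eqVneq k 2%N.
  rewrite E2 in hf *; apply: poly_form_eq (poly_form0 0 _) => z uz.
  by rewrite (weight2 hf fc uz).
(* One factor g3 corrects the parity of k/2; in that case k/2 >= 3, because k = 2 is already
   excluded. *)
have [i [j kE]] : exists i j, k = (4 * i + 6 * j)%N.
  have [m km] : exists m, k = m.*2 by exists k./2; rewrite even_halfK.
  have [om|em] := boolP (odd m).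
    by exists (m - 3)./2, 1%N; lia.
  by exists m./2, 0%N; lia.
pose e : C := c / (@g2_lim R ^+ i * @g3_lim R ^+ j).
have L0 : @g2_lim R ^+ i * @g3_lim R ^+ j != 0 by rewrite mulf_neq0 // expf_neq0 // ?g2_lim_neq0 ?g3_lim_neq0.
have hm : weakmod k (fun z => g2 z ^+ i * g3 z ^+ j).
  have := weakmodM (weakmodX i (@weakmod_g2 R)) (weakmodX j (@weakmod_g3 R)).
  by rewrite (_ : 4 * i%:Z + 6 * j%:Z = k) // kE; lia.
have lm : ccvg cusp (fun z => g2 z ^+ i * g3 z ^+ j) (@g2_lim R ^+ i * @g3_lim R ^+ j).
  by apply: ccvgM; apply: ccvgX; [exact: g2_cusp|exact: g3_cusp].
have hd := weakmodD hf (weakmodZ (- e) hm).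
have ld : ccvg cusp (fun z => f z + - e * (g2 z ^+ i * g3 z ^+ j)) 0.
  rewrite (_ : 0 = c + - e * (@g2_lim R ^+ i * @g3_lim R ^+ j)); last by rewrite mulNr divfK // subrr.
  by apply: ccvgD => //; apply: ccvgM => //; exact: ccvg_cst.
have [hq [c' lq]] := cusp_div_Delta hd ld.
have pq : poly_form 0 (k%:Z - 12) (fun z => (f z + - e * (g2 z ^+ i * g3 z ^+ j)) / Delta z).
  by apply: IH hq lq; lia.
have := poly_formM pq poly_form_Delta; rewrite subrK => p1.
have p2 := poly_formZ e (poly_form_g2g3 i j); rewrite -kE in p2.
apply: poly_form_eq (poly_formD p1 p2) => z uz.
by rewrite divfK ?Delta_neq0 // mulNr subrK.
Qed.

End PolynomialForms.

(** * Quasimodular forms *)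

Section QuasimodularForms.
Context {R : realType}.
Local Notation C := R[i].
Local Notation g1 := (@g1 R).
Local Notation g2 := (@g2 R).
Local Notation g3 := (@g3 R).
Local Notation cusp := (@Im_pinfty R).
Implicit Types (z w : C) (f g : C -> C) (k m : int).

(* [Mnm] without the binomial coefficients, and with [j(A,z)] cleared from the left. *)
Definition quasi (n : nat) m f := exists F : nat -> C -> C,
  [/\ forall i z, @upper R z -> exists D, cderiv (F i) z D,
      forall i, exists c, ccvg cusp (F i) c
    & forall a b c d : int, a * d - b * c = 1 -> forall z, @upper R z ->
      f ((a%:~R * z + b%:~R) / (c%:~R * z + d%:~R)) =
      (c%:~R * z + d%:~R) ^ m *
        \sum_(i < n.+1) (c%:~R / (c%:~R * z + d%:~R)) ^+ i * F i z].

Lemma det2 (S : comPzRingType) (A : 'M[S]_2) : \det A = A 0 0 * A 1 1 - A 0 1 * A 1 0.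
Proof.
rewrite (expand_det_row _ 0) !big_ord_recl big_ord0 addr0 /cofactor !det_mx11 !mxE /=.
rewrite !expr0 !expr1 /= mul1r mulN1r mulrN.
by congr (A _ _ * A _ _ - A _ _ * A _ _); apply: val_inj.
Qed.

Lemma slashE (A0 : 'M[int]_2) m f z : \det A0 = 1 ->
  slash m (map_mx intr A0 : 'M[R]_2) f z =
  ((A0 1 0)%:~R * z + (A0 1 1)%:~R) ^ (- m) *
  f (((A0 0 0)%:~R * z + (A0 0 1)%:~R) / ((A0 1 0)%:~R * z + (A0 1 1)%:~R)).
Proof.
move=> dA; rewrite /slash /moebius /autfactor det_map_mx dA !mxE !rmorph_int.
by rewrite exp1rz mul1r.
Qed.

Lemma Mnm_quasi n m f : Mnm n m f -> quasi n m f.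
Proof.
move=> [fh [F [Fh Flaw Fl]]]; exists (fun i z => 'C(n, i)%:R * F (inord i) z); split.
- move=> i z uz; have /holomorphicP/(_ z uz)[D hD] := Fh (inord i).
  by eexists; exact: cderivZ hD.
- move=> i; have /finite_limitP[c hc] := Fl (inord i).
  by exists ('C(n, i)%:R * c); apply: ccvgM => //; exact: ccvg_cst.
move=> a b c d det z uz.
pose A0 : 'M[int]_2 := \matrix_(i, j) (if i == 0 then if j == 0 then a else b
   else if j == 0 then c else d).
have dA : \det A0 = 1 by rewrite det2 !mxE.
have [j0 _] := Im_moebius det uz.
have := Flaw A0 dA z uz; rewrite slashE // /autfactor !mxE /= !rmorph_int => E.
set j := c%:~R * z + d%:~R in E j0 *.
have jm : j ^ (- m) != 0 by rewrite expfz_neq0.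
apply: (mulfI jm); rewrite E mulrA -expfzDr // addNr expr0z mul1r; apply: eq_bigr => i _; rewrite inord_val exprMn exprVn; ring.
Qed.

Lemma quasi_F0 n m f (F : nat -> C -> C) :
  (forall a b c d : int, a * d - b * c = 1 -> forall z, @upper R z ->
    f ((a%:~R * z + b%:~R) / (c%:~R * z + d%:~R)) =
    (c%:~R * z + d%:~R) ^ m *
      \sum_(i < n.+1) (c%:~R / (c%:~R * z + d%:~R)) ^+ i * F i z) ->
  eq_upper f (F 0%N).
Proof.
move=> law z uz; have det : 1 * 1 - 0 * 0 = 1 :> int by [].
have := law _ _ _ _ det z uz; rewrite !mulr0z !mulr1z mul1r !mul0r addr0 add0r divr1 => ->.
by rewrite exp1rz mul1r big_ord_recl big1 ?addr0 ?mul1r // => i _; rewrite expr0n mul0r.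
Qed.

Lemma quasi_Mnm n m f : quasi n m f -> Mnm n m f.
Proof.
move=> [F [Fh Fl Flaw]].
have f0 := quasi_F0 Flaw.
split.
  apply/holomorphicP => z uz; have [D hD] := Fh 0%N z uz; exists D.
  by apply: near_upper_cderiv uz _ hD => x ux; rewrite f0.
exists (fun i z => ('C(n, i)%:R)^-1 * F i z); split.
- move=> i; apply/holomorphicP => z uz; have [D hD] := Fh i z uz.
  by eexists; exact: cderivZ hD.
- move=> A0 dA A z uz; rewrite slashE // /autfactor !mxE /= !rmorph_int.
  have det : A0 0 0 * A0 1 1 - A0 0 1 * A0 1 0 = 1 by rewrite -det2.
  have [j0 _] := Im_moebius det uz.
  rewrite (Flaw _ _ _ _ det z uz); set j := _ * z + _.
  rewrite mulrA -expfzDr // addNr expr0z mul1r; apply: eq_bigr => i _.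
  have b0 : 'C(n, i)%:R != 0 :> C by rewrite pnatr_eq0 -lt0n bin_gt0 -ltnS.
  rewrite exprMn exprVn; move: ('C(n, i)%:R) b0 => x x0.
  rewrite !mulrA; congr (_ * _).
  by rewrite [RHS]mulrC -!mulrA mulKf.
- move=> i; apply/finite_limitP; have [c hc] := Fl i.
  by exists ('C(n, i)%:R^-1 * c); apply: ccvgM => //; exact: ccvg_cst.
Qed.

Lemma poly_inf_roots (p : {poly C}) (u : nat -> C) : injective u ->
  (forall n, p.[u n] = 0) -> p = 0.
Proof.
move=> ui pu; pose rs := [seq u n | n <- iota 0 (size p)].
apply: (@roots_geq_poly_eq0 _ p rs).
- by apply/allP => _ /mapP[n _ ->]; apply/eqP/pu.
- by rewrite map_inj_uniq // iota_uniq.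
- by rewrite size_map size_iota.
Qed.

Lemma coef_affine_exp (a b : C) i n : (i <= n)%N ->
  ((a *: 'X + b%:P) ^+ i)`_n = (i == n)%:R * a ^+ i.
Proof.
elim: i n => [|i IH] n hn; first by rewrite expr0 coef1 eq_sym mulr1.
case: n hn => // n hn; rewrite exprS mulrDl coefD -scalerAl coefZ coefXM /= coefCM.
transitivity (a * ((i == n)%:R * a ^+ i) + b * ((i == n.+1)%:R * a ^+ i)).
  by congr (a * _ + b * _); apply: IH; rewrite // ltnW.
rewrite (ltn_eqF hn) mul0r mulr0 addr0.
by rewrite exprS (_ : (i.+1 == n.+1) = (i == n)) //; ring.
Qed.

Section TopCoefficient.
Variables (n : nat) (m : int) (f : C -> C) (F : nat -> C -> C).
Hypothesis law : forall a b c d : int, a * d - b * c = 1 -> forall z, @upper R z ->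
  f ((a%:~R * z + b%:~R) / (c%:~R * z + d%:~R)) =
  (c%:~R * z + d%:~R) ^ m *
    \sum_(i < n.+1) (c%:~R / (c%:~R * z + d%:~R)) ^+ i * F i z.

Lemma translate_neq0 z (d : nat) : @upper R z -> z + d%:R != 0.
Proof. by move=> uz; apply: upper_neq0; exact: (@upper_translate R z d). Qed.

Lemma inv_translate_inj z : @upper R z -> injective (fun d : nat => (z + d%:R)^-1).
Proof.
move=> uz d d' /invr_inj/addrI/eqP; rewrite -subr_eq0 => /eqP E; apply/eqP.
by rewrite -(eqr_nat C) -subr_eq0 E.
Qed.

(** The number f (-1 / (z + 1 + d)) is expanded from z + 1 with lower row (1, d) and from z with
    lower row (1, d + 1). The two polynomials in the same 1/j agree for infinitely many d, hence
    coefficientwise. *)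
Lemma top_T z : @upper R z -> F n (z + 1) = F n z.
Proof.
move=> uz; have uz1 : @upper R (z + 1) by exact: (upper_translate 1 uz).
pose p : {poly C} := \sum_(i < n.+1) (F i (z + 1) - F i z) *: 'X^i.
have p0 : p = 0.
  apply: (poly_inf_roots (inv_translate_inj uz1)) => d.
  have n0 := translate_neq0 d uz1.
  have det (e : int) : 0 * e - (-1) * 1 = 1 by rewrite mul0r.
  have := law (det d%:Z) uz1; have := law (det (d%:Z + 1)) uz.
  rewrite !mul0r !mul1r !add0r intrD.
  have -> : z + (d%:~R + 1%:~R) = z + 1 + d%:~R by ring.
  rewrite -!pmulrn.
  move=> -> /eqP; rewrite -subr_eq0 -mulrBr mulf_eq0 expfz_eq0 (negPf n0) andbF /=.
  move=> /eqP; rewrite horner_sum -sumrB => E.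
  rewrite -[RHS]oppr0 -[in RHS]E -sumrN; apply: eq_bigr => i _.
  by rewrite hornerZ hornerXn; ring.
have := congr1 (fun q : {poly C} => q`_n) p0.
rewrite coef0 coef_sum big_ord_recr /= big1 ?add0r => [|i _].
  by rewrite coefZ coefXn eqxx mulr1 => /eqP; rewrite subr_eq0 => /eqP.
by rewrite coefZ coefXn gtn_eqF ?mulr0.
Qed.

(* With [w = -1/z] and [X = 1/(w + d)], the two expansions of [f (-1/(w + d))]
   are polynomials in [X] which agree for every integer [d]. *)
Lemma top_S z : @upper R z -> F n (- z^-1) = z ^ (m - (2 * n)%:Z) * F n z.
Proof.
move=> uz; have uw := upper_S uz; set w := - z^-1 in uw *.
have z0 := upper_neq0 uz.
pose p : {poly C} := \sum_(i < n.+1) (F i w *: 'X^i -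
   (z ^ m * F i z) *: (z ^- 2 *: 'X + (z^-1)%:P) ^+ i).
have p0 : p = 0.
  apply: (poly_inf_roots (inv_translate_inj uw)) => d.
  have n0 := translate_neq0 d uw.
  have wd : w + d%:R = (d%:R * z - 1) / z by rewrite /w; field.
  have d0 : d%:R * z - 1 != 0 by apply: contraNneq n0 => E; rewrite wd E mul0r.
  (* The point -1 / (w + d) is reached from w with rows (0, -1), (1, d), and from z with rows (-1,
     0), (d, -1). *)
  have det (e : int) : 0 * e - (-1) * 1 = 1 by rewrite mul0r.
  have det' (e : int) : (-1) * (-1) - 0 * e = 1 by rewrite mul0r.
  have := law (det d%:Z) uw; have := law (det' d%:Z) uz.
  rewrite !mul0r !mul1r !add0r addr0 -!pmulrn.
  have -> : (-1)%:~R / (w + d%:R) = (-1)%:~R * z / (d%:R * z + (-1)%:~R) :> C.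
    by rewrite wd mulrN1z; field; rewrite d0 z0.
  rewrite mulrN1z => -> /eqP; rewrite {1}(_ : d%:R * z - 1 = (w + d%:R) * z); last by rewrite wd divfK.
  rewrite expfzMl -mulrA -subr_eq0 -mulrBr mulf_eq0 expfz_eq0 (negPf n0) andbF /=.
  rewrite mulr_sumr -sumrB => /eqP E.
  rewrite horner_sum -[RHS]oppr0 -[in RHS]E -sumrN; apply: eq_bigr => i _.
  rewrite hornerD hornerN !hornerZ hornerXn horner_exp hornerD hornerZ hornerX hornerC.
  have -> : z ^- 2 * (w + d%:R)^-1 + z^-1 = d%:R / (d%:R * z - 1).
    by rewrite wd; field; rewrite d0 z0.
  by ring.
have := congr1 (fun q : {poly C} => q`_n) p0.
rewrite coef0 coef_sum big_ord_recr /= big1 ?add0r => [|i _]; last first.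
  by rewrite coefB !coefZ coefXn coef_affine_exp ?(ltnW (ltn_ord i)) // gtn_eqF // ltn_eqF // mul0r !mulr0 subr0.
rewrite coefB !coefZ coefXn coef_affine_exp // eqxx mulr1 mul1r => /eqP.
rewrite subr_eq0 => /eqP ->; by rewrite exprVn -exprM expfzDr // -exprnN mulrAC.
Qed.

End TopCoefficient.

(** [SL2_transformation] is about even natural weights; in all other weights the form is zero. *)
Lemma weakmod_SL2 k f (l : C) : weakmod k f -> ccvg cusp f l ->
  forall a b c d : int, a * d - b * c = 1 -> forall z, @upper R z ->
  f ((a%:~R * z + b%:~R) / (c%:~R * z + d%:~R)) = (c%:~R * z + d%:~R) ^ k * f z.
Proof.
move=> hf fl a b c d det z uz; have [j0 uA] := Im_moebius det uz.
have [k0|k0] := ltP k 0; first by rewrite !(weight_neg k0 hf fl) // mulr0.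
have [ok|ek] := boolP (odd `|k|); first by rewrite !(weakmod_odd ok hf) // mulr0.
case: k => // k in hf k0 ek *; have [fh fp fS] := hf.
have gT x (n : int) : @upper R x -> f (x + n%:~R) = f x by move=> ux; rewrite (periodic_int fp).
have gS x : @upper R x -> f (- x^-1) = x ^+ k * (f x + 0 / x).
  by move=> ux; rewrite mul0r addr0 fS.
rewrite (SL2_transformation ek (or_introl erefl) gT gS det uz).
by rewrite !mul0r addr0.
Qed.

Lemma g1_SL2 (a b c d : int) : a * d - b * c = 1 -> forall z, @upper R z ->
  g1 ((a%:~R * z + b%:~R) / (c%:~R * z + d%:~R)) =
  (c%:~R * z + d%:~R) ^+ 2 * (g1 z + c%:~R / (c%:~R * z + d%:~R)).
Proof.
move=> det z uz.
have gT x (n : int) : @upper R x -> g1 (x + n%:~R) = g1 x by rewrite g1_T.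
have gS x : @upper R x -> g1 (- x^-1) = x ^+ 2 * (g1 x + 1 / x).
  by move=> ux; rewrite g1_S //; field; rewrite upper_neq0.
by rewrite (@SL2_transformation R g1 2 1 isT (or_intror erefl) gT gS _ _ _ _ det z uz) mul1r.
Qed.

Theorem quasi_poly n m f : quasi n m f -> poly_form n m f.
Proof.
elim: n f => [|n IH] f [F [Fh Fl Flaw]].
  have f0 := quasi_F0 Flaw.
  have [c hc] := Fl 0%N; apply: (@poly_form_eq _ _ _ (F 0%N)); first by move=> z uz; rewrite f0.
  apply: modform_poly hc; split; first exact: Fh.
    exact: top_T Flaw.
  by move=> z uz; rewrite (top_S Flaw uz) muln0 subr0.
pose N := n.+1; have [c hc] := Fl N.
have hN : weakmod (m - (2 * N)%:Z) (F N).
  by split; [exact: Fh|exact: top_T Flaw|exact: top_S Flaw].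
have pN := poly_formM (modform_poly hN hc) (poly_form_X N (@poly_form_g1 R)).
rewrite mul1n add0n (_ : m - (2 * N)%:Z + 2 * N%:Z = m) in pN; last by rewrite PoszM subrK.
suff q' : quasi n m (fun z => f z + -1 * (F N z * g1 z ^+ N)).
  have := poly_formD (poly_form_weaken (leqnSn n) (IH _ q')) pN.
  by apply: poly_form_eq => z uz; rewrite mulN1r subrK.
(* Coefficients of f - F_N g1^N, by the binomial expansion of (g1 + c/j)^N; the one of index N
   cancels, so the depth drops. *)
exists (fun i z => F i z + (- 'C(N, i)%:R) * (F N z * g1 z ^+ (N - i))); split.
- move=> i z uz; have [D hD] := Fh i z uz; have [D' hD'] := Fh N z uz.
  have /holomorphicP/(_ z uz)[E hE] := @g1_hol R.
  by eexists; apply: cderivD hD _; apply: cderivZ; apply: cderivM hD' (cderivX _ hE).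
- move=> i; have [l hl] := Fl i; eexists; apply: ccvgD hl _.
  apply: ccvgM; first exact: ccvg_cst.
  by apply: ccvgM hc _; apply: ccvgX; exact: g1_cusp.
move=> a b c' d det z uz; have [j0 uA] := Im_moebius det uz.
rewrite (Flaw _ _ _ _ det z uz) (weakmod_SL2 hN hc det uz) (g1_SL2 det uz).
set j := c'%:~R * z + d%:~R in j0 *; set X := c'%:~R / j.
have -> : j ^ (m - (2 * N)%:Z) * F N z * (j ^+ 2 * (g1 z + X)) ^+ N =
   j ^ m * (F N z * (g1 z + X) ^+ N).
  rewrite exprMn -exprM expfzDr // -exprnN -!mulrA; congr (_ * _).
  by rewrite mulrCA (mulrA (_ ^- _)) mulVf ?expf_neq0 // mul1r.
rewrite mulrCA -mulrDr; congr (_ * _).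
rewrite exprDn [in LHS]big_ord_recr /= [X in _ + _ * (_ * X)]big_ord_recr /= subnn expr0 binn.
have aux (s1 s2 x y : C) : s1 + x * y + -1 * (y * (s2 + x)) = s1 - y * s2 by ring.
rewrite mul1r mulr1n aux.
rewrite mulr_sumr -sumrB; apply: eq_bigr => i _; rewrite -mulr_natr; ring.
Qed.

Lemma quasi_eq n m f g : eq_upper f g -> quasi n m f -> quasi n m g.
Proof.
move=> fg [F [h1 h2 h3]]; exists F; split=> // a b c d det z uz.
by rewrite -fg ?h3 //; have [] := Im_moebius det uz.
Qed.

Lemma quasiD n m f g : quasi n m f -> quasi n m g -> quasi n m (fun z => f z + g z).
Proof.
move=> [F [h1 h2 h3]] [G [k1 k2 k3]]; exists (fun i z => F i z + G i z); split.
- by move=> i z uz; have [D hD] := h1 i z uz; have [E hE] := k1 i z uz; eexists; exact: cderivD hD hE.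
- by move=> i; have [c hc] := h2 i; have [e he] := k2 i; exists (c + e); exact: ccvgD.
- move=> a b c d det z uz; rewrite h3 // k3 // -mulrDr -big_split; congr (_ * _).
  by apply: eq_bigr => i _ /=; rewrite mulrDr.
Qed.

Lemma quasiZ n m (x : C) f : quasi n m f -> quasi n m (fun z => x * f z).
Proof.
move=> [F [h1 h2 h3]]; exists (fun i z => x * F i z); split.
- by move=> i z uz; have [D hD] := h1 i z uz; eexists; exact: cderivZ hD.
- by move=> i; have [c hc] := h2 i; exists (x * c); apply: ccvgM => //; exact: ccvg_cst.
- move=> a b c d det z uz; rewrite h3 // mulrCA mulr_sumr; congr (_ * _).
  by apply: eq_bigr => i _ /=; rewrite mulrCA.
Qed.

Lemma quasi0 n m : quasi n m (fun=> 0).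
Proof.
exists (fun _ _ => 0); split.
- by move=> i z uz; exists 0; exact: cderiv_cst.
- by move=> i; exists 0; exact: ccvg_cst.
- by move=> a b c d det z uz; rewrite big1 ?mulr0 // => i _; rewrite mulr0.
Qed.

Lemma quasi_monomial n (a b c : nat) : (a <= n)%N ->
  quasi n (2 * a + 4 * b + 6 * c)%N (fun z => g1 z ^+ a * g2 z ^+ b * g3 z ^+ c).
Proof.
move=> an; exists (fun i z => 'C(a, i)%:R * (g1 z ^+ (a - i) * g2 z ^+ b * g3 z ^+ c)); split.
- move=> i z uz; have /holomorphicP/(_ z uz)[D1 h1] := @g1_hol R.
  have /holomorphicP/(_ z uz)[D2 h2] := @g2_hol R.
  have /holomorphicP/(_ z uz)[D3 h3] := @g3_hol R.
  eexists; apply: cderivZ; apply: cderivM; last exact: cderivX h3.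
  by apply: cderivM; [exact: cderivX h1|exact: cderivX h2].
- move=> i; eexists; apply: ccvgM; first exact: ccvg_cst.
  apply: ccvgM; last by apply: ccvgX; exact: g3_cusp.
  by apply: ccvgM; apply: ccvgX; [exact: g1_cusp|exact: g2_cusp].
move=> x y u v det z uz; have [j0 uA] := Im_moebius det uz.
rewrite (g1_SL2 det uz) (weakmod_SL2 (@weakmod_g2 R) (@g2_cusp R) det uz).
rewrite (weakmod_SL2 (@weakmod_g3 R) (@g3_cusp R) det uz).
set j := u%:~R * z + v%:~R in j0 *; set X := u%:~R / j.
have -> : j ^ 4 = j ^+ 4 by [].
have -> : j ^ 6 = j ^+ 6 by [].
have e (p y' : C) s t : (p ^+ s * y') ^+ t = p ^+ (s * t) * y' ^+ t by rewrite exprMn -exprM.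
rewrite -exprnP !e (exprD j (2 * a + 4 * b)) (exprD j (2 * a)).
move: (j ^+ (2 * a)) (j ^+ (4 * b)) (j ^+ (6 * c)) => ja jb jc.
transitivity (ja * jb * jc *
   ((g1 z + X) ^+ a * (g2 z ^+ b * g3 z ^+ c))); first by ring.
congr (_ * _).
rewrite exprDn (big_ord_widen n.+1 (fun i => (g1 z ^+ (a - i) * X ^+ i) *+ 'C(a, i))) //.
rewrite mulr_suml big_mkcond; apply: eq_bigr => i _.
(* Beyond a the binomial coefficient is 0, which pads the expansion up to n. *)
case: ltnP => ia; first by rewrite -mulr_natr; ring.
by rewrite bin_small // mul0r mulr0.
Qed.

Theorem poly_quasi n m f : poly_form n m f -> quasi n m f.
Proof.
move=> [P [hP fP]]; apply: (@quasi_eq _ _ (peval (@gs R) P)); first by move=> z /fP.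
have -> : peval (@gs R) P = fun z => \sum_(a <- msupp P) mcoeff a P *
    (g1 z ^+ a ord0 * g2 z ^+ a o1 * g3 z ^+ a o2).
  by apply/funext => z; rewrite /peval mevalE; apply: eq_bigr => a _; rewrite gs_prod.
elim: (msupp P) hP => [|a s IH] hP.
  by apply: quasi_eq (quasi0 n m) => z _; rewrite big_nil.
have [d0 an] := hP a (mem_head a s).
have h1 := quasiZ (mcoeff a P) (quasi_monomial (a o1) (a o2) an).
rewrite -wdegE d0 in h1.
have h2 := IH (fun b hb => hP b (mem_behead (s := a :: s) hb)).
by apply: quasi_eq (quasiD h1 h2) => z _; rewrite big_cons.
Qed.

Lemma Mnm_poly_form n m f : Mnm n m f <-> poly_form n m f.
Proof.
by split=> [/Mnm_quasi/quasi_poly|/poly_quasi/quasi_Mnm].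
Qed.

End QuasimodularForms.

(** * Algebraic independence *)

Section AlgebraicIndependence.
Context {R : realType}.
Local Notation C := R[i].
Local Notation Im := complex.Im.
Local Notation g1 := (@g1 R).
Local Notation g2 := (@g2 R).
Local Notation g3 := (@g3 R).
Local Notation cusp := (@Im_pinfty R).
Local Notation mp := (mpoly 3 C).
Implicit Types (z w : C) (P Q : mp).

Definition eval3 P (x y t : C) : C := \sum_(a <- msupp P)
  mcoeff a P * (x ^+ a ord0 * y ^+ a o1 * t ^+ a o2).

(** Substituting univariate polynomials lets each relation between values be spread, one parameter
    at a time, from infinitely many points to all of C. *)
Definition sub3 P (p q r : {poly C}) : {poly C} := \sum_(a <- msupp P)
  mcoeff a P *: (p ^+ a ord0 * q ^+ a o1 * r ^+ a o2).

Lemma sub3E P p q r x : (sub3 P p q r).[x] = eval3 P p.[x] q.[x] r.[x].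
Proof.
by rewrite horner_sum; apply: eq_bigr => a _; rewrite hornerZ !hornerM !horner_exp.
Qed.

Lemma pevalE P z : peval (@gs R) P z = eval3 P (g1 z) (g2 z) (g3 z).
Proof. by rewrite /peval mevalE; apply: eq_bigr => a _; rewrite gs_prod. Qed.

(* Kronecker substitution. *)
Lemma eval3_eq0 P : (forall u x y, x != 0 -> y != 0 -> eval3 P u x y = 0) -> P = 0.
Proof.
move=> H; pose N := msize P.
have lt a (i : 'I_3) : a \in msupp P -> (a i < N)%N.
  move=> /msize_mdeg_lt; apply: leq_ltn_trans; rewrite mdegE (bigD1 i) //=; exact: leq_addr.
pose e a := (a ord0 + N * (a o1 + N * a o2))%N.
have einj a b : a \in msupp P -> b \in msupp P -> e a = e b -> a = b.
  move=> ha hb E; have hdiv (n x y x' y' : nat) : (x < n)%N -> (x' < n)%N ->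
      (x + n * y = x' + n * y')%N -> x = x' /\ y = y'.
    move=> h h' E'; have n0 : (0 < n)%N by exact: leq_ltn_trans h.
    have yy : y = y'.
      have := congr1 (divn^~ n) E'; rewrite /= !(addnC _ (n * _)%N) !(mulnC n) !divnMDl //.
      by rewrite !divn_small // !addn0.
    by split=> //; move: E'; rewrite yy => /addIn.
  have [e0 E1] := hdiv _ _ _ _ _ (lt _ _ ha) (lt _ _ hb) E.
  have [e1 e2] := hdiv _ _ _ _ _ (lt _ _ ha) (lt _ _ hb) E1.
  apply/mnmP => i; case: i => [[|[|[|//]]]] hi.
  - by rewrite (_ : Ordinal hi = ord0) //; exact: val_inj.
  - by rewrite (_ : Ordinal hi = o1) //; exact: val_inj.
  - by rewrite (_ : Ordinal hi = o2) //; exact: val_inj.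
(* The points n + 1 are nonzero, as the hypothesis requires of the last two arguments. *)
have p0 : sub3 P 'X 'X^N 'X^(N ^ 2) = 0.
  apply: (@poly_inf_roots R _ (fun n => n.+1%:R)).
    by move=> n m /eqP; rewrite eqr_nat => /eqP[].
  move=> n; rewrite sub3E !hornerXn hornerX; apply: H; apply: expf_neq0; by rewrite pnatr_eq0.
have pE : sub3 P 'X 'X^N 'X^(N ^ 2) = \sum_(a <- msupp P) mcoeff a P *: 'X^(e a).
  apply: eq_bigr => a _; congr (_ *: _); rewrite -!exprM -!exprD; congr ('X^_).
  by rewrite /e; nia.
apply/mpolyP => a; rewrite mcoeff0; apply/eqP/negPn/negP; rewrite -mcoeff_msupp => ha.
have := congr1 (fun q : {poly C} => q`_(e a)) p0; rewrite pE coef0 coef_sum.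
rewrite (bigD1_seq a) ?msupp_uniq //= coefZ coefXn eqxx mulr1 big_seq_cond big1 ?addr0.
  by move/eqP; rewrite mcoeff_eq0 ha.
move=> b /andP[hb ba]; rewrite coefZ coefXn; case: eqP => [/einj E|_]; last by rewrite mulr0.
by move: ba; rewrite E // eqxx.
Qed.

Lemma seq_isolated (s : seq C) (l : C) : exists2 r : R, 0 < r &
  forall x, x \in s -> x != l -> r <= nc (x - l).
Proof.
elim: s => [|y s [r r0 hr]]; first by exists 1.
have [->|yl] := eqVneq y l.
  exists r => // x; rewrite inE => /orP[/eqP ->|/hr //]; by rewrite eqxx.
exists (Num.min r (nc (y - l))); first by rewrite lt_min r0 nc_gt0 subr_eq0.
move=> x; rewrite inE ge_min => /orP[/eqP -> _|/hr h /h ->//].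
by rewrite lexx orbT.
Qed.

Lemma poly_cluster_roots (p : {poly C}) (l : C) :
  (forall r : R, 0 < r -> exists x, [/\ x != l, nc (x - l) < r & p.[x] = 0]) -> p = 0.
Proof.
move=> H; apply/eqP/negPn/negP => p0.
have [s ps] := closed_field_poly_normal p.
have [r r0 hr] := seq_isolated s l; have [x [xl xr px]] := H r r0.
have xs : x \in s.
  rewrite -root_prod_XsubC; have : root p x by apply/eqP.
  by rewrite ps rootZ // lead_coef_eq0.
by have := hr x xs xl; rewrite leNgt xr.
Qed.

(** The ratio tends to its limit at the cusp but never attains it, since the normalised difference
    is a multiple of [Delta]; so its values accumulate and no nonzero polynomial vanishes on
    them. *)
Lemma poly_ratio_roots (p : {poly C}) :
  (forall z, @upper R z -> g2 z != 0 -> g3 z != 0 -> p.[g2 z ^+ 3 / g3 z ^+ 2] = 0) -> p = 0.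
Proof.
move=> H; pose l := @g2_lim R ^+ 3 / @g3_lim R ^+ 2; apply: (@poly_cluster_roots _ l) => r r0.
have c2 := @g2_cusp R; have c3 := @g3_cusp R; rewrite -/(@g2_lim R) in c2; rewrite -/(@g3_lim R) in c3.
have L20 := @g2_lim_neq0 R; have L30 := @g3_lim_neq0 R.
have cl : ccvg cusp (fun z => g2 z ^+ 3 * (g3 z ^+ 2)^-1) l.
  apply: ccvgM; first exact: ccvgX.
  by apply: ccvgV; [exact: expf_neq0|exact: ccvgX].
have [Y hY] := (cvg_cuspP _ _).1 cl r r0.
have n2 : 0 < nc (@g2_lim R) by rewrite nc_gt0.
have n3 : 0 < nc (@g3_lim R) by rewrite nc_gt0.
have [Y2 hY2] := (cvg_cuspP _ _).1 c2 _ n2; have [Y3 hY3] := (cvg_cuspP _ _).1 c3 _ n3.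
pose y := Num.max (Num.max 0 Y) (Num.max Y2 Y3) + 1; pose z : C := 0 +i* y.
have : Num.max (Num.max 0 Y) (Num.max Y2 Y3) < Im z by rewrite /= /y ltrDl.
rewrite !gt_max => /andP[/andP[uz zY] /andP[zY2 zY3]].
have g20 : g2 z != 0 by apply/eqP => e; have := hY2 z zY2; rewrite e sub0r ncN ltxx.
have g30 : g3 z != 0 by apply/eqP => e; have := hY3 z zY3; rewrite e sub0r ncN ltxx.
exists (g2 z ^+ 3 / g3 z ^+ 2); split; [|exact: hY|exact: H].
apply/eqP => E; have := Delta_g2g3 uz => D.
have : (1728 : C) * Delta z != 0 by apply: mulf_neq0; [rewrite pnatr_eq0|exact: Delta_neq0].
rewrite -D subr_eq0 => /negP; apply; apply/eqP.
have key (a b x v : C) : a != 0 -> b != 0 -> v != 0 ->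
    x ^+ 3 / v ^+ 2 = a ^+ 3 / b ^+ 2 -> (x / a) ^+ 3 = (v / b) ^+ 2.
  move=> a0 b0 v0 e; have -> : (x / a) ^+ 3 = x ^+ 3 / v ^+ 2 * (v ^+ 2 / a ^+ 3).
    by field; rewrite a0 v0.
  by rewrite e; field; rewrite a0 b0.
exact: key E.
Qed.

Theorem gs_independent : algebraically_independent (@gs R).
Proof.
move=> P HP; have H z : @upper R z -> eval3 P (g1 z) (g2 z) (g3 z) = 0.
  by move=> /HP; rewrite pevalE.
(* The matrices with rows (1, t), (c, 1 + c t): for fixed c and z they give infinitely many values
   of j. *)
have S1 z (c t : nat) : @upper R z -> let j := c%:R * z + (1 + c * t)%:R in
    eval3 P (j ^+ 2 * g1 z + c%:R * j) (j ^+ 4 * g2 z) (j ^+ 6 * g3 z) = 0.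
  move=> uz j; have det : 1 * (1 + c * t)%:Z - t%:Z * c%:Z = 1 by lia.
  have [j0 uA] := Im_moebius det uz.
  have := H _ uA; rewrite (g1_SL2 det uz) (weakmod_SL2 (@weakmod_g2 R) (@g2_cusp R) det uz).
  rewrite (weakmod_SL2 (@weakmod_g3 R) (@g3_cusp R) det uz) -!pmulrn -/j.
  rewrite -!pmulrn -/j in j0; clearbody j.
  have aux (x y : C) : j ^+ 2 * (x + y / j) = j ^+ 2 * x + y * j by field.
  have -> : j ^ 4 = j ^+ 4 by [].
  have -> : j ^ 6 = j ^+ 6 by [].
  by rewrite aux.
(* Now j is arbitrary; c is taken positive so that distinct t give distinct j. *)
have S2 z (c : nat) j : @upper R z ->
    eval3 P (j ^+ 2 * g1 z + c.+1%:R * j) (j ^+ 4 * g2 z) (j ^+ 6 * g3 z) = 0.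
  move=> uz.
  have E : sub3 P (g1 z *: 'X^2 + c.+1%:R *: 'X) (g2 z *: 'X^4) (g3 z *: 'X^6) = 0.
    apply: (@poly_inf_roots R _ (fun t => c.+1%:R * z + (1 + c.+1 * t)%:R)).
      by move=> n m /addrI/eqP; rewrite eqr_nat => /eqP; nia.
    move=> t; rewrite sub3E hornerD !hornerZ !hornerXn hornerX.
    by have := S1 z c.+1 t uz; rewrite /= mulrC (mulrC (g2 z)) (mulrC (g3 z)).
  have := congr1 (fun p : {poly C} => p.[j]) E; rewrite sub3E hornerD !hornerZ !hornerXn hornerX horner0.
  by rewrite mulrC (mulrC (g2 z)) (mulrC (g3 z)).
(* Varying c frees the first argument. *)
have S3 z j u : @upper R z -> j != 0 -> eval3 P u (j ^+ 4 * g2 z) (j ^+ 6 * g3 z) = 0.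
  move=> uz j0.
  have E : sub3 P ((j ^+ 2 * g1 z)%:P + j *: 'X) (j ^+ 4 * g2 z)%:P (j ^+ 6 * g3 z)%:P = 0.
    apply: (@poly_inf_roots R _ (fun n => n.+1%:R)).
      by move=> n m /eqP; rewrite eqr_nat => /eqP[].
    by move=> n; rewrite sub3E hornerD hornerZ hornerX !hornerC (mulrC j) S2.
  have := congr1 (fun p : {poly C} => p.[(u - j ^+ 2 * g1 z) / j]) E.
  rewrite sub3E hornerD hornerZ hornerX !hornerC => E'; rewrite -[RHS]E'; congr (eval3 P _ _ _).
  by field.
have S4 z u s : @upper R z -> g2 z != 0 -> g3 z != 0 -> s != 0 ->
    eval3 P u (s ^+ 2 * (g2 z ^+ 3 / g3 z ^+ 2)) (s ^+ 3 * (g2 z ^+ 3 / g3 z ^+ 2)) = 0.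
  (* This square root makes both remaining arguments multiples of the single ratio g2^3 / g3^2. *)
  move=> uz g20 g30 s0; pose j := sqrtc (s * g2 z / g3 z).
  have j2 : j ^+ 2 = s * g2 z / g3 z by exact: sqr_sqrtc.
  have j0 : j != 0 by rewrite -sqrf_eq0 j2 mulf_eq0 invr_eq0 (negPf g30) orbF mulf_neq0.
  rewrite -(S3 z j u uz j0); congr (eval3 P _ _ _).
    by have -> : j ^+ 4 = (s * g2 z / g3 z) ^+ 2; [rewrite -j2 -exprM|field].
  by have -> : j ^+ 6 = (s * g2 z / g3 z) ^+ 3; [rewrite -j2 -exprM|field].
(* The ratio takes enough values to be replaced by any x; the pairs (s^2 x, s^3 x) then cover all
   pairs of nonzero numbers. *)
have S5 u s x : s != 0 -> eval3 P u (s ^+ 2 * x) (s ^+ 3 * x) = 0.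
  move=> s0; have E : sub3 P u%:P (s ^+ 2 *: 'X) (s ^+ 3 *: 'X) = 0.
    by apply: poly_ratio_roots => z uz g20 g30; rewrite sub3E hornerC !hornerZ hornerX S4.
  by have := congr1 (fun p : {poly C} => p.[x]) E; rewrite sub3E hornerC !hornerZ hornerX horner0.
apply: eval3_eq0 => u x y x0 y0.
have s0 : y / x != 0 by rewrite mulf_neq0 ?invr_eq0.
rewrite -(S5 u (y / x) (x ^+ 3 / y ^+ 2) s0); congr (eval3 P _ _ _).
  by field; rewrite x0 y0.
by field; rewrite x0 y0.
Qed.

(** The sum is taken monomial by monomial, each being homogeneous with its own weight and depth. *)
Lemma Msum_peval P : Msum (peval (@gs R) P).
Proof.
pose s := msupp P; pose a i := nth mnm0 s i.
exists (size s), (fun i => a i ord0), (fun i => (wdeg (a i))%:Z),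
  (fun i => peval (@gs R) (mcoeff (a i) P *: mpolyX C (a i))); split.
  move=> i; apply/Mnm_poly_form; exists (mcoeff (a i) P *: mpolyX C (a i)); split=> // b.
  by move/msuppZ_le; rewrite msuppX inE => /eqP ->.
move=> z uz; rewrite /peval [in LHS](mpolyE P) raddf_sum /= (big_nth mnm0) big_mkord.
by [].
Qed.

Lemma Msum_exists f : Msum f -> exists P, eq_upper f (peval (@gs R) P).
Proof.
move=> [k [n [m [h [hh fh]]]]].
have /choice[Q hQ] : forall i, exists Q, eq_upper (h i) (peval (@gs R) Q).
  by move=> i; have /Mnm_poly_form[Q [_ hQ]] := hh i; exists Q.
exists (\sum_(i < k) Q i) => z uz; rewrite fh // /peval raddf_sum /=.
by apply: eq_bigr => i _; rewrite hQ.
Qed.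

End AlgebraicIndependence.

Theorem theorem1 (R : realType) :
  [/\ algebraically_independent (@gs R),
      freely_generated (@Msum R) (@gs R)
    & forall (m n : nat), (0 < m)%N -> forall f : R[i] -> R[i],
        Mnm n m%:Z f <->
        exists P : mpoly.mpoly 3 R[i],
          [/\ P \is mpoly.ishomog1 m (@wdeg 3),
              forall a, a \in mpoly.msupp P ->
                (a ord0 <= n)%N
            & eq_upper f (peval (@gs R) P)]].
Proof.
split; first exact: gs_independent.
  split; first exact: Msum_peval.
  move=> f /Msum_exists[P hP]; exists P; split=> // Q hQ.
  apply/eqP; rewrite -subr_eq0; apply/eqP/gs_independent => z uz.
  by rewrite /peval mevalB -/(peval _ P z) -/(peval _ Q z) -hP // -hQ // subrr.
move=> m n _ f; rewrite Mnm_poly_form; split=> [[P [hP fP]]|[P [hP aP fP]]]; exists P; split=> //.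
- by apply/dhomogP => a /hP[[]].
- by move=> a /hP[].
- by move=> a ha; split; [rewrite (dhomogP _ _ _ hP a ha)|exact: aP].
Qed.
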